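(* Let $R>0$, $\gamma>1$, $\alpha>0$, and let $p=R\rho\theta$, $e=\frac{R}{\gamma-1}\theta$, $g(\theta)=\sigma\theta^\alpha$, $E=\frac12u^2+e$. Let the triples $(\rho_\pm,u_\pm,\theta_\pm)$ and the constant $c\in\mathbb{R}$ be such that the Rankine--Hugoniot conditions $$c[\rho]=[\rho u],\qquad c[\rho u]=[\rho u^2+p],\qquad c[\rho E]=[\rho E u+p u]$$ are satisfied, together with the entropy condition for 1-shocks $$c+\sqrt{R\gamma\theta_-}<u_-,\qquad c<u_+<c+\sqrt{R\gamma\theta_+}.$$ Then the system $$\begin{cases}\partial_t\rho+\partial_x(\rho u)=0,\\ \partial_t(\rho u)+\partial_x(\rho u^2+p)=0,\\ \partial_t(\rho E)+\partial_x(\rho E u+p u-\sigma_s^{-1}\partial_x n)=0,\\ \partial_x^2 n=\tau^2(n-g(\theta))\end{cases}$$ supports a shock wave, that is, a solution of the form $(\rho,u,\theta,n)=(\rho,u,\theta,n)(x-ct)$ such that $$(\rho,u,\theta,n,\partial_xn)(\pm\infty)=(\rho_\pm,u_\pm,\theta_\pm,g(\theta_\pm),0).$$ The profile is unique up to translations and possesses at most one discontinuity point; if there is a discontinuity point, all of the variables $\rho$, $u$ and $\theta$ have a jump at that point.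
   Context: The unknowns are density $\rho>0$, velocity $u$, temperature $\theta>0$ and radiation intensity $n$, functions of $(x,t)$ with $x\in\mathbb{R}$; $p$ is pressure, $e$ internal energy, $E$ specific total energy. The constants $\sigma,\sigma_s,\tau$ are positive, and $\rho_\pm>0$, $\theta_\pm>0$. For a quantity $h$ depending on the state, $[h]:=h_+-h_-$ is the difference of its values at the states $(\rho_+,u_+,\theta_+)$ and $(\rho_-,u_-,\theta_-)$. Solutions of traveling wave form are understood in the following sense, with $\xi=x-ct$ and $U:=u-c$. The functions $\rho,u,\theta$ of $\xi$ are continuous and piecewise $C^1$ except possibly at finitely many jump points, where they have left limits $(\rho_\ell,u_\ell,\theta_\ell)$ and right limits $(\rho_r,u_r,\theta_r)$; the function $n$ and its first derivative are continuous on $\mathbb{R}$. The traveling wave equations $$\frac{d}{d\xi}(\rho U)=0,\quad \frac{d}{d\xi}(\rho U^2+p)=0,\quad \frac{d}{d\xi}\Bigl(\rho U\bigl(\tfrac12U^2+e\bigr)+pU-\frac1{\sigma_s}\frac{dn}{d\xi}\Bigr)=0,\quad \frac{d^2n}{d\xi^2}=\tau^2(n-g(\theta))$$ hold in the weak sense (so that, at a jump point, $\rho U$, $\rho U^2+p$ and $\rho U(\frac12U^2+e)+pU$ take equal left and right limits), and each jump is required to satisfy the admissibility (entropy) condition for 1-shocks $$\sqrt{R\gamma\theta_\ell}<U_\ell,\qquad 0<U_r<\sqrt{R\gamma\theta_r},\qquad U_\ell=u_\ell-c,\ U_r=u_r-c.$$ *)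

(* Defs.v *)
From Stdlib Require Export Reals List.
From Coquelicot Require Export Coquelicot.
Open Scope R_scope.

Record state := State { rho : R; vel : R; temp : R }.

(** A travelling wave [(rho, u, theta, n)] as a function of [xi = x - c t]. *)
Record wave := Wave { hydro : R -> state; rad : R -> R }.

Section Gas.
Variables Rg gamma alpha sigma : R.

Definition pressure (s : state) : R := Rg * rho s * temp s.
Definition internal_energy (s : state) : R := Rg / (gamma - 1) * temp s.
Definition total_energy (s : state) : R :=
  / 2 * vel s ^ 2 + internal_energy s.
Definition sound_speed (s : state) : R := sqrt (Rg * gamma * temp s).
Definition emission (s : state) : R := sigma * Rpower (temp s) alpha.

Definition rankine_hugoniot (c : R) (sm sp : state) : Prop :=
  c * (rho sp - rho sm) = rho sp * vel sp - rho sm * vel sm /\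
  c * (rho sp * vel sp - rho sm * vel sm)
    = (rho sp * vel sp ^ 2 + pressure sp) - (rho sm * vel sm ^ 2 + pressure sm) /\
  c * (rho sp * total_energy sp - rho sm * total_energy sm)
    = (rho sp * total_energy sp * vel sp + pressure sp * vel sp)
      - (rho sm * total_energy sm * vel sm + pressure sm * vel sm).

(** Fluxes in the moving frame, with [U = vel s - c]. *)
Definition mass_flux (c : R) (s : state) : R := rho s * (vel s - c).
Definition momentum_flux (c : R) (s : state) : R :=
  rho s * (vel s - c) ^ 2 + pressure s.
Definition energy_flux (c : R) (s : state) : R :=
  rho s * (vel s - c) * (/ 2 * (vel s - c) ^ 2 + internal_energy s)
  + pressure s * (vel s - c).

Definition entropy_1shock (c : R) (sl sr : state) : Prop :=
  sound_speed sl < vel sl - c /\ 0 < vel sr - c < sound_speed sr.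

End Gas.

Definition C1 (f : R -> R) : Prop :=
  forall x, ex_derive f x /\ continuous (Derive f) x.

(** [F' = G] in the sense of distributions, tested on compactly supported
    [C^1] functions.  [is_RInt] also asserts Riemann integrability. *)
Definition weak_derivative (F G : R -> R) : Prop :=
  forall (phi : R -> R) (a b : R), a < b -> C1 phi ->
    (forall x, x <= a \/ b <= x -> phi x = 0) ->
    is_RInt (fun x => F x * Derive phi x + G x * phi x) a b 0.

Definition has_one_sided_limits (f : R -> R) (x : R) : Prop :=
  (exists l, filterlim f (at_left x) (locally l)) /\
  (exists r, filterlim f (at_right x) (locally r)).

(** [C^1] off the finite set [B], with finite one-sided limits of the function
    and of its derivative at the points of [B]; jumps are allowed in [B]. *)
Definition piecewise_C1 (B : list R) (f : R -> R) : Prop :=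
  (forall x, ~ In x B -> ex_derive f x /\ continuous (Derive f) x) /\
  (forall x, In x B ->
     has_one_sided_limits f x /\ has_one_sided_limits (Derive f) x).

Definition has_jump (f : R -> R) (x : R) : Prop :=
  exists l r, l <> r /\
    filterlim f (at_left x) (locally l) /\
    filterlim f (at_right x) (locally r).

Definition state_lim (v : R -> state) (F : (R -> Prop) -> Prop) (s : state) : Prop :=
  filterlim (fun x => rho (v x)) F (locally (rho s)) /\
  filterlim (fun x => vel (v x)) F (locally (vel s)) /\
  filterlim (fun x => temp (v x)) F (locally (temp s)).

Definition state_continuous (v : R -> state) (x : R) : Prop :=
  continuous (fun y => rho (v y)) x /\
  continuous (fun y => vel (v y)) x /\
  continuous (fun y => temp (v y)) x.

Definition wave_discontinuity (w : wave) (x : R) : Prop :=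
  ~ (state_continuous (hydro w) x /\ continuous (rad w) x).

(** [J] is the set of jump points; [B] is the set of break points of the
    piecewise [C^1] structure, so that a point of [B] outside [J] is a kink. *)
Definition wave_regular (Rg gamma c : R) (w : wave) : Prop :=
  (exists J B : list R,
     piecewise_C1 B (fun x => rho (hydro w x)) /\
     piecewise_C1 B (fun x => vel (hydro w x)) /\
     piecewise_C1 B (fun x => temp (hydro w x)) /\
     (forall x, ~ In x J -> state_continuous (hydro w) x) /\
     (forall x, In x J -> exists sl sr,
        state_lim (hydro w) (at_left x) sl /\
        state_lim (hydro w) (at_right x) sr /\
        entropy_1shock Rg gamma c sl sr)) /\
  C1 (rad w).

Definition wave_equations (Rg gamma alpha sigma sigma_s tau c : R) (w : wave) : Prop :=
  weak_derivative (fun x => mass_flux c (hydro w x)) (fun _ => 0) /\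
  weak_derivative (fun x => momentum_flux Rg c (hydro w x)) (fun _ => 0) /\
  weak_derivative
    (fun x => energy_flux Rg gamma c (hydro w x) - / sigma_s * Derive (rad w) x)
    (fun _ => 0) /\
  weak_derivative (Derive (rad w))
    (fun x => tau ^ 2 * (rad w x - emission alpha sigma (hydro w x))).

Definition travelling_wave (Rg gamma alpha sigma sigma_s tau c : R) (w : wave) : Prop :=
  (forall x, 0 < rho (hydro w x) /\ 0 < temp (hydro w x)) /\
  wave_regular Rg gamma c w /\
  wave_equations Rg gamma alpha sigma sigma_s tau c w.

Definition wave_tends_to (alpha sigma : R) (w : wave) (F : (R -> Prop) -> Prop)
    (s : state) : Prop :=
  state_lim (hydro w) F s /\
  filterlim (rad w) F (locally (emission alpha sigma s)) /\
  filterlim (Derive (rad w)) F (locally 0).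

Definition shock_profile (Rg gamma alpha sigma sigma_s tau c : R) (sm sp : state)
    (w : wave) : Prop :=
  travelling_wave Rg gamma alpha sigma sigma_s tau c w /\
  wave_tends_to alpha sigma w (Rbar_locally m_infty) sm /\
  wave_tends_to alpha sigma w (Rbar_locally p_infty) sp.

(** The value of the hydrodynamic variables at a jump point carries no meaning
    and is not prescribed, so it is not compared. *)
Definition same_up_to_translation (w1 w2 : wave) : Prop :=
  exists h : R, forall x,
    rad w2 x = rad w1 (x + h) /\
    (~ wave_discontinuity w1 (x + h) -> hydro w2 x = hydro w1 (x + h)).

(* Main.v *)
From Stdlib Require Import Lra Lia Psatz Ranalysis5 PSeries_reg Classical ClassicalEpsilon.
Require Import Defs.

(** In the moving frame the fluxes of mass and momentum are constants [m] and [m a],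
    so the hydrodynamic state is a function of [U = u - c] alone. With [v] the
    difference of [U] and the sonic velocity [gamma a / (gamma + 1)], the end states
    are [v = D] on the left and [v = - D] on the right, and the energy law becomes
    [n' = K (D^2 - v^2)]. With [G v] the emission of the state [v], the radiation
    equation becomes [v v' = - b (n - G v)]: a planar system that is singular on the
    sonic line [v = 0]. Since [n'] is continuous, a jump sends [v] to [- v], and the
    entropy condition says that [v > 0] on its left.

    A profile changes from [v > 0] to [v < 0] exactly once. At a continuous passage
    through [v = 0], [n'] is maximal, hence [n = G 0], while [n] increases; as [G]
    decreases near [0], only the passage from [v > 0] to [v < 0] is compatible with
    the sign of [n''] ([sonic_crossing], [sign_change_once]). So there is at most one
    jump, and it remains to study one solution on each side. The reflection
    [(x, v, n) -> (- x, - v, - n)] exchanges the sides.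

    On one side the end state is a saddle, so [n'] has a constant sign
    ([saddle_dichotomy]). The signs on the two sides agree, and both are positive
    because [n] has to increase from [G D] to [G (- D)]. Then [v] is monotone, and
    the distance [P] of [n] and [G v] is a function of [s = D - |v|] that solves
    [P' = g + k / P], [P 0 = 0], where [k] is positive inside the interval and
    vanishes at its ends. The right-hand side decreases in [P]. This gives uniqueness
    at once ([half_profile_gap]), and existence as a uniform limit of regularised
    problems ([singular_solution]).

    Let [PL] and [PR] be the functions of the two sides. Continuity of [n] where the
    sides meet at [v = d] and [v = - d] reads [PL s + PR s = G (- D + s) - G (D - s)]
    with [s = D - d]. The derivative of the difference of the two members is
    [k (1 / PL + 1 / PR) > 0], so there is exactly one [d] ([mismatch_decreasing],
    [matched_exists]). If [d > 0], the profile has a jump; if [d = 0], it is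
    continuous, and [sonic_slope] shows that [v] still has one-sided derivatives.
    Finally [v' = - b P (D - v) / v] is a scalar autonomous equation, which is solved,
    uniquely up to translation, by inverting its time function ([flow_exists],
    [flow_unique]). *)

Set Bullet Behavior "Strict Subproofs".

(** * Calculus on the line *)

Lemma is_derive_eq (f : R -> R) (x a b : R) :
  is_derive f x a -> a = b -> is_derive f x b.
Proof. now intros H <-. Qed.

Lemma der_const (a x : R) : is_derive (fun _ : R => a) x 0.
Proof. exact (is_derive_const a x). Qed.

Lemma der_id (x : R) : is_derive (fun y : R => y) x 1.
Proof. exact (is_derive_id x). Qed.

Lemma der_plus (f g : R -> R) (x a b : R) :
  is_derive f x a -> is_derive g x b -> is_derive (fun y => f y + g y) x (a + b).
Proof. exact (is_derive_plus f g x a b). Qed.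

Lemma der_minus (f g : R -> R) (x a b : R) :
  is_derive f x a -> is_derive g x b -> is_derive (fun y => f y - g y) x (a - b).
Proof. exact (is_derive_minus f g x a b). Qed.

Lemma der_opp (f : R -> R) (x a : R) :
  is_derive f x a -> is_derive (fun y => - f y) x (- a).
Proof. exact (is_derive_opp f x a). Qed.

Lemma der_mult (f g : R -> R) (x a b : R) :
  is_derive f x a -> is_derive g x b ->
  is_derive (fun y => f y * g y) x (a * g x + f x * b).
Proof. intros Hf Hg. exact (is_derive_mult f g x a b Hf Hg Rmult_comm). Qed.

Lemma der_pow2 (f : R -> R) (x a : R) :
  is_derive f x a -> is_derive (fun y => f y ^ 2) x (2 * f x * a).
Proof.
  intros H. eapply is_derive_eq.
  - exact (is_derive_pow f 2 x a H).
  - simpl. ring.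
Qed.

Lemma der_inv (f : R -> R) (x a : R) :
  is_derive f x a -> f x <> 0 -> is_derive (fun y => / f y) x (- a / f x ^ 2).
Proof. exact (is_derive_inv f x a). Qed.

Lemma der_div (f g : R -> R) (x a b : R) :
  is_derive f x a -> is_derive g x b -> g x <> 0 ->
  is_derive (fun y => f y / g y) x ((a * g x - f x * b) / g x ^ 2).
Proof. exact (is_derive_div f g x a b). Qed.

Lemma der_comp (f g : R -> R) (x a b : R) :
  is_derive f (g x) a -> is_derive g x b -> is_derive (fun y => f (g y)) x (a * b).
Proof.
  intros Hf Hg. eapply is_derive_eq.
  - exact (is_derive_comp f g x a b Hf Hg).
  - unfold scal; simpl; unfold mult; simpl; ring.
Qed.

Lemma der_continuous (f : R -> R) (x l : R) : is_derive f x l -> continuous f x.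
Proof. intros H. apply (ex_derive_continuous f). now exists l. Qed.

(* Unification may eta-reduce a section such as [fun y => a + y]. *)
Ltac der :=
  lazymatch goal with
  | |- is_derive (Rplus ?a) ?x ?l => change (is_derive (fun y => a + y) x l); der
  | |- is_derive (Rminus ?a) ?x ?l => change (is_derive (fun y => a - y) x l); der
  | |- is_derive (Rmult ?a) ?x ?l => change (is_derive (fun y => a * y) x l); der
  | |- is_derive (Rdiv ?a) ?x ?l => change (is_derive (fun y => a / y) x l); der
  | |- is_derive (fun _ => ?a) _ _ => apply der_const
  | |- is_derive (fun y => y) _ _ => apply der_id
  | |- is_derive (fun y => _ + _) _ _ => apply der_plus; der
  | |- is_derive (fun y => _ - _) _ _ => apply der_minus; der
  | |- is_derive (fun y => - _) _ _ => apply der_opp; der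
  | |- is_derive (fun y => _ * _) _ _ => apply der_mult; der
  | |- is_derive (fun y => _ ^ 2) _ _ => apply der_pow2; der
  | |- is_derive (fun y => / _) _ _ => apply der_inv; [der | idtac]
  | |- is_derive (fun y => _ / _) _ _ => apply der_div; [der | der | idtac]
  | |- _ => try eassumption
  end.

Lemma cont_const (a x : R) : continuous (fun _ : R => a) x.
Proof. apply continuous_const. Qed.
Lemma cont_id (x : R) : continuous (fun y : R => y) x.
Proof. apply continuous_id. Qed.
Lemma cont_plus (f g : R -> R) (x : R) :
  continuous f x -> continuous g x -> continuous (fun y => f y + g y) x.
Proof. exact (continuous_plus f g x). Qed.
Lemma cont_minus (f g : R -> R) (x : R) :
  continuous f x -> continuous g x -> continuous (fun y => f y - g y) x.
Proof. exact (continuous_minus f g x). Qed.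
Lemma cont_opp (f : R -> R) (x : R) :
  continuous f x -> continuous (fun y => - f y) x.
Proof. exact (continuous_opp f x). Qed.
Lemma cont_mult (f g : R -> R) (x : R) :
  continuous f x -> continuous g x -> continuous (fun y => f y * g y) x.
Proof. exact (continuous_mult f g x). Qed.
Lemma cont_pow2 (f : R -> R) (x : R) :
  continuous f x -> continuous (fun y => f y ^ 2) x.
Proof.
  intros H. apply continuous_ext with (fun y => f y * f y).
  - intros y. simpl. ring.
  - now apply cont_mult.
Qed.
Lemma cont_comp (f g : R -> R) (x : R) :
  continuous g x -> continuous f (g x) -> continuous (fun y => f (g y)) x.
Proof. exact (continuous_comp g f x). Qed.
Lemma cont_inv (f : R -> R) (x : R) :
  continuous f x -> f x <> 0 -> continuous (fun y => / f y) x.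
Proof.
  intros H H0. apply (cont_comp Rinv f); [exact H|].
  eapply der_continuous. apply (der_inv (fun y => y)); [apply der_id | exact H0].
Qed.
Lemma cont_div (f g : R -> R) (x : R) :
  continuous f x -> continuous g x -> g x <> 0 -> continuous (fun y => f y / g y) x.
Proof. intros Hf Hg H0. apply cont_mult; [exact Hf | now apply cont_inv]. Qed.
Lemma cont_abs (f : R -> R) (x : R) :
  continuous f x -> continuous (fun y => Rabs (f y)) x.
Proof. exact (continuous_Rabs_comp f x). Qed.
Lemma le_div (a b c : R) : 0 < c -> a * c <= b -> a <= b / c.
Proof. intros Hc H. now apply (proj1 (Rle_div_r a b c Hc)). Qed.
Lemma div_le (a b c : R) : 0 < c -> a <= b * c -> a / c <= b.
Proof. intros Hc H. now apply (proj2 (Rle_div_l a b c Hc)). Qed.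
Lemma pick_right (a b c : R) : a < b -> a < c -> exists t, a < t < b /\ t < c.
Proof.
  intros H1 H2. exists ((a + Rmin b c) / 2).
  unfold Rmin. destruct (Rle_dec b c); lra.
Qed.

Lemma pick_left (a b c : R) : a < c -> b < c -> exists t, a < t < c /\ b < t.
Proof.
  intros H1 H2. exists ((c + Rmax a b) / 2).
  unfold Rmax. destruct (Rle_dec a b); lra.
Qed.

Lemma exists_below (a b : R) : exists t, t < a /\ t < b.
Proof.
  exists (Rmin a b - 1). assert (H1 := Rmin_l a b). assert (H2 := Rmin_r a b). lra.
Qed.

Lemma pick_small (a b : R) : 0 < a -> 0 < b -> exists d, 0 < d /\ d <= a /\ d <= b.
Proof.
  intros H1 H2. exists (Rmin a b). split; [now apply Rmin_pos|].
  split; [apply Rmin_l | apply Rmin_r].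
Qed.

Lemma Rmax_abs (a b : R) : Rmax a b = (a + b + Rabs (a - b)) / 2.
Proof.
  unfold Rmax, Rabs. destruct (Rle_dec a b), (Rcase_abs (a - b)); lra.
Qed.
Lemma Rmin_abs (a b : R) : Rmin a b = (a + b - Rabs (a - b)) / 2.
Proof.
  unfold Rmin, Rabs. destruct (Rle_dec a b), (Rcase_abs (a - b)); lra.
Qed.

Ltac cont :=
  lazymatch goal with
  | |- continuous (Rplus ?a) ?x => change (continuous (fun y => a + y) x); cont
  | |- continuous (Rminus ?a) ?x => change (continuous (fun y => a - y) x); cont
  | |- continuous (Rmult ?a) ?x => change (continuous (fun y => a * y) x); cont
  | |- continuous (Rdiv ?a) ?x => change (continuous (fun y => a / y) x); cont
  | |- continuous Rabs _ => apply continuous_Rabs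
  | |- continuous (fun _ => ?a) _ => apply cont_const
  | |- continuous (fun y => y) _ => apply cont_id
  | |- continuous (fun y => _ + _) _ => apply cont_plus; cont
  | |- continuous (fun y => _ - _) _ => apply cont_minus; cont
  | |- continuous (fun y => - _) _ => apply cont_opp; cont
  | |- continuous (fun y => _ * _) _ => apply cont_mult; cont
  | |- continuous (fun y => _ ^ 2) _ => apply cont_pow2; cont
  | |- continuous (fun y => Rabs _) _ => apply cont_abs; cont
  | |- continuous (fun y => / _) _ => apply cont_inv; [cont | idtac]
  | |- continuous (fun y => _ / _) _ => apply cont_div; [cont | cont | idtac]
  | |- _ => try assumption
  end.

Lemma cont_max (f g : R -> R) (x : R) :
  continuous f x -> continuous g x -> continuous (fun y => Rmax (f y) (g y)) x.
Proof.
  intros Hf Hg.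
  apply continuous_ext with (fun y => (f y + g y + Rabs (f y - g y)) / 2).
  - intros y. symmetry. apply Rmax_abs.
  - cont. lra.
Qed.
Lemma cont_min (f g : R -> R) (x : R) :
  continuous f x -> continuous g x -> continuous (fun y => Rmin (f y) (g y)) x.
Proof.
  intros Hf Hg.
  apply continuous_ext with (fun y => (f y + g y - Rabs (f y - g y)) / 2).
  - intros y. symmetry. apply Rmin_abs.
  - cont. lra.
Qed.

(** ** Limits in epsilon form *)

Lemma lim_locally (F : (R -> Prop) -> Prop) {FF : Filter F} (f : R -> R) (l : R) :
  filterlim f F (locally l) <-> forall e, 0 < e -> F (fun x => Rabs (f x - l) < e).
Proof.
  rewrite filterlim_locally. split.
  - intros H e He. exact (H (mkposreal e He)).
  - intros H e. exact (H e (cond_pos e)).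
Qed.

Lemma locally_R (x : R) (P : R -> Prop) :
  locally x P <-> exists d, 0 < d /\ forall y, Rabs (y - x) < d -> P y.
Proof.
  split.
  - intros [d H]. exists d. split; [apply cond_pos | exact H].
  - intros [d [Hd H]]. now exists (mkposreal d Hd).
Qed.

Lemma at_left_R (x : R) (P : R -> Prop) :
  at_left x P <-> exists d, 0 < d /\ forall y, x - d < y < x -> P y.
Proof.
  unfold at_left, within. rewrite locally_R. split.
  - intros [d [Hd H]]. exists d. split; [exact Hd|]. intros y Hy. apply H; [|lra].
    apply Rabs_def1; lra.
  - intros [d [Hd H]]. exists d. split; [exact Hd|]. intros y Hy Hl. apply H.
    apply Rabs_def2 in Hy. lra.
Qed.

Lemma at_right_R (x : R) (P : R -> Prop) :
  at_right x P <-> exists d, 0 < d /\ forall y, x < y < x + d -> P y.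
Proof.
  unfold at_right, within. rewrite locally_R. split.
  - intros [d [Hd H]]. exists d. split; [exact Hd|]. intros y Hy. apply H; [|lra].
    apply Rabs_def1; lra.
  - intros [d [Hd H]]. exists d. split; [exact Hd|]. intros y Hy Hl. apply H.
    apply Rabs_def2 in Hy. lra.
Qed.

Lemma cont_eps (f : R -> R) (x : R) :
  continuous f x <->
  forall e, 0 < e -> exists d, 0 < d /\ forall y, Rabs (y - x) < d -> Rabs (f y - f x) < e.
Proof.
  unfold continuous. rewrite (lim_locally (locally x)). split; intros H e He.
  - exact (proj1 (locally_R _ _) (H e He)).
  - exact (proj2 (locally_R _ _) (H e He)).
Qed.

Lemma lim_minf (f : R -> R) (l : R) :
  filterlim f (Rbar_locally m_infty) (locally l) <->
  forall e, 0 < e -> exists M, forall x, x < M -> Rabs (f x - l) < e.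
Proof. apply (lim_locally (Rbar_locally m_infty)). Qed.

Lemma lim_pinf (f : R -> R) (l : R) :
  filterlim f (Rbar_locally p_infty) (locally l) <->
  forall e, 0 < e -> exists M, forall x, M < x -> Rabs (f x - l) < e.
Proof. apply (lim_locally (Rbar_locally p_infty)). Qed.

Lemma lim_left (f : R -> R) (x l : R) :
  filterlim f (at_left x) (locally l) <->
  forall e, 0 < e -> exists d, 0 < d /\ forall y, x - d < y < x -> Rabs (f y - l) < e.
Proof.
  rewrite (lim_locally (at_left x)). split; intros H e He; specialize (H e He); now apply at_left_R.
Qed.

Lemma lim_right (f : R -> R) (x l : R) :
  filterlim f (at_right x) (locally l) <->
  forall e, 0 < e -> exists d, 0 < d /\ forall y, x < y < x + d -> Rabs (f y - l) < e.
Proof.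
  rewrite (lim_locally (at_right x)). split; intros H e He; specialize (H e He); now apply at_right_R.
Qed.

Lemma cont_at_left (f : R -> R) (x : R) :
  continuous f x -> filterlim f (at_left x) (locally (f x)).
Proof.
  intros H. eapply filterlim_filter_le_1; [|exact H]. apply filter_le_within.
Qed.

Lemma cont_at_right (f : R -> R) (x : R) :
  continuous f x -> filterlim f (at_right x) (locally (f x)).
Proof.
  intros H. eapply filterlim_filter_le_1; [|exact H]. apply filter_le_within.
Qed.

Lemma lim_unique_R (F : (R -> Prop) -> Prop) {FF : ProperFilter F} (f : R -> R) (a b : R) :
  filterlim f F (locally a) -> filterlim f F (locally b) -> a = b.
Proof. intros Ha Hb. exact (filterlim_locally_unique f a b Ha Hb). Qed.

Lemma cont_pos_near (f : R -> R) (x : R) :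
  continuous f x -> 0 < f x -> exists d, 0 < d /\ forall y, Rabs (y - x) < d -> 0 < f y.
Proof.
  intros H H0. destruct (proj1 (cont_eps f x) H _ H0) as [d [Hd Hf]].
  exists d. split; [exact Hd|]. intros y Hy. specialize (Hf y Hy).
  apply Rabs_def2 in Hf. lra.
Qed.

(** ** Monotonicity and barriers *)

Lemma mean_value (f df : R -> R) (a b : R) :
  a < b -> (forall x, a <= x <= b -> continuous f x) ->
  (forall x, a < x < b -> is_derive f x (df x)) ->
  exists x, a < x < b /\ f b - f a = df x * (b - a).
Proof.
  intros Hab Hc Hd.
  assert (pr : forall x, a < x < b -> derivable_pt f x).
  { intros x Hx. exists (df x). now apply is_derive_Reals, Hd. }
  assert (Hc' : forall x, a <= x <= b -> continuity_pt f x).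
  { intros x Hx. now apply continuity_pt_filterlim, Hc. }
  assert (pr2 : forall x, a < x < b -> derivable_pt id x).
  { intros x Hx. apply derivable_pt_id. }
  destruct (MVT f id a b pr pr2 Hab Hc') as [x [Hx He]].
  - intros x Hx. apply derivable_continuous_pt, derivable_pt_id.
  - exists x. split; [exact Hx|].
    rewrite (proj2 (derive_pt_eq _ _ _ (pr2 x Hx)) (derivable_pt_lim_id x)) in He.
    rewrite (proj2 (derive_pt_eq _ _ _ (pr x Hx)) (proj1 (is_derive_Reals _ _ _) (Hd x Hx))) in He.
    unfold id in He. lra.
Qed.

Lemma nondecreasing_of_derive (f df : R -> R) (a b : R) :
  a <= b -> (forall x, a <= x <= b -> continuous f x) ->
  (forall x, a < x < b -> is_derive f x (df x) /\ 0 <= df x) -> f a <= f b.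
Proof.
  intros [Hab | ->] Hc Hd; [|lra].
  destruct (mean_value f df a b Hab Hc) as [x [Hx He]].
  - intros x Hx. now apply Hd.
  - assert (0 <= df x) by now apply Hd. nra.
Qed.

Lemma increasing_of_derive (f df : R -> R) (a b : R) :
  a < b -> (forall x, a <= x <= b -> continuous f x) ->
  (forall x, a < x < b -> is_derive f x (df x) /\ 0 < df x) -> f a < f b.
Proof.
  intros Hab Hc Hd.
  destruct (mean_value f df a b Hab Hc) as [x [Hx He]].
  - intros x Hx. now apply Hd.
  - assert (0 < df x) by now apply Hd. nra.
Qed.

Lemma constant_of_derive (f : R -> R) (a b : R) :
  a <= b -> (forall x, a <= x <= b -> continuous f x) ->
  (forall x, a < x < b -> is_derive f x 0) -> f a = f b.
Proof.
  intros [Hab | ->] Hc Hd; [|lra].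
  destruct (mean_value f (fun _ => 0) a b Hab Hc Hd) as [x [Hx He]]. lra.
Qed.

(** Takes the supremum of the points where [f] is nonnegative. *)
Lemma last_nonneg (f : R -> R) (a b : R) :
  a <= b -> (forall x, a <= x <= b -> continuous f x) -> 0 <= f a -> f b < 0 ->
  exists m, a <= m < b /\ f m = 0 /\ forall x, m < x <= b -> f x < 0.
Proof.
  intros Hab Hc Ha Hb.
  pose (S := fun x => a <= x <= b /\ 0 <= f x).
  destruct (completeness S) as [m [Hub Hlub]].
  { exists b. intros x [Hx _]. lra. }
  { exists a. split; lra. }
  assert (Ham : a <= m) by (apply Hub; split; lra).
  assert (Hmx : m <= b) by (apply Hlub; intros x [Hx _]; lra).
  assert (Habove : forall x, m < x <= b -> f x < 0).
  { intros x Hx. apply Rnot_le_lt. intros H0.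
    assert (x <= m) by (apply Hub; split; lra). lra. }
  assert (Hm : 0 <= f m).
  { apply Rnot_lt_le. intros Hm.
    destruct (cont_pos_near (fun x => - f x) m) as [d [Hd0 Hnear]].
    - apply cont_opp, Hc. lra.
    - lra.
    - assert (m <= m - d); [|lra]. apply Hlub. intros x [Hx H0].
      apply Rnot_lt_le. intros Hlt.
      assert (x <= m) by (apply Hub; split; lra).
      assert (0 < - f x) by (apply Hnear, Rabs_def1; lra). lra. }
  assert (Hlt : m < b) by (destruct Hmx as [| ->]; lra).
  exists m. split; [lra|]. split; [|exact Habove].
  apply Rle_antisym; [|exact Hm]. apply Rnot_lt_le. intros Hp.
  destruct (cont_pos_near f m) as [d [Hd0 Hnear]]; [apply Hc; lra | lra |].
  destruct (pick_right m (m + d) b) as [t [Ht1 Ht2]]; [lra | lra |].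
  assert (0 < f t) by (apply Hnear, Rabs_def1; lra).
  assert (f t < 0) by (apply Habove; lra). lra.
Qed.

(** After its last zero before a negative value, [f] would be nondecreasing and
    negative. *)
Lemma nonneg_of_barrier (f df : R -> R) (a b : R) :
  (forall x, a <= x <= b -> continuous f x) ->
  (forall x, a < x < b -> f x < 0 -> is_derive f x (df x) /\ 0 <= df x) ->
  0 <= f a -> forall x, a <= x <= b -> 0 <= f x.
Proof.
  intros Hc Hd Ha x1 Hx1.
  destruct (Rle_or_lt 0 (f x1)) as [H | Hneg]; [exact H|]. exfalso.
  destruct (last_nonneg f a x1) as [m [Hm [Hm0 Habove]]]; [lra | | exact Ha | exact Hneg |].
  { intros x Hx. apply Hc. lra. }
  assert (f m <= f x1); [|lra].
  apply nondecreasing_of_derive with df; [lra | |].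
  - intros x Hx. apply Hc. lra.
  - intros x Hx. apply Hd; [lra|]. apply Habove. lra.
Qed.

Lemma derive_pos_right (f : R -> R) (x l : R) :
  is_derive f x l -> 0 < l ->
  exists d, 0 < d /\ forall y, x < y < x + d -> f x < f y.
Proof.
  intros H Hl. apply is_derive_Reals in H.
  destruct (H l Hl) as [[d Hd] Hy]. simpl in Hy. exists d. split; [exact Hd|].
  intros y Hyx. specialize (Hy (y - x)). replace (x + (y - x)) with y in Hy by ring.
  assert (Hq : Rabs ((f y - f x) / (y - x) - l) < l).
  { apply Hy; [lra|]. rewrite Rabs_right; lra. }
  apply Rabs_def2 in Hq. destruct Hq as [_ Hq].
  assert (0 < (f y - f x) / (y - x)) by lra.
  assert (0 < (f y - f x) / (y - x) * (y - x)) by (apply Rmult_lt_0_compat; lra).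
  replace ((f y - f x) / (y - x) * (y - x)) with (f y - f x) in * by (field; lra). lra.
Qed.

Lemma derive_pos_left (f : R -> R) (x l : R) :
  is_derive f x l -> 0 < l ->
  exists d, 0 < d /\ forall y, x - d < y < x -> f y < f x.
Proof.
  intros H Hl.
  destruct (derive_pos_right (fun y => - f (- y)) (- x) l) as [d [Hd Hy]].
  - eapply is_derive_eq.
    + apply der_opp. apply (der_comp f (fun y => - y)).
      * rewrite Ropp_involutive. exact H.
      * der.
    + ring.
  - exact Hl.
  - exists d. split; [exact Hd|]. intros y Hyx. specialize (Hy (- y)).
    rewrite !Ropp_involutive in Hy. lra.
Qed.

(** Unlike [nonneg_of_barrier] this needs the derivative only at the zeros of [f], but
    with a strict sign: right after its last zero [f] would be positive. *)
Lemma nonneg_of_upcrossing (f df : R -> R) (a b : R) :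
  a <= b -> (forall x, a <= x <= b -> continuous f x) ->
  (forall x, a <= x < b -> f x = 0 -> is_derive f x (df x) /\ 0 < df x) ->
  0 <= f a -> 0 <= f b.
Proof.
  intros Hab Hc Hd Ha. apply Rnot_lt_le. intros Hb.
  destruct (last_nonneg f a b Hab Hc Ha Hb) as [m [Hm [Hm0 Hneg]]].
  destruct (Hd m Hm Hm0) as [Hdm Hpos].
  destruct (derive_pos_right f m (df m) Hdm Hpos) as [d [Hd0 Hr]].
  destruct (pick_right m (m + d) b) as [t [Ht1 Ht2]]; [lra | lra |].
  assert (f m < f t) by (apply Hr; lra).
  assert (f t < 0) by (apply Hneg; lra). lra.
Qed.

Lemma intermediate_value (f : R -> R) (a b y : R) :
  a <= b -> (forall x, a <= x <= b -> continuous f x) ->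
  f a <= y <= f b -> exists x, a <= x <= b /\ f x = y.
Proof.
  intros Hab Hc Hy.
  pose (g := fun x => f (Rmax a (Rmin x b)) - y).
  assert (Hg : continuity g).
  { intros x. apply continuity_pt_filterlim. apply cont_minus; [|apply cont_const].
    apply (cont_comp f (fun x => Rmax a (Rmin x b))).
    - apply cont_max; [apply cont_const|]. apply cont_min; [apply cont_id | apply cont_const].
    - apply Hc. unfold Rmax, Rmin. repeat destruct (Rle_dec _ _); lra. }
  assert (Ea : Rmax a (Rmin a b) = a).
  { rewrite Rmin_left by lra. apply Rmax_left. lra. }
  assert (Eb : Rmax a (Rmin b b) = b).
  { rewrite Rmin_left by lra. apply Rmax_right. lra. }
  destruct (IVT_cor g a b Hg Hab) as [x [Hx He]].
  - unfold g. rewrite Ea, Eb. nra.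
  - exists x. split; [exact Hx|]. unfold g in He.
    rewrite Rmin_left, Rmax_right in He; lra.
Qed.

(** ** Sequences and uniform limits *)

Lemma Lim_seq_of_modulus (u : nat -> R) (e : nat -> R) :
  is_lim_seq e 0 -> (forall n m, (n <= m)%nat -> Rabs (u m - u n) <= e n) ->
  forall n, Rabs (u n - Lim_seq u) <= e n.
Proof.
  intros He Hu n.
  assert (Hfin : ex_finite_lim_seq u).
  { apply ex_lim_seq_cauchy_corr. intros eps.
    apply is_lim_seq_spec in He. destruct (He (pos_div_2 eps)) as [N HN].
    exists N. intros p q Hp Hq.
    specialize (HN N (Nat.le_refl N)). simpl in HN. apply Rabs_def2 in HN.
    assert (H1 := Hu N p Hp). assert (H2 := Hu N q Hq).
    apply Rabs_le_between in H1. apply Rabs_le_between in H2.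
    apply Rabs_def1; lra. }
  apply Lim_seq_correct' in Hfin.
  assert (H : Rbar_le (Rabs (Lim_seq u - u n)) (e n)).
  { apply (is_lim_seq_le_loc (fun m => Rabs (u m - u n)) (fun _ => e n)).
    - exists n. intros m Hm. now apply Hu.
    - apply (is_lim_seq_abs (fun m => u m - u n) (Lim_seq u - u n)).
      apply is_lim_seq_minus'; [exact Hfin | apply is_lim_seq_const].
    - apply is_lim_seq_const. }
  simpl in H. now rewrite Rabs_minus_sym.
Qed.

Lemma cont_of_uniform (u : nat -> R -> R) (l w : R -> R) (e : nat -> R) (x : R) :
  is_lim_seq e 0 -> continuous w x ->
  (forall n y, Rabs (u n y - l y) <= e n * w y) ->
  (forall n, continuous (u n) x) -> continuous l x.
Proof.
  intros He Hw Hl Hu. apply cont_eps. intros eps Heps.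
  pose (W := Rabs (w x) + 1).
  assert (HW : 0 < W) by (unfold W; assert (H := Rabs_pos (w x)); lra).
  assert (Hpos : 0 < eps / (4 * W)) by (apply Rdiv_lt_0_compat; lra).
  apply is_lim_seq_spec in He. destruct (He (mkposreal _ Hpos)) as [N HN].
  specialize (HN N (Nat.le_refl N)). simpl in HN. rewrite Rminus_0_r in HN.
  destruct (proj1 (cont_eps w x) Hw 1 Rlt_0_1) as [d1 [Hd1 Hw1]].
  destruct (proj1 (cont_eps (u N) x) (Hu N) (eps / 2)) as [d2 [Hd2 Hu2]]; [lra|].
  assert (Hclose : forall y, Rabs (y - x) < d1 -> Rabs (u N y - l y) < eps / 4).
  { intros y Hy. specialize (Hw1 y Hy). eapply Rle_lt_trans; [apply Hl|].
    assert (Rabs (w y) <= W).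
    { unfold W. replace (w y) with (w x + (w y - w x)) by ring.
      eapply Rle_trans; [apply Rabs_triang|]. lra. }
    apply Rle_lt_trans with (Rabs (e N) * W).
    - apply Rle_trans with (Rabs (e N * w y)); [apply Rle_abs|].
      rewrite Rabs_mult. apply Rmult_le_compat_l; [apply Rabs_pos | assumption].
    - replace (eps / 4) with (eps / (4 * W) * W) by (field; lra).
      now apply Rmult_lt_compat_r. }
  exists (Rmin d1 d2). split; [now apply Rmin_pos|]. intros y Hy.
  assert (H1 := Hclose y (Rlt_le_trans _ _ _ Hy (Rmin_l _ _))).
  assert (H2 := Hu2 y (Rlt_le_trans _ _ _ Hy (Rmin_r _ _))).
  assert (H3 : Rabs (u N x - l x) < eps / 4).
  { apply Hclose. rewrite Rminus_eq_0, Rabs_R0. exact Hd1. }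
  apply Rabs_def2 in H1. apply Rabs_def2 in H2. apply Rabs_def2 in H3.
  apply Rabs_def1; lra.
Qed.

(** * Ordinary differential equations *)

Lemma ex_RInt_cont (h : R -> R) (a b : R) :
  (forall t, continuous h t) -> ex_RInt h a b.
Proof. intros H. apply (ex_RInt_continuous h). intros; apply H. Qed.

Lemma der_RInt (h : R -> R) (a x : R) :
  (forall t, continuous h t) -> is_derive (fun u => RInt h a u) x (h x).
Proof.
  intros H. apply (is_derive_RInt h (fun u => RInt h a u) a x).
  - apply filter_forall. intros u. apply (RInt_correct h), ex_RInt_cont, H.
  - apply H.
Qed.

Lemma is_derive_of_uniform (fn fn' : nat -> R -> R) (f g : nat -> R) (F G : R -> R) (x r : R) :
  0 < r ->
  (forall y n, Rabs (y - x) < r -> is_derive (fn n) y (fn' n y)) ->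
  (forall y n, Rabs (y - x) < r -> Rabs (fn n y - F y) <= f n) ->
  (forall y n, Rabs (y - x) < r -> Rabs (fn' n y - G y) <= g n) ->
  is_lim_seq f 0 -> is_lim_seq g 0 ->
  (forall y, Rabs (y - x) < r -> continuous G y) ->
  is_derive F x (G x).
Proof.
  intros Hr Hd HF HG Hf Hg Hc. apply is_derive_Reals.
  apply (derivable_pt_lim_CVU fn fn' F G x x (mkposreal r Hr)).
  - unfold Boule. simpl. rewrite Rminus_eq_0, Rabs_R0. exact Hr.
  - intros y n Hy. apply is_derive_Reals, Hd, Hy.
  - intros y Hy eps Heps. apply is_lim_seq_spec in Hf.
    destruct (Hf (mkposreal eps Heps)) as [N HN]. exists N. intros n Hn.
    specialize (HN n Hn). simpl in HN. rewrite Rminus_0_r in HN.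
    unfold Rdist. eapply Rle_lt_trans; [apply HF, Hy|].
    eapply Rle_lt_trans; [apply Rle_abs | exact HN].
  - intros eps Heps. apply is_lim_seq_spec in Hg.
    destruct (Hg (mkposreal eps Heps)) as [N HN]. exists N. intros n y Hn Hy.
    specialize (HN n Hn). simpl in HN. rewrite Rminus_0_r in HN.
    rewrite Rabs_minus_sym. eapply Rle_lt_trans; [apply HG, Hy|].
    eapply Rle_lt_trans; [apply Rle_abs | exact HN].
  - intros y Hy. apply continuity_pt_filterlim, Hc, Hy.
Qed.

(** Compares [f] with the primitive of [h], which is differentiable at [x0] too. *)
Lemma is_derive_of_punctured (f h : R -> R) (x0 : R) :
  (forall x, continuous f x) -> (forall x, continuous h x) ->
  (forall x, x <> x0 -> is_derive f x (h x)) -> forall x, is_derive f x (h x).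
Proof.
  intros Hf Hh Hd x.
  pose (g := fun t => f t - RInt h x0 t).
  assert (Hg : forall t, continuous g t).
  { intros t. unfold g. cont; [apply Hf | eapply der_continuous, der_RInt, Hh]. }
  assert (Hgd : forall t, t <> x0 -> is_derive g t 0).
  { intros t Ht. unfold g. eapply is_derive_eq; [der; [now apply Hd | apply der_RInt, Hh] | ring]. }
  assert (Hc : forall t, g t = g x0).
  { intros t. destruct (Rle_or_lt t x0) as [Ht | Ht].
    - apply constant_of_derive; [exact Ht | auto |]. intros y Hy. apply Hgd. lra.
    - symmetry. apply constant_of_derive; [lra | auto |]. intros y Hy. apply Hgd. lra. }
  apply is_derive_ext with (fun t => g x0 + RInt h x0 t).
  - intros t. rewrite <- (Hc t). unfold g.
    change (f t - RInt h x0 t + RInt h x0 t = f t). lra.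
  - eapply is_derive_eq; [der; apply der_RInt, Hh | ring].
Qed.

Section Picard.

Variables (F : R -> R -> R) (L C y0 : R).
Hypothesis HL : 0 < L.
Hypothesis HLip : forall s y y', Rabs (F s y - F s y') <= L * Rabs (y - y').
Hypothesis HC : forall s, Rabs (F s y0) <= C.
Hypothesis Hcont : forall y, (forall s, continuous y s) ->
  forall s, continuous (fun t => F t (y t)) s.

(** The bound [Rmax s 0] freezes the iterates for [s < 0], so that they are
    continuous on the whole line. *)
Fixpoint picard_iter (n : nat) (s : R) : R :=
  match n with
  | O => y0
  | S n => y0 + RInt (fun t => F t (picard_iter n t)) 0 (Rmax s 0)
  end.

Lemma picard_iter_cont n s : continuous (picard_iter n) s.
Proof.
  revert s. induction n as [|n IH]; intros s; simpl.
  - apply cont_const.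
  - apply cont_plus; [apply cont_const|].
    apply (cont_comp (fun u => RInt (fun t => F t (picard_iter n t)) 0 u) (fun s => Rmax s 0)).
    + apply cont_max; [apply cont_id | apply cont_const].
    + eapply der_continuous. apply der_RInt. intros t. now apply Hcont.
Qed.

(** Relative to the weight [exp (2 L s)], each integration against the Lipschitz
    constant [L] halves the distance of consecutive iterates. *)
Lemma picard_step n s :
  Rabs (picard_iter (S n) s - picard_iter n s)
  <= C / L * (/ 2) ^ n * exp (2 * L * Rmax s 0).
Proof.
  assert (HC0 : 0 <= C) by (eapply Rle_trans; [apply Rabs_pos | apply (HC 0)]).
  revert s. induction n as [|n IH]; intros s; set (sp := Rmax s 0);
    assert (Hsp : 0 <= sp) by apply Rmax_r.
  - simpl. fold sp. assert (E : forall a b : R, a + b - a = b) by (intros; ring). rewrite E.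
    eapply Rle_trans.
    + apply (abs_RInt_le_const (fun t => F t y0) 0 sp C Hsp).
      * apply ex_RInt_cont. intros t. apply (Hcont (fun _ => y0)). intros; apply cont_const.
      * intros t _. apply HC.
    + assert (H := exp_ineq1_le (2 * L * sp)).
      replace ((sp - 0) * C) with (C / L * (L * sp)) by (field; lra).
      rewrite Rmult_1_r. apply Rmult_le_compat_l; [|nra].
      apply Rdiv_le_0_compat; lra.
  - change (picard_iter (S (S n)) s) with
      (y0 + RInt (fun t => F t (picard_iter (S n) t)) 0 sp).
    change (picard_iter (S n) s) with
      (y0 + RInt (fun t => F t (picard_iter n t)) 0 sp).
    assert (Hex : forall m, ex_RInt (fun t => F t (picard_iter m t)) 0 sp).
    { intros m. apply ex_RInt_cont. intros t. apply Hcont. apply picard_iter_cont. }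
    pose (q := C / L * (/ 2) ^ S n).
    assert (Hq : 0 <= q).
    { apply Rmult_le_pos; [apply Rdiv_le_0_compat; lra | apply pow_le; lra]. }
    apply Rle_trans with (q * exp (2 * L * sp) - q * exp (2 * L * 0)).
    + assert (E : forall a b c : R, a + b - (a + c) = b - c) by (intros; ring). rewrite E.
      apply (norm_RInt_le
        (fun t => F t (picard_iter (S n) t) - F t (picard_iter n t))
        (fun t => 2 * L * q * exp (2 * L * t)) 0 sp); [exact Hsp | | |].
      * intros t Ht. change (norm ?a) with (Rabs a).
        eapply Rle_trans; [apply HLip|].
        replace (2 * L * q * exp (2 * L * t))
          with (L * (C / L * (/ 2) ^ n * exp (2 * L * t))).
        2: { unfold q. simpl. field. lra. }
        apply Rmult_le_compat_l; [lra|].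
        assert (H := IH t). rewrite Rmax_left in H by lra. exact H.
      * apply (is_RInt_minus (fun t => F t (picard_iter (S n) t)) (fun t => F t (picard_iter n t)));
        apply (RInt_correct (fun t => F t (picard_iter _ t))); apply Hex.
      * apply (is_RInt_derive (fun t => q * exp (2 * L * t))).
        -- intros t _. eapply is_derive_eq.
           ++ apply der_mult; [der|].
              apply (der_comp exp (fun t => 2 * L * t)); [apply is_derive_exp | der].
           ++ cbv beta. ring.
        -- intros t _. cont. apply (cont_comp exp (fun t => 2 * L * t)).
           ++ cont.
           ++ eapply der_continuous, is_derive_exp.
    + assert (0 < exp (2 * L * 0)) by apply exp_pos. fold q. nra.
Qed.

Let w (s : R) := exp (2 * L * Rmax s 0).
Let e (n : nat) := 2 * (C / L) * (/ 2) ^ n.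

Lemma picard_cauchy s n m : (n <= m)%nat ->
  Rabs (picard_iter m s - picard_iter n s) <= e n * w s.
Proof.
  intros Hnm.
  assert (HC0 : 0 <= C / L * w s).
  { assert (0 < w s) by apply exp_pos.
    assert (0 <= C) by (eapply Rle_trans; [apply Rabs_pos | apply (HC 0)]).
    apply Rmult_le_pos; [apply Rdiv_le_0_compat; lra | lra]. }
  assert (H : Rabs (picard_iter m s - picard_iter n s)
              <= 2 * (C / L * w s) * ((/ 2) ^ n - (/ 2) ^ m)).
  { induction Hnm as [|m Hnm IH].
    - rewrite Rminus_eq_0, Rabs_R0. lra.
    - replace (picard_iter (S m) s - picard_iter n s) with
        ((picard_iter (S m) s - picard_iter m s) + (picard_iter m s - picard_iter n s)) by ring.
      eapply Rle_trans; [apply Rabs_triang|].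
      assert (Hs := picard_step m s). fold (w s) in Hs. simpl ((/ 2) ^ S m). nra. }
  assert (0 <= (/ 2) ^ m) by (apply pow_le; lra).
  unfold e. nra.
Qed.

Lemma picard_modulus_lim : is_lim_seq e 0.
Proof.
  unfold e. replace (Finite 0) with (Rbar_mult (2 * (C / L)) 0) by (simpl; f_equal; ring).
  apply is_lim_seq_scal_l, is_lim_seq_geom. rewrite Rabs_right; lra.
Qed.

Theorem picard : exists y : R -> R,
  (forall s, continuous y s) /\ y 0 = y0 /\
  forall s, 0 < s -> is_derive y s (F s (y s)).
Proof.
  pose (y := fun s => real (Lim_seq (fun n => picard_iter n s))).
  assert (Hy : forall n s, Rabs (picard_iter n s - y s) <= e n * w s).
  { intros n s. apply (Lim_seq_of_modulus (fun n => picard_iter n s) (fun n => e n * w s)).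
    - replace (Finite 0) with (Rbar_mult 0 (w s)) by (simpl; f_equal; ring).
      apply is_lim_seq_scal_r, picard_modulus_lim.
    - intros p m Hpm. now apply picard_cauchy. }
  assert (Hyc : forall s, continuous y s).
  { intros s. apply cont_of_uniform with picard_iter w e.
    - apply picard_modulus_lim.
    - unfold w. apply (cont_comp exp (fun s => 2 * L * Rmax s 0)).
      + cont. apply cont_max; cont.
      + eapply der_continuous, is_derive_exp.
    - exact Hy.
    - intros n. apply picard_iter_cont. }
  exists y. split; [exact Hyc|]. split.
  - unfold y. erewrite Lim_seq_ext; [rewrite Lim_seq_const; reflexivity|].
    intros [|n]; simpl; [reflexivity|].
    rewrite Rmax_left by lra. rewrite RInt_point. unfold zero; simpl. ring.
  - intros s Hs. pose (W := exp (2 * L * (2 * s))).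
    assert (Hloc : forall t, Rabs (t - s) < s -> 0 < t < 2 * s).
    { intros t Ht. apply Rabs_def2 in Ht. lra. }
    assert (He : forall n, 0 <= e n).
    { intros n. assert (H := picard_cauchy 0 n n (Nat.le_refl n)).
      assert (0 < w 0) by apply exp_pos.
      rewrite Rminus_eq_0, Rabs_R0 in H. nra. }
    assert (HW : forall n t, Rabs (t - s) < s -> Rabs (picard_iter n t - y t) <= e n * W).
    { intros n t Ht. apply Hloc in Ht. eapply Rle_trans; [apply Hy|].
      apply Rmult_le_compat_l; [apply He|]. unfold w, W.
      rewrite Rmax_left by lra. left. apply exp_increasing. nra. }
    apply (is_derive_of_uniform (fun n => picard_iter (S n))
             (fun n t => F t (picard_iter n t)) (fun n => e (S n) * W)
             (fun n => L * (e n * W)) y (fun t => F t (y t)) s s Hs).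
    + intros t n Ht. apply Hloc in Ht. simpl.
      apply is_derive_ext_loc with
        (fun u => y0 + RInt (fun t => F t (picard_iter n t)) 0 u).
      * apply locally_R. exists t. split; [lra|]. intros u Hu. apply Rabs_def2 in Hu.
        rewrite Rmax_left by lra. reflexivity.
      * eapply is_derive_eq; [apply der_plus; [der|]|apply Rplus_0_l].
        apply (der_RInt (fun t => F t (picard_iter n t))). intros u. apply Hcont, picard_iter_cont.
    + intros t n Ht. now apply HW.
    + intros t n Ht. eapply Rle_trans; [apply HLip|].
      apply Rmult_le_compat_l; [lra | now apply HW].
    + replace (Finite 0) with (Rbar_mult 0 W) by (simpl; f_equal; ring).
      apply is_lim_seq_scal_r. apply (is_lim_seq_incr_1 e), picard_modulus_lim.
    + replace (Finite 0) with (Rbar_mult L (Rbar_mult 0 W)) by (simpl; f_equal; ring).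
      apply is_lim_seq_scal_l, is_lim_seq_scal_r, picard_modulus_lim.
    + intros t _. now apply Hcont.
Qed.

End Picard.

Definition clamp (D s : R) : R := Rmax 0 (Rmin s D).

Lemma clamp_bounds D s : 0 <= D -> 0 <= clamp D s <= D.
Proof.
  intros HD. unfold clamp. split; [apply Rmax_l|].
  apply Rmax_lub; [exact HD | apply Rmin_r].
Qed.

Lemma clamp_id D s : 0 <= s <= D -> clamp D s = s.
Proof. intros H. unfold clamp. rewrite Rmin_left, Rmax_right; lra. Qed.

Lemma clamp_cont D s : continuous (clamp D) s.
Proof. apply cont_max; [cont|]. apply cont_min; cont. Qed.

(** The equation is singular at [P = 0]; the bounds single out the solutions that leave
    the singular point [s = 0] along a direction of positive slope. *)
Definition singular_sol (D c : R) (g P : R -> R) : Prop :=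
  (forall s, continuous P s) /\ P 0 = 0 /\
  (exists et La, 0 < et /\ 0 < La /\
     forall s, 0 <= s <= D -> et * s * (D - s) <= P s <= La * s) /\
  (forall s, 0 < s < D -> is_derive P s (g s + c * (D - s) * s * (2 * D - s) / P s)).

Section SingularODE.

Variables (D c M : R) (g : R -> R).
Hypothesis HD : 0 < D.
Hypothesis Hc : 0 < c.
Hypothesis Hg : forall s, continuous g s.
Hypothesis HM : forall s, Rabs (g s) <= M.

Let k (s : R) := c * (D - s) * s * (2 * D - s).
Let kmax := c * D * D * (2 * D).

Lemma kmax_bound s : 0 <= s <= D -> 0 <= k s <= kmax.
Proof.
  intros Hs. unfold k, kmax.
  assert (0 <= c * (D - s)) by nra.
  assert (0 <= c * (D - s) * s) by nra.
  split; [nra|].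
  apply Rmult_le_compat; [lra | lra | | lra].
  apply Rmult_le_compat; nra.
Qed.

Lemma M_nonneg : 0 <= M.
Proof. eapply Rle_trans; [apply Rabs_pos | apply (HM 0)]. Qed.

Definition regularised (d : R) (y : R -> R) : Prop :=
  (forall s, continuous y s) /\ y 0 = d /\
  (forall s, 0 <= s <= D -> d <= y s) /\
  (forall s, 0 < s < D -> is_derive y s (g s + (k s + (M + 1) * d) / y s)).

(** The floor [d] in the denominator makes the right-hand side globally
    Lipschitz; the added constant [(M + 1) * d] pushes the solution upwards at the
    height [d], so the floor is never active. *)
Lemma regularised_solution (d : R) : 0 < d -> exists y : R -> R, regularised d y.
Proof.
  intros Hd. assert (HM0 := M_nonneg).
  pose (A := fun s => k (clamp D s) + (M + 1) * d).
  assert (HA : forall s, 0 < A s <= kmax + (M + 1) * d).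
  { intros s. unfold A. assert (H := kmax_bound _ (clamp_bounds D s (Rlt_le _ _ HD))). nra. }
  assert (HAc : forall s, continuous A s).
  { intros s. unfold A. apply cont_plus; [|cont].
    apply (cont_comp k (clamp D)); [apply clamp_cont|]. unfold k. cont. }
  pose (F := fun s y => g s + A s / Rmax y d).
  assert (Hmax : forall y, d <= Rmax y d) by (intros; apply Rmax_r).
  destruct (picard F ((kmax + (M + 1) * d) / d ^ 2) (M + (kmax + (M + 1) * d) / d) d)
    as [y [Hyc [Hy0 Hyd]]].
  - apply Rdiv_lt_0_compat; [destruct (HA 0); lra | nra].
  - intros s y y'. unfold F.
    assert (Hy := Hmax y). assert (Hy' := Hmax y'). destruct (HA s) as [HA0 HA1].
    replace (g s + A s / Rmax y d - (g s + A s / Rmax y' d))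
      with (A s * ((Rmax y' d - Rmax y d) / (Rmax y d * Rmax y' d))) by (field; lra).
    rewrite Rabs_mult, (Rabs_right (A s)) by lra.
    unfold Rdiv at 2. rewrite Rmult_assoc.
    apply Rmult_le_compat; [lra | apply Rabs_pos | exact HA1 |].
    unfold Rdiv. rewrite Rabs_mult, Rmult_comm, (Rabs_right (/ _)).
    2: { apply Rle_ge. left. apply Rinv_0_lt_compat. nra. }
    apply Rmult_le_compat.
    + left. apply Rinv_0_lt_compat. nra.
    + apply Rabs_pos.
    + apply Rinv_le_contravar; nra.
    + unfold Rmax. destruct (Rle_dec y d), (Rle_dec y' d); unfold Rabs;
        repeat destruct (Rcase_abs _); lra.
  - intros s. unfold F. eapply Rle_trans; [apply Rabs_triang|].
    apply Rplus_le_compat; [apply HM|].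
    rewrite Rmax_left by lra. destruct (HA s) as [HA0 HA1].
    unfold Rdiv. rewrite Rabs_mult, !Rabs_right.
    + apply Rmult_le_compat_r; [left; now apply Rinv_0_lt_compat | exact HA1].
    + apply Rle_ge. left. now apply Rinv_0_lt_compat.
    + lra.
  - intros y Hy s. unfold F. apply cont_plus; [apply Hg|].
    apply cont_div; [apply HAc | |].
    + apply cont_max; [apply Hy | cont].
    + assert (H := Hmax (y s)). lra.
  - assert (Hfloor : forall s, 0 <= s <= D -> 0 <= y s - d).
    { apply nonneg_of_barrier with (fun s => F s (y s)).
      - intros s _. cont. apply Hyc.
      - intros s Hs Hlt. split.
        + eapply is_derive_eq; [der; now apply Hyd|]. cbv beta. ring.
        + unfold F. rewrite Rmax_right by lra.
          assert (H := HM s). apply Rabs_le_between in H.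
          assert (M + 1 <= A s / d).
          { apply le_div; [lra|]. unfold A.
            assert (H1 := kmax_bound _ (clamp_bounds D s (Rlt_le _ _ HD))). lra. }
          lra.
      - lra. }
    exists y. split; [exact Hyc|]. split; [exact Hy0|]. split.
    + intros s Hs. specialize (Hfloor s Hs). lra.
    + intros s Hs. eapply is_derive_eq; [apply Hyd; lra|].
      assert (H := Hfloor s ltac:(lra)).
      unfold F, A. rewrite clamp_id, Rmax_left by lra. reflexivity.
Qed.

Let eta := c * D / (M + D + c * D).
Let Lam := 2 * M + 1 + 2 * c * D ^ 2.

Lemma eta_pos : 0 < eta.
Proof.
  assert (HM0 := M_nonneg). apply Rdiv_lt_0_compat; nra.
Qed.

(** [eta s (D - s)] is a subsolution: [k / (eta s (D - s)) >= c D / eta], which exceeds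
    [M + eta D] for this [eta]. *)
Lemma regularised_lower (d : R) (y : R -> R) : 0 < d -> regularised d y ->
  forall s, 0 <= s <= D -> eta * s * (D - s) <= y s.
Proof.
  intros Hd [Hyc [Hy0 [Hfl Hyd]]]. assert (HM0 := M_nonneg). assert (He := eta_pos).
  assert (He1 : eta <= 1).
  { unfold eta. apply div_le; nra. }
  assert (HcD : c * D / eta = M + D + c * D).
  { unfold eta. field. split; [nra|]. split; lra. }
  assert (H : forall s, 0 <= s <= D -> 0 <= y s - eta * s * (D - s)).
  { apply nonneg_of_barrier with
      (fun s => g s + (k s + (M + 1) * d) / y s - eta * (D - 2 * s)).
    - intros s _. cont. apply Hyc.
    - intros s Hs Hlt. split.
      + eapply is_derive_eq; [der; now apply Hyd|]. cbv beta. ring.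
      + assert (Hy : d <= y s) by (apply Hfl; lra).
        assert (H := HM s). apply Rabs_le_between in H.
        assert (c * D / eta <= (k s + (M + 1) * d) / y s).
        { apply le_div; [lra|].
          apply Rle_trans with (c * D / eta * (eta * s * (D - s))).
          - apply Rmult_le_compat_l; [|lra]. rewrite HcD. nra.
          - replace (c * D / eta * (eta * s * (D - s))) with (c * D * (s * (D - s)))
              by (field; lra).
            unfold k. assert (0 <= c * (s * (D - s))) by (apply Rmult_le_pos; nra). nra. }
        nra.
    - lra. }
  intros s Hs. specialize (H s Hs). lra.
Qed.

(** [d + Lam s] is a supersolution: above it, [k / y <= k / s <= 2 c D^2], the regularising
    term is at most [M + 1], and [Lam] is the sum of these and of the bound [M] on [g]. *)
Lemma regularised_upper (d : R) (y : R -> R) : 0 < d -> regularised d y ->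
  forall s, 0 <= s <= D -> y s <= d + Lam * s.
Proof.
  intros Hd [Hyc [Hy0 [Hfl Hyd]]]. assert (HM0 := M_nonneg).
  assert (HcD : 0 <= 2 * c * D ^ 2) by nra.
  assert (HL1 : 1 <= Lam) by (unfold Lam; lra).
  assert (H : forall s, 0 <= s <= D -> 0 <= d + Lam * s - y s).
  { apply nonneg_of_barrier with
      (fun s => Lam - (g s + (k s + (M + 1) * d) / y s)).
    - intros s _. cont. apply Hyc.
    - intros s Hs Hlt. split.
      + eapply is_derive_eq; [der; now apply Hyd|]. cbv beta. ring.
      + assert (Hy : d <= y s) by (apply Hfl; lra).
        assert (H := HM s). apply Rabs_le_between in H.
        assert ((k s + (M + 1) * d) / y s <= 2 * c * D ^ 2 + (M + 1)).
        { apply div_le; [lra|].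
          assert (k s <= 2 * c * D ^ 2 * y s); [|nra].
          apply Rle_trans with (2 * c * D ^ 2 * s).
          - unfold k.
            replace (c * (D - s) * s * (2 * D - s)) with (c * s * ((D - s) * (2 * D - s))) by ring.
            replace (2 * c * D ^ 2 * s) with (c * s * (2 * D ^ 2)) by ring.
            apply Rmult_le_compat_l; nra.
          - apply Rmult_le_compat_l; [exact HcD | nra]. }
        unfold Lam. lra.
    - lra. }
  intros s Hs. specialize (H s Hs). lra.
Qed.

(** The right-hand side is decreasing in the unknown apart from the
    regularisation, so the squared distance of two solutions grows no faster than
    the regularising constants. *)
Lemma regularised_close (d1 d2 : R) (y1 y2 : R -> R) : 0 < d1 -> 0 < d2 -> regularised d1 y1 -> regularised d2 y2 ->
  forall s, 0 <= s <= D ->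
    (y1 s - y2 s) ^ 2 <= (d1 - d2) ^ 2 + 2 * (M + 1) * (d1 + d2) * s.
Proof.
  intros Hd1 Hd2 [Hc1 [H10 [Hf1 Hder1]]] [Hc2 [H20 [Hf2 Hder2]]] s Hs. assert (HM0 := M_nonneg).
  pose (f := fun s => (d1 - d2) ^ 2 + 2 * (M + 1) * (d1 + d2) * s - (y1 s - y2 s) ^ 2).
  assert (H : f 0 <= f s); [|unfold f in H; rewrite H10, H20 in H; lra].
  apply nondecreasing_of_derive with
    (fun s => 2 * (M + 1) * (d1 + d2) -
       2 * (y1 s - y2 s) * ((g s + (k s + (M + 1) * d1) / y1 s)
                            - (g s + (k s + (M + 1) * d2) / y2 s))); [lra | |].
  - intros t _. unfold f. cont; auto.
  - intros t Ht. split.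
    + unfold f. eapply is_derive_eq.
      * der; [apply Hder1; lra | apply Hder2; lra].
      * cbv beta. ring.
    + assert (Hy1 : d1 <= y1 t) by (apply Hf1; lra).
      assert (Hy2 : d2 <= y2 t) by (apply Hf2; lra).
      destruct (kmax_bound t) as [Hk _]; [lra|].
      assert (H1 : 0 <= (y1 t - y2 t) ^ 2 / (y1 t * y2 t)).
      { apply Rdiv_le_0_compat; [apply pow2_ge_0 | nra]. }
      assert (H2 : 0 <= y2 t / y1 t) by (apply Rdiv_le_0_compat; lra).
      assert (H3 : 0 <= y1 t / y2 t) by (apply Rdiv_le_0_compat; lra).
      replace (2 * (M + 1) * (d1 + d2) -
       2 * (y1 t - y2 t) * ((g t + (k t + (M + 1) * d1) / y1 t)
                            - (g t + (k t + (M + 1) * d2) / y2 t)))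
        with (2 * k t * ((y1 t - y2 t) ^ 2 / (y1 t * y2 t))
              + 2 * (M + 1) * (d1 * (y2 t / y1 t) + d2 * (y1 t / y2 t))) by (field; lra).
      assert (0 <= k t * ((y1 t - y2 t) ^ 2 / (y1 t * y2 t))) by now apply Rmult_le_pos.
      assert (0 <= d1 * (y2 t / y1 t)) by (apply Rmult_le_pos; lra).
      assert (0 <= d2 * (y1 t / y2 t)) by (apply Rmult_le_pos; lra).
      nra.
Qed.

(** The solutions for [d = (1 / 4)^n] converge uniformly with rate [(1 / 2)^n], and the
    lower bound keeps [k / y] away from its singularity on compact subsets of the open
    interval. *)
Theorem singular_solution : exists P, singular_sol D c g P.
Proof.
  assert (HM0 := M_nonneg).
  pose (dl := fun n : nat => (/ 4) ^ n).
  assert (Hdl : forall n, 0 < dl n) by (intros; apply pow_lt; lra).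
  pose (sol := fun n => constructive_indefinite_description _ (regularised_solution _ (Hdl n))).
  pose (y := fun n => proj1_sig (sol n)).
  assert (Hy : forall n, regularised (dl n) (y n)) by (intros n; apply (proj2_sig (sol n))).
  pose (Bd := sqrt (1 + 4 * (M + 1) * D)).
  pose (e := fun n : nat => Bd * (/ 2) ^ n).
  assert (Hgeom : is_lim_seq (fun n => (/ 2) ^ n) 0) by (apply is_lim_seq_geom; rewrite Rabs_right; lra).
  assert (Hgeom4 : is_lim_seq dl 0) by (apply is_lim_seq_geom; rewrite Rabs_right; lra).
  assert (He : is_lim_seq e 0).
  { replace (Finite 0) with (Rbar_mult Bd 0) by (simpl; f_equal; ring).
    now apply is_lim_seq_scal_l. }
  assert (Hcauchy : forall s n m, 0 <= s <= D -> (n <= m)%nat -> Rabs (y m s - y n s) <= e n).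
  { intros s n m Hs Hnm.
    assert (Hdm : dl m <= dl n).
    { unfold dl. replace m with (n + (m - n))%nat by lia. rewrite pow_add.
      assert (H1 : (/ 4) ^ (m - n) <= 1).
      { rewrite <- (pow1 (m - n)). apply pow_incr. lra. }
      assert (0 < (/ 4) ^ n) by (apply pow_lt; lra). nra. }
    assert (Hdn : dl n <= 1).
    { unfold dl. rewrite <- (pow1 n). apply pow_incr. lra. }
    assert (Hp := Hdl m).
    assert (H := regularised_close (dl m) (dl n) (y m) (y n) (Hdl m) (Hdl n) (Hy m) (Hy n) s Hs).
    assert (Hen : 0 <= e n).
    { apply Rmult_le_pos; [apply sqrt_pos | apply pow_le; lra]. }
    assert (Hsq : e n ^ 2 = (1 + 4 * (M + 1) * D) * dl n).
    { unfold e. rewrite Rpow_mult_distr. unfold Bd. rewrite pow2_sqrt by nra.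
      f_equal. unfold dl. rewrite <- pow_mult, Nat.mul_comm, pow_mult. f_equal. lra. }
    apply Rsqr_incr_0_var; [|exact Hen]. rewrite <- Rsqr_abs. unfold Rsqr.
    assert ((dl m - dl n) ^ 2 <= dl n) by nra.
    assert (2 * (M + 1) * (dl m + dl n) * s <= 2 * (M + 1) * (2 * dl n) * D).
    { apply Rmult_le_compat; nra. }
    nra. }
  pose (P := fun s => real (Lim_seq (fun n => y n (clamp D s)))).
  assert (HP : forall n s, Rabs (y n (clamp D s) - P s) <= e n).
  { intros n s. apply (Lim_seq_of_modulus (fun n => y n (clamp D s)) e He).
    intros i j Hij. apply Hcauchy; [apply clamp_bounds; lra | exact Hij]. }
  assert (HPin : forall n s, 0 <= s <= D -> Rabs (y n s - P s) <= e n).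
  { intros n s Hs. rewrite <- (clamp_id D s Hs) at 1. apply HP. }
  assert (HPlim : forall s, 0 <= s <= D -> is_lim_seq (fun n => y n s) (P s)).
  { intros s Hs. apply is_lim_seq_spec. intros eps. apply is_lim_seq_spec in He.
    destruct (He eps) as [N HN]. exists N. intros n Hn. specialize (HN n Hn).
    rewrite Rminus_0_r in HN. eapply Rle_lt_trans; [now apply HPin|].
    eapply Rle_lt_trans; [apply Rle_abs | exact HN]. }
  assert (HPc : forall s, continuous P s).
  { intros s. apply cont_of_uniform with (fun n s => y n (clamp D s)) (fun _ => 1) e.
    - exact He.
    - cont.
    - intros n t. rewrite Rmult_1_r. apply HP.
    - intros n. apply (cont_comp (y n) (clamp D)); [apply clamp_cont | apply Hy]. }
  assert (Hlown : forall n s, 0 <= s <= D -> eta * s * (D - s) <= y n s).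
  { intros n. apply (regularised_lower (dl n)); auto. }
  assert (Hlow : forall s, 0 <= s <= D -> eta * s * (D - s) <= P s).
  { intros s Hs.
    apply (is_lim_seq_le (fun _ => eta * s * (D - s)) (fun n => y n s)
             (eta * s * (D - s)) (P s)).
    - intros n. now apply Hlown.
    - apply is_lim_seq_const.
    - now apply HPlim. }
  assert (Hup : forall s, 0 <= s <= D -> P s <= Lam * s).
  { intros s Hs.
    apply (is_lim_seq_le (fun n => y n s) (fun n => dl n + Lam * s) (P s) (Lam * s)).
    - intros n. apply (regularised_upper (dl n)); auto.
    - now apply HPlim.
    - replace (Finite (Lam * s)) with (Rbar_plus 0 (Lam * s)) by (simpl; f_equal; ring).
      apply is_lim_seq_plus'; [exact Hgeom4 | apply is_lim_seq_const]. }
  assert (Heta := eta_pos).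
  exists P. split; [exact HPc|]. split.
  { assert (H1 := Hlow 0). assert (H2 := Hup 0). lra. }
  split.
  { exists eta, Lam. split; [exact Heta|]. split; [unfold Lam; nra|]. auto. }
  intros s Hs. pose (r := Rmin s (D - s) / 2).
  assert (Hr1 : 2 * r <= s) by (unfold r; assert (H := Rmin_l s (D - s)); lra).
  assert (Hr2 : 2 * r <= D - s) by (unfold r; assert (H := Rmin_r s (D - s)); lra).
  assert (Hr : 0 < r) by (unfold r; assert (0 < Rmin s (D - s)) by (apply Rmin_pos; lra); lra).
  pose (be := eta * r * r).
  assert (Hbe : 0 < be) by (unfold be; apply Rmult_lt_0_compat; nra).
  assert (Hloc : forall t, Rabs (t - s) < r -> r <= t <= D - r).
  { intros t Ht. apply Rabs_def2 in Ht. lra. }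
  assert (Hbt : forall t, r <= t <= D - r -> be <= eta * t * (D - t)).
  { intros t Ht. unfold be. apply Rmult_le_compat; nra. }
  apply (is_derive_of_uniform y (fun n s => g s + (k s + (M + 1) * dl n) / y n s)
           e (fun n => kmax / be ^ 2 * e n + (M + 1) / be * dl n)
           P (fun s => g s + k s / P s) s r Hr).
  - intros t n Ht. apply Hloc in Ht. apply Hy. lra.
  - intros t n Ht. apply Hloc in Ht. apply HPin. lra.
  - intros t n Ht. apply Hloc in Ht. assert (Hb := Hbt t Ht).
    assert (HPt : be <= P t) by (eapply Rle_trans; [exact Hb | apply Hlow; lra]).
    assert (Hyt : be <= y n t).
    { eapply Rle_trans; [exact Hb|]. apply Hlown. lra. }
    destruct (kmax_bound t) as [Hk0 Hk1]; [lra|].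
    replace (g t + (k t + (M + 1) * dl n) / y n t - (g t + k t / P t))
      with (k t / (y n t * P t) * (P t - y n t) + (M + 1) * dl n / y n t) by (field; lra).
    assert (Hdn := Hdl n).
    eapply Rle_trans; [apply Rabs_triang|]. apply Rplus_le_compat.
    + rewrite Rabs_mult. apply Rmult_le_compat; try apply Rabs_pos.
      * rewrite Rabs_right; [|apply Rle_ge, Rdiv_le_0_compat; nra].
        unfold Rdiv. apply Rmult_le_compat; [lra | | lra |].
        -- left. apply Rinv_0_lt_compat. nra.
        -- apply Rinv_le_contravar; nra.
      * rewrite Rabs_minus_sym. apply HPin. lra.
    + rewrite Rabs_right; [|apply Rle_ge, Rdiv_le_0_compat; nra].
      replace ((M + 1) / be * dl n) with ((M + 1) * dl n * / be) by (field; lra).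
      apply Rmult_le_compat_l; [nra|]. apply Rinv_le_contravar; lra.
  - exact He.
  - replace (Finite 0) with (Finite (kmax / be ^ 2 * 0 + (M + 1) / be * 0)) by (f_equal; ring).
    apply is_lim_seq_plus'.
    + replace (Finite (kmax / be ^ 2 * 0)) with (Rbar_mult (kmax / be ^ 2) 0) by reflexivity.
      now apply is_lim_seq_scal_l.
    + replace (Finite ((M + 1) / be * 0)) with (Rbar_mult ((M + 1) / be) 0) by reflexivity.
      now apply is_lim_seq_scal_l.
  - intros t Ht. apply Hloc in Ht. assert (Hb := Hbt t Ht).
    assert (HPt : be <= P t) by (eapply Rle_trans; [exact Hb | apply Hlow; lra]).
    unfold k. cont; auto. lra.
Qed.

End SingularODE.

(** ** The slope at the sonic point *)

(** The level [om] is crossed on [(0, r)] in one direction only. *)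
Definition one_way (w dw : R -> R) (om r : R) : Prop :=
  (forall x, 0 < x < r -> w x = om -> 0 < dw x) \/
  (forall x, 0 < x < r -> w x = om -> dw x < 0).

Lemma one_way_settles (w dw : R -> R) (om r : R) : 0 < r ->
  (forall x, 0 < x < r -> is_derive w x (dw x)) -> one_way w dw om r ->
  exists r', 0 < r' /\
    ((forall x, 0 < x < r' -> om <= w x) \/ (forall x, 0 < x < r' -> w x <= om)).
Proof.
  intros Hr Hw Hway.
  assert (Hc : forall x, 0 < x < r -> continuous w x).
  { intros x Hx. eapply der_continuous, Hw, Hx. }
  destruct Hway as [Hup | Hdn].
  - destruct (classic (exists x, 0 < x < r /\ w x < om)) as [[x0 [Hx0 H0]] | Hno].
    + exists x0. split; [lra|]. right. intros x Hx. apply Rnot_lt_le. intros Hlt.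
      assert (0 <= w x0 - om); [|lra].
      apply (nonneg_of_upcrossing (fun x => w x - om) dw x x0); [lra | | | lra].
      * intros y Hy. cont. apply Hc. lra.
      * intros y Hy H. split.
        -- eapply is_derive_eq; [der; apply Hw; lra | ring].
        -- apply Hup; lra.
    + exists r. split; [exact Hr|]. left. intros x Hx. apply Rnot_lt_le. intros H.
      apply Hno. now exists x.
  - destruct (classic (exists x, 0 < x < r /\ om < w x)) as [[x0 [Hx0 H0]] | Hno].
    + exists x0. split; [lra|]. left. intros x Hx. apply Rnot_lt_le. intros Hlt.
      assert (0 <= om - w x0); [|lra].
      apply (nonneg_of_upcrossing (fun x => om - w x) (fun x => - dw x) x x0); [lra | | | lra].
      * intros y Hy. cont. apply Hc. lra.
      * intros y Hy H. split.
        -- eapply is_derive_eq; [der; apply Hw; lra | ring].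
        -- assert (dw y < 0) by (apply Hdn; lra). lra.
    + exists r. split; [exact Hr|]. right. intros x Hx. apply Rnot_lt_le. intros H.
      apply Hno. now exists x.
Qed.

(** A bounded function that crosses a dense set of levels in one direction only
    cannot oscillate. *)
Lemma limit_of_one_way (w dw : R -> R) (r lo hi : R) : 0 < r ->
  (forall x, 0 < x < r -> is_derive w x (dw x)) ->
  (forall x, 0 < x < r -> lo <= w x <= hi) ->
  (forall a b, a < b -> exists om r', a < om < b /\ 0 < r' <= r /\ one_way w dw om r') ->
  exists l, filterlim w (at_right 0) (locally l).
Proof.
  intros Hr Hw Hb Hdense.
  pose (S := fun om => exists r', 0 < r' /\ forall x, 0 < x < r' -> om <= w x).
  destruct (completeness S) as [l [Hub Hlub]].
  { exists hi. intros om [r' [Hr' H]].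
    destruct (pick_right 0 r r') as [t [Ht1 Ht2]]; [lra | lra |].
    assert (om <= w t) by (apply H; lra).
    assert (lo <= w t <= hi) by (apply Hb; lra). lra. }
  { exists lo, r. split; [exact Hr|]. intros x Hx. now apply Hb. }
  exists l. apply lim_right. intros e He.
  destruct (Hdense l (l + e)) as [om [r1 [Hom [Hr1 Hway]]]]; [lra|].
  destruct (one_way_settles w dw om r1) as [r2 [Hr2 [Hge | Hle]]]; try lra; try assumption.
  { intros x Hx. apply Hw. lra. }
  { assert (om <= l) by (apply Hub; exists r2; auto). lra. }
  assert (Hbelow : exists om', l - e < om' /\ S om').
  { apply NNPP. intros Hno. assert (l <= l - e); [|lra].
    apply Hlub. intros x Hx. apply Rnot_lt_le. intros Hlt. apply Hno. now exists x. }
  destruct Hbelow as [om' [Hom' [r3 [Hr3 Hge]]]].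
  destruct (pick_small r2 r3 Hr2 Hr3) as [r4 [Hr4 [H2 H3]]].
  exists r4. split; [exact Hr4|]. intros x Hx.
  assert (w x <= om) by (apply Hle; lra). assert (om' <= w x) by (apply Hge; lra).
  apply Rabs_def1; lra.
Qed.

(** Of three equidistant points, one is not among the two roots. *)
Lemma quadratic_nonroot (B C a b : R) : a < b ->
  exists x, a < x < b /\ x ^ 2 + B * x + C <> 0.
Proof.
  intros Hab. set (h := (b - a) / 4).
  assert (Hh : 0 < h) by (unfold h; lra). assert (Hb : b = a + 4 * h) by (unfold h; lra).
  destruct (Req_dec ((a + h) ^ 2 + B * (a + h) + C) 0) as [E1 | N]; [|exists (a + h); split; [lra | exact N]].
  destruct (Req_dec ((a + 2 * h) ^ 2 + B * (a + 2 * h) + C) 0) as [E2 | N]; [|exists (a + 2 * h); split; [lra | exact N]].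
  exists (a + 3 * h). split; [lra|]. intros E3.
  assert (h * h = 0) by lra. nra.
Qed.

(** The ratio [w = P (D - r) / r] satisfies [r w' = - (w + g + c (D^2 - r^2) / w)]. It is
    bounded, and as [r -> 0] the bracket takes at a level [w = om] the sign of the
    quadratic [om^2 + g om + c D^2], so all levels but two are crossed one way. *)
Lemma sonic_slope (D c : R) (g P : R -> R) : 0 < D -> 0 < c ->
  (forall s, continuous g s) -> (exists M, forall s, Rabs (g s) <= M) ->
  singular_sol D c g P -> P D = 0 ->
  exists l, filterlim (fun r => P (D - r) / r) (at_right 0) (locally l).
Proof.
  intros HD Hc Hg [M HM] [HPc [HP0 [[et [La [Het [HLa Hb]]]] HPd]]] HPD.
  pose (w := fun r => P (D - r) / r).
  pose (dw := fun r => - (w r + g (D - r) + c * (D ^ 2 - r ^ 2) / w r) / r).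
  assert (Hpos : forall r, 0 < r < D -> et * (D - r) <= w r).
  { intros r Hr. unfold w. apply le_div; [lra|].
    assert (H := Hb (D - r) ltac:(lra)). nra. }
  assert (Hwpos : forall r, 0 < r < D -> 0 < w r).
  { intros r Hr. assert (H := Hpos r Hr). nra. }
  assert (HPpos : forall s, 0 < s < D -> 0 < P s).
  { intros s Hs. assert (H := Hb s ltac:(lra)).
    assert (0 < et * s * (D - s)) by (repeat apply Rmult_lt_0_compat; lra). lra. }
  assert (Hup : forall r, 0 < r < D -> w r <= M).
  { intros r Hr. unfold w. apply div_le; [lra|].
    assert (H : P (D - r) - M * (D - (D - r)) <= P D - M * (D - D)); [|rewrite HPD in H; lra].
    apply (nondecreasing_of_derive (fun s => P s - M * (D - s))
      (fun s => g s + c * (D - s) * s * (2 * D - s) / P s + M) (D - r) D); [lra | |].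
    - intros s _. cont. apply HPc.
    - intros s Hs. split.
      + eapply is_derive_eq; [der; apply HPd; lra | cbv beta; ring].
      + assert (H := HM s). apply Rabs_le_between in H.
        assert (0 <= c * (D - s) * s * (2 * D - s) / P s); [|lra].
        apply Rdiv_le_0_compat; [|apply HPpos; lra].
        repeat apply Rmult_le_pos; lra. }
  assert (Hwd : forall r, 0 < r < D -> is_derive w r (dw r)).
  { intros r Hr. unfold w. assert (HPr := HPpos (D - r) ltac:(lra)).
    eapply is_derive_eq.
    - apply der_div; [|der | lra].
      apply (der_comp P (fun r => D - r)); [apply HPd; lra | der].
    - cbv beta. unfold dw, w. field. lra. }
  apply (limit_of_one_way w dw (D / 2) 0 M); [lra | | |].
  - intros r Hr. apply Hwd. lra.
  - intros r Hr. split; [left; apply Hwpos | apply Hup]; lra.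
  - intros a b Hab. destruct (quadratic_nonroot (g D) (c * D ^ 2) a b Hab) as [om [Hom Hnr]].
    exists om.
    destruct (Rle_or_lt om 0) as [Hom0 | Hom0].
    { exists (D / 2). split; [exact Hom|]. split; [lra|]. left. intros x Hx Hwx.
      assert (0 < w x) by (apply Hwpos; lra). lra. }
    pose (phi := fun r => om ^ 2 + g (D - r) * om + c * (D ^ 2 - r ^ 2)).
    assert (Hphic : continuous phi 0).
    { unfold phi. cont. apply (cont_comp g (fun r => D - r)); [cont | apply Hg]. }
    assert (Hphi0 : phi 0 = om ^ 2 + g D * om + c * D ^ 2).
    { unfold phi. rewrite Rminus_0_r. ring. }
    assert (Hdw : forall x, 0 < x -> w x = om -> dw x * (x * om) = - phi x).
    { intros x Hx Hwx. unfold dw, phi. rewrite Hwx. field. lra. }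
    destruct (Rtotal_order (phi 0) 0) as [Hlt | [Heq | Hgt]].
    + destruct (cont_pos_near (fun r => - phi r) 0) as [d [Hd Hn]]; [cont | lra |].
      destruct (pick_small d (D / 2)) as [r [Hr [H1 H2]]]; [exact Hd | lra |].
      exists r. split; [exact Hom|]. split; [lra|].
      left. intros x Hx Hwx.
      assert (0 < - phi x) by (apply Hn, Rabs_def1; lra).
      assert (Hk := Hdw x ltac:(lra) Hwx). assert (0 < x * om) by nra. nra.
    + exfalso. apply Hnr. lra.
    + destruct (cont_pos_near phi 0 Hphic Hgt) as [d [Hd Hn]].
      destruct (pick_small d (D / 2)) as [r [Hr [H1 H2]]]; [exact Hd | lra |].
      exists r. split; [exact Hom|]. split; [lra|].
      right. intros x Hx Hwx.
      assert (0 < phi x) by (apply Hn, Rabs_def1; lra).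
      assert (Hk := Hdw x ltac:(lra) Hwx). assert (0 < x * om) by nra. nra.
Qed.

(** * One side of the profile *)

Lemma lim_minf_le (f : R -> R) (l x1 : R) :
  (forall x y, x <= y -> y < x1 -> f x <= f y) ->
  filterlim f (Rbar_locally m_infty) (locally l) -> forall x, x < x1 -> l <= f x.
Proof.
  intros Hm Hl x Hx. apply Rnot_lt_le. intros Hlt.
  destruct (proj1 (lim_minf f l) Hl (l - f x)) as [M HM]; [lra|].
  destruct (exists_below M x) as [y [Hy1 Hy2]].
  assert (H := HM y Hy1). apply Rabs_def2 in H.
  assert (f y <= f x) by (apply Hm; lra). lra.
Qed.

Lemma lim_minf_lt (f : R -> R) (l x1 : R) :
  (forall x y, x < y -> y < x1 -> f x < f y) ->
  filterlim f (Rbar_locally m_infty) (locally l) -> forall x, x < x1 -> l < f x.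
Proof.
  intros Hm Hl x Hx. apply Rle_lt_trans with (f (x - 1)).
  - apply lim_minf_le with x1; [|exact Hl | lra].
    intros y z [Hyz | ->] Hz; [left; now apply Hm | apply Rle_refl].
  - apply Hm; lra.
Qed.

Lemma lim_opp (F : (R -> Prop) -> Prop) {FF : Filter F} (f : R -> R) (l : R) :
  filterlim f F (locally l) -> filterlim (fun x => - f x) F (locally (- l)).
Proof.
  intros H. apply (filterlim_comp _ _ _ f Ropp F (locally l) (locally (- l)) H).
  apply (continuous_opp (fun x : R => x)). apply cont_id.
Qed.

Section Saddle.

Variables (A K x1 : R) (Y p beta : R -> R).
Hypotheses (HA : 0 < A) (HK : 0 < K).
Hypothesis HY : forall x, x < x1 -> is_derive Y x (A * p x).
Hypothesis Hp : forall x, x < x1 -> is_derive p x (K * Y x + beta x * p x).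
Hypothesis Hbeta : forall x, x < x1 -> continuous beta x.
Hypothesis Hlim : filterlim Y (Rbar_locally m_infty) (locally 0).

Lemma saddle_product_derive x : x < x1 ->
  is_derive (fun x => Y x * p x) x (A * p x ^ 2 + K * Y x ^ 2 + beta x * (Y x * p x)).
Proof.
  intros Hx. eapply is_derive_eq; [der; [apply HY | apply Hp]; exact Hx|]. cbv beta. ring.
Qed.

Lemma saddle_cont x : x < x1 -> continuous Y x /\ continuous p x.
Proof.
  intros Hx. split; eapply der_continuous; [apply HY | apply Hp]; exact Hx.
Qed.

Lemma saddle_square_le x y : x <= y -> y < x1 ->
  (forall t, x < t < y -> 0 <= Y t * p t) -> Y x ^ 2 <= Y y ^ 2.
Proof.
  intros Hxy Hy H.
  apply (nondecreasing_of_derive (fun t => Y t ^ 2) (fun t => 2 * A * (Y t * p t)) x y Hxy).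
  - intros t Ht. apply cont_pow2. apply saddle_cont. lra.
  - intros t Ht. split.
    + eapply is_derive_eq; [der; apply HY; lra | cbv beta; ring].
    + assert (0 <= Y t * p t) by now apply H. nra.
Qed.

Lemma saddle_product_nonneg x : x < x1 -> 0 <= Y x * p x.
Proof.
  intros Hx. apply Rnot_lt_le. intros Hneg.
  assert (Hdec : forall a b, a <= b -> b < x1 ->
    (forall t, a < t < b -> Y t * p t < 0) -> Y b ^ 2 <= Y a ^ 2).
  { intros a b Hab Hb H.
    assert (Hm : - Y a ^ 2 <= - Y b ^ 2); [|lra].
    apply (nondecreasing_of_derive (fun t => - Y t ^ 2) (fun t => - (2 * A * (Y t * p t))) a b Hab).
    - intros t Ht. cont. apply saddle_cont. lra.
    - intros t Ht. split.
      + eapply is_derive_eq; [der; apply HY; lra | cbv beta; ring].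
      + specialize (H t Ht). nra. }
  assert (Hall : forall y, y <= x -> Y y * p y < 0).
  { intros y Hyx. apply Rnot_le_lt. intros Hy.
    destruct (last_nonneg (fun t => Y t * p t) y x) as [m [Hm [Hm0 Hafter]]]; auto.
    { intros t Ht. destruct (saddle_cont t) as [H1 H2]; [lra|]. cont. }
    assert (Hmd := saddle_product_derive m ltac:(lra)).
    assert (HYm : Y x ^ 2 <= Y m ^ 2).
    { apply Hdec; [lra | lra|]. intros t Ht. apply Hafter. lra. }
    assert (HYx : 0 < Y x ^ 2) by (destruct (Req_dec (Y x) 0) as [E|N]; [rewrite E in Hneg; lra | nra]).
    destruct (derive_pos_right _ _ _ Hmd) as [d [Hd Hr]].
    { cbv beta in Hm0. rewrite Hm0. assert (0 <= p m ^ 2) by apply pow2_ge_0. nra. }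
    cbv beta in Hm0, Hr. rewrite Hm0 in Hr.
    destruct (pick_right m (m + d) x) as [t [Ht1 Ht2]]; [lra | lra |].
    assert (Y t * p t < 0) by (apply Hafter; lra).
    assert (0 < Y t * p t) by (apply Hr; lra). lra. }
  assert (HYx : Y x <> 0) by (intros E; rewrite E in Hneg; lra).
  destruct (proj1 (lim_minf Y 0) Hlim (Rabs (Y x))) as [M HM]; [now apply Rabs_pos_lt|].
  destruct (exists_below M x) as [y [Hy1 Hy2]].
  assert (H := HM y Hy1). rewrite Rminus_0_r in H.
  assert (Y x ^ 2 <= Y y ^ 2).
  { apply Hdec; [lra | lra|]. intros t Ht. apply Hall. lra. }
  assert (Rabs (Y y) ^ 2 < Rabs (Y x) ^ 2).
  { assert (Hq := Rabs_pos (Y y)). nra. }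
  rewrite !pow2_abs in *. lra.
Qed.

Lemma saddle_zero x : x < x1 -> Y x * p x = 0 -> Y x = 0 /\ p x = 0.
Proof.
  intros Hx H0.
  destruct (Rle_lt_or_eq_dec 0 (A * p x ^ 2 + K * Y x ^ 2)) as [Hpos | E].
  { assert (H1 := pow2_ge_0 (p x)). assert (H2 := pow2_ge_0 (Y x)). nra. }
  - exfalso. assert (Hd := saddle_product_derive x Hx).
    destruct (derive_pos_left _ _ _ Hd) as [d [Hd0 Hl]].
    { rewrite H0. lra. }
    cbv beta in Hl. specialize (Hl (x - d / 2) ltac:(lra)).
    assert (H := saddle_product_nonneg (x - d / 2) ltac:(lra)). lra.
  - assert (H1 := pow2_ge_0 (p x)). assert (H2 := pow2_ge_0 (Y x)).
    assert (E1 : Y x ^ 2 = 0) by nra. assert (E2 : p x ^ 2 = 0) by nra.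
    split; apply Rsqr_0_uniq; unfold Rsqr; lra.
Qed.

(** A Gronwall estimate for [Y^2 + p^2]. *)
Lemma saddle_stays_zero x y : x <= y -> y < x1 -> Y x = 0 -> p x = 0 -> Y y = 0 /\ p y = 0.
Proof.
  intros Hxy Hy HYx Hpx.
  destruct (continuity_ab_maj (fun t => Rabs (beta t)) x y Hxy) as [tm [Hmax _]].
  { intros t Ht. apply continuity_pt_filterlim. apply cont_abs, Hbeta. lra. }
  set (B := Rabs (beta tm)) in Hmax. pose (C := A + K + 2 * B).
  pose (f := fun t => - ((Y t ^ 2 + p t ^ 2) * exp (- C * t))).
  assert (Hexp : forall t, is_derive (fun t => exp (- C * t)) t (- C * exp (- C * t))).
  { intros t. eapply is_derive_eq.
    - apply (der_comp exp (fun t => - C * t)); [apply is_derive_exp | der].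
    - cbv beta. ring. }
  assert (Hf : f x <= f y).
  { apply nondecreasing_of_derive with
      (fun t => - ((2 * Y t * (A * p t) + 2 * p t * (K * Y t + beta t * p t)
                    - C * (Y t ^ 2 + p t ^ 2)) * exp (- C * t))); [exact Hxy | |].
    - intros t Ht. destruct (saddle_cont t) as [H1 H2]; [lra|]. unfold f. cont.
      eapply der_continuous, Hexp.
    - intros t Ht. split.
      + unfold f. eapply is_derive_eq.
        * apply der_opp, der_mult; [der; [apply HY | apply Hp]; lra | apply Hexp].
        * cbv beta. ring.
      + assert (He := exp_pos (- C * t)).
        assert (Hb := Hmax t ltac:(lra)). cbv beta in Hb. apply Rabs_le_between in Hb.
        assert (2 * Y t * (A * p t) + 2 * p t * (K * Y t + beta t * p t)
                <= C * (Y t ^ 2 + p t ^ 2)); [|nra].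
        assert (H1 := pow2_ge_0 (Y t - p t)). assert (H2 := pow2_ge_0 (Y t)).
        assert (H3 := pow2_ge_0 (p t)).
        assert (2 * (Y t * p t) <= Y t ^ 2 + p t ^ 2) by nra.
        assert (beta t * p t ^ 2 <= B * p t ^ 2) by (apply Rmult_le_compat_r; lra).
        assert (0 <= B * Y t ^ 2) by (apply Rmult_le_pos; [apply Rabs_pos | lra]).
        unfold C. nra. }
  unfold f in Hf. rewrite HYx, Hpx in Hf.
  assert (He := exp_pos (- C * y)).
  assert (H2 := pow2_ge_0 (Y y)). assert (H3 := pow2_ge_0 (p y)).
  assert (Y y ^ 2 + p y ^ 2 <= 0) by nra.
  split; apply Rsqr_0_uniq; unfold Rsqr; nra.
Qed.

(** The linear system with matrix [[0, A], [K, beta]] has negative determinant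
    whatever [beta]: along solutions with [Y -> 0] in the past, [Y * p] cannot be
    negative because [Y ^ 2] would then decrease in time. *)
Lemma saddle_dichotomy :
  (forall x, x < x1 -> 0 < Y x * p x) \/ (forall x, x < x1 -> Y x = 0 /\ p x = 0).
Proof.
  destruct (classic (exists x, x < x1 /\ Y x * p x = 0)) as [[x0 [Hx0 H0]] | Hno].
  - right. intros x Hx. destruct (saddle_zero x0 Hx0 H0) as [HY0 Hp0].
    destruct (Rle_or_lt x0 x) as [Hle | Hlt].
    + now apply saddle_stays_zero with x0.
    + apply saddle_zero; [exact Hx|].
      assert (Y x ^ 2 <= Y x0 ^ 2).
      { apply saddle_square_le; [lra | exact Hx0|]. intros t Ht. apply saddle_product_nonneg. lra. }
      rewrite HY0 in H. assert (E : Y x = 0); [|rewrite E; ring].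
      apply Rsqr_0_uniq. unfold Rsqr. assert (H2 := pow2_ge_0 (Y x)). nra.
  - left. intros x Hx. destruct (Rle_lt_or_eq_dec _ _ (saddle_product_nonneg x Hx)) as [H | E]; [exact H|].
    exfalso. apply Hno. exists x. auto.
Qed.

End Saddle.

Lemma sign_constant (f : R -> R) (x1 : R) :
  (forall x, x < x1 -> continuous f x) -> (forall x, x < x1 -> f x <> 0) ->
  (forall x, x < x1 -> 0 < f x) \/ (forall x, x < x1 -> f x < 0).
Proof.
  intros Hc Hnz.
  assert (Hkey : forall x y, x < x1 -> y < x1 -> 0 < f x -> f y < 0 -> False).
  { intros x y Hx Hy Hfx Hfy. destruct (Rle_or_lt x y) as [Hxy | Hxy].
    - destruct (last_nonneg f x y Hxy) as [m [Hm [Hm0 _]]]; [|lra | exact Hfy |].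
      + intros t Ht. apply Hc. lra.
      + apply (Hnz m); [lra | exact Hm0].
    - destruct (last_nonneg (fun t => - f t) y x) as [m [Hm [Hm0 _]]]; [lra | | lra | lra |].
      + intros t Ht. cont. apply Hc. lra.
      + apply (Hnz m); lra. }
  assert (Hx : x1 - 1 < x1) by lra.
  destruct (Rtotal_order (f (x1 - 1)) 0) as [H | [H | H]].
  - right. intros x Hx'. destruct (Rtotal_order (f x) 0) as [H' | [H' | H']]; [exact H' | |].
    + now apply Hnz in H'.
    + exfalso. now apply (Hkey x (x1 - 1)).
  - now apply Hnz in H.
  - left. intros x Hx'. destruct (Rtotal_order (f x) 0) as [H' | [H' | H']]; [| |exact H'].
    + exfalso. now apply (Hkey (x1 - 1) x).
    + now apply Hnz in H'.
Qed.

Lemma der_RInt_on (h : R -> R) (lo hi a x : R) :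
  lo < a < hi -> lo < x < hi -> (forall t, lo < t < hi -> continuous h t) ->
  is_derive (fun u => RInt h a u) x (h x).
Proof.
  intros Ha Hx H. apply (is_derive_RInt h (fun u => RInt h a u) a x).
  - apply locally_R. exists (Rmin (x - lo) (hi - x)). split; [apply Rmin_pos; lra|].
    intros y Hy. assert (H1 := Rmin_l (x - lo) (hi - x)). assert (H2 := Rmin_r (x - lo) (hi - x)).
    apply Rabs_def2 in Hy.
    apply (RInt_correct h), (ex_RInt_continuous h). intros z Hz. apply H.
    unfold Rmin, Rmax in Hz. destruct (Rle_dec a y); lra.
  - now apply H.
Qed.

(** Solving [v' = - 1 / h v] by inverting the time function [T], with [T' = h]. *)
Lemma inverse_flow (T h : R -> R) (d D : R) : d < D ->
  (forall u, d < u < D -> is_derive T u (h u) /\ 0 < h u) ->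
  (exists m, forall u, d < u < D -> m <= T u) ->
  (forall A, exists u, d < u < D /\ A < T u) ->
  exists v : R -> R,
    (forall x, continuous v x) /\ (forall x, 0 <= x -> v x = d) /\
    (forall x, x < 0 -> d < v x < D /\ is_derive v x (- / h (v x))) /\
    filterlim v (Rbar_locally m_infty) (locally D).
Proof.
  intros HdD HT [m Hm] Hinf.
  assert (HTc : forall u, d < u < D -> continuous T u).
  { intros u Hu. eapply der_continuous. now apply HT. }
  assert (Hinc : forall a b, d < a -> a < b -> b < D -> T a < T b).
  { intros a b Ha Hab Hb. apply increasing_of_derive with h; [exact Hab | |].
    - intros t Ht. apply HTc. lra.
    - intros t Ht. apply HT. lra. }
  assert (Hinc' : forall a b, d < a < D -> d < b < D -> T a < T b -> a < b).
  { intros a b Ha Hb Hab. apply Rnot_le_lt. intros [Hba | ->]; [|lra].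
    assert (T b < T a) by (apply Hinc; lra). lra. }
  destruct (completeness (fun t => exists u, d < u < D /\ t = - T u)) as [t0 [Hub Hlub]].
  { exists (- m). intros t [u [Hu ->]]. assert (H := Hm u Hu). lra. }
  { exists (- T ((d + D) / 2)), ((d + D) / 2). split; [lra | reflexivity]. }
  pose (T0 := - t0).
  assert (HT0 : forall u, d < u < D -> T0 < T u).
  { intros u Hu. assert (- T ((d + u) / 2) <= t0).
    { apply Hub. exists ((d + u) / 2). split; [lra | reflexivity]. }
    assert (T ((d + u) / 2) < T u) by (apply Hinc; lra). unfold T0. lra. }
  assert (Hex : forall x, exists u, (x < 0 -> d < u < D /\ T u = T0 - x) /\ (0 <= x -> u = d)).
  { intros x. destruct (Rlt_or_le x 0) as [Hx | Hx].
    2: { exists d. split; [lra | auto]. }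
    assert (Hlow : exists u, d < u < D /\ T u < T0 - x).
    { apply NNPP. intros Hno. assert (t0 <= - (T0 - x)); [|unfold T0 in *; lra].
      apply Hlub. intros t [u [Hu ->]]. apply Ropp_le_contravar, Rnot_lt_le. intros Hlt.
      apply Hno. now exists u. }
    destruct Hlow as [u1 [Hu1 HTu1]]. destruct (Hinf (T0 - x)) as [u2 [Hu2 HTu2]].
    assert (H12 : u1 < u2) by (apply Hinc'; [exact Hu1 | exact Hu2 | lra]).
    destruct (intermediate_value T u1 u2 (T0 - x)) as [u [Hu HTu]]; [lra | | lra |].
    { intros t Ht. apply HTc. lra. }
    exists u. split; [intros _; split; [lra | exact HTu] | lra]. }
  pose (v := fun x => proj1_sig (constructive_indefinite_description _ (Hex x))).
  assert (Hv1 : forall x, x < 0 -> d < v x < D /\ T (v x) = T0 - x).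
  { intros x. apply (proj2_sig (constructive_indefinite_description _ (Hex x))). }
  assert (Hv2 : forall x, 0 <= x -> v x = d).
  { intros x. apply (proj2_sig (constructive_indefinite_description _ (Hex x))). }
  assert (Hcneg : forall x, x < 0 -> continuous v x).
  { intros x Hx. apply cont_eps. intros e He.
    destruct (Hv1 x Hx) as [Hvx HTx].
    destruct (pick_right 0 (v x - d) (D - v x)) as [e0 [He0 He1]]; [lra | lra |].
    destruct (pick_right 0 e e0) as [e' [He' He2]]; [lra | lra |].
    assert (HTl : T (v x - e') < T (v x)) by (apply Hinc; lra).
    assert (HTr : T (v x) < T (v x + e')) by (apply Hinc; lra).
    destruct (pick_small (T (v x) - T (v x - e')) (T (v x + e') - T (v x)))
      as [d1 [Hd1 [Hn1 Hn2]]]; [lra | lra |].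
    destruct (pick_small (- x) d1) as [d2 [Hd2 [Hn3 Hn4]]]; [lra | exact Hd1 |].
    exists d2. split; [exact Hd2|]. intros y Hy. apply Rabs_def2 in Hy.
    destruct (Hv1 y) as [Hvy HTy]; [lra|].
    assert (v y < v x + e') by (apply Hinc'; lra).
    assert (v x - e' < v y) by (apply Hinc'; lra).
    apply Rabs_def1; lra. }
  exists v. split; [|split; [exact Hv2 | split]].
  - intros x. destruct (Rtotal_order x 0) as [Hx | [-> | Hx]].
    + now apply Hcneg.
    + apply cont_eps. intros e He. rewrite (Hv2 0) by lra.
      destruct (pick_right d (d + e) D) as [u [Hu1 Hu2]]; [lra | lra |].
      assert (HTu := HT0 u ltac:(lra)).
      exists (T u - T0). split; [lra|]. intros y Hy. apply Rabs_def2 in Hy.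
      destruct (Rlt_or_le y 0) as [Hy0 | Hy0].
      * destruct (Hv1 y Hy0) as [Hvy HTy].
        assert (v y < u) by (apply Hinc'; lra). apply Rabs_def1; lra.
      * rewrite (Hv2 y Hy0), Rminus_eq_0, Rabs_R0. exact He.
    + apply continuous_ext_loc with (fun _ => d); [|cont].
      apply locally_R. exists x. split; [exact Hx|]. intros y Hy. apply Rabs_def2 in Hy.
      symmetry. apply Hv2. lra.
  - intros x Hx. destruct (Hv1 x Hx) as [Hvx HTx]. split; [exact Hvx|].
    destruct (HT (v x) Hvx) as [HTd Hh].
    pose (q := fun w => if Req_EM_T w (v x) then h (v x) else (T w - T (v x)) / (w - v x)).
    assert (Hq0 : q (v x) = h (v x)).
    { unfold q. destruct (Req_EM_T (v x) (v x)); [reflexivity | lra]. }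
    assert (Hqc : continuous q (v x)).
    { apply cont_eps. intros e He. apply is_derive_Reals in HTd.
      destruct (HTd e He) as [[dl Hdl] Hlim]. simpl in Hlim. exists dl. split; [exact Hdl|].
      intros w Hw. rewrite Hq0. unfold q. destruct (Req_EM_T w (v x)) as [_ | N].
      - rewrite Rminus_eq_0, Rabs_R0. exact He.
      - specialize (Hlim (w - v x)). replace (v x + (w - v x)) with w in Hlim by ring.
        apply Hlim; [lra | exact Hw]. }
    assert (Hqv : continuous (fun y => - / q (v y)) x).
    { cont.
      - apply (cont_comp q v); [now apply Hcneg | exact Hqc].
      - rewrite Hq0. lra. }
    apply is_derive_Reals. intros e He.
    destruct (proj1 (cont_eps _ x) Hqv e He) as [dl [Hdl Hlim]].
    destruct (pick_small dl (- x)) as [d' [Hd' [Ht1 Ht2]]]; [exact Hdl | lra |].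
    exists (mkposreal _ Hd'). simpl. intros t Ht0 Ht.
    assert (Hxt : x + t < 0) by (apply Rabs_def2 in Ht; lra).
    destruct (Hv1 (x + t) Hxt) as [Hvt HTt].
    specialize (Hlim (x + t)). replace (x + t - x) with t in Hlim by ring.
    specialize (Hlim ltac:(lra)). cbv beta in Hlim. rewrite Hq0 in Hlim.
    assert (N : v (x + t) <> v x) by (intros E; rewrite E in HTt; lra).
    replace ((v (x + t) - v x) / t) with (- / q (v (x + t))); [exact Hlim|].
    unfold q. destruct (Req_EM_T (v (x + t)) (v x)) as [E | _]; [contradiction|].
    rewrite HTt, HTx. field. repeat split; lra.
  - apply lim_minf. intros e He.
    destruct (pick_left (D - e) d D) as [u [Hu1 Hu2]]; [lra | lra |].
    assert (HTu := HT0 u ltac:(lra)).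
    exists (T0 - T u). intros x Hx. destruct (Hv1 x) as [Hvx HTx]; [lra|].
    assert (u < v x) by (apply Hinc'; lra). apply Rabs_def1; lra.
Qed.

Section HalfProfile.

Variables (K b D hi : R) (G dG : R -> R).
Hypotheses (HK : 0 < K) (Hb : 0 < b) (HD : 0 < D) (Hhi : D < hi).
Hypothesis HG : forall v, 0 <= v < hi -> is_derive G v (dG v).
Hypothesis HdG : forall v, 0 <= v < hi -> continuous dG v.

Definition half_profile (x1 : R) (n v : R -> R) : Prop :=
  (forall x, x < x1 -> 0 < v x < hi /\ is_derive n x (K * (D ^ 2 - v x ^ 2)) /\
     is_derive v x (- b * (n x - G (v x)) / v x)) /\
  filterlim v (Rbar_locally m_infty) (locally D) /\
  filterlim n (Rbar_locally m_infty) (locally (G D)).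

(** The clamp makes the coefficient continuous on the whole line. *)
Definition gap_slope (s : R) : R := dG (D - clamp D s).

(** [P] gives the distance [n - G v] of the radiation from equilibrium in terms of
    [s = D - v]. *)
Definition gap_curve (P : R -> R) : Prop := singular_sol D (K / b) gap_slope P.

Lemma gap_slope_cont s : continuous gap_slope s.
Proof.
  apply (cont_comp dG (fun s => D - clamp D s)).
  - cont. apply clamp_cont.
  - apply HdG. assert (H := clamp_bounds D s (Rlt_le _ _ HD)). lra.
Qed.

Lemma gap_slope_bounded : exists M, forall s, Rabs (gap_slope s) <= M.
Proof.
  destruct (continuity_ab_maj (fun s => Rabs (gap_slope s)) 0 D) as [m [Hm _]]; [lra | |].
  - intros s _. apply continuity_pt_filterlim. apply cont_abs, gap_slope_cont.
  - exists (Rabs (gap_slope m)). intros s.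
    replace (gap_slope s) with (gap_slope (clamp D s)).
    + apply Hm, clamp_bounds. lra.
    + unfold gap_slope. rewrite (clamp_id D (clamp D s)); [reflexivity|].
      apply clamp_bounds. lra.
Qed.

Lemma Kb_pos : 0 < K / b.
Proof. now apply Rdiv_lt_0_compat. Qed.

Lemma gap_curve_exists : exists P, gap_curve P.
Proof.
  destruct gap_slope_bounded as [M HM].
  exact (singular_solution D (K / b) M gap_slope HD Kb_pos gap_slope_cont HM).
Qed.

Lemma gap_curve_pos P s : gap_curve P -> 0 < s < D -> 0 < P s.
Proof.
  intros [_ [_ [[et [La [Het [_ Hbd]]]] _]]] Hs.
  assert (H := Hbd s ltac:(lra)).
  assert (0 < et * s * (D - s)) by (repeat apply Rmult_lt_0_compat; lra). lra.
Qed.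

Lemma gap_curve_derive P v : gap_curve P -> 0 < v < D ->
  is_derive P (D - v) (dG v + K / b * v * (D ^ 2 - v ^ 2) / P (D - v)).
Proof.
  intros HP Hv. assert (Hpos := gap_curve_pos P (D - v) HP ltac:(lra)).
  destruct HP as [_ [_ [_ HPd]]].
  eapply is_derive_eq; [apply HPd; lra|].
  unfold gap_slope. rewrite clamp_id by lra.
  replace (D - (D - v)) with v by ring. field. lra.
Qed.

(** In the variables [Y = D^2 - v^2] and [p = n - G v] the equations are linear,
    [Y' = 2 b p] and [p' = K Y + beta p] with [beta = b G'(v) / v], whatever the sign
    of [beta]. *)
Lemma half_profile_dichotomy x1 n v : half_profile x1 n v ->
  (forall x, x < x1 -> v x < D /\ 0 < n x - G (v x)) \/
  (forall x, x < x1 -> v x = D /\ n x = G D) \/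
  (forall x, x < x1 -> D < v x /\ n x - G (v x) < 0).
Proof.
  intros [Hode [Hv Hn]].
  pose (Y := fun x => D ^ 2 - v x ^ 2). pose (p := fun x => n x - G (v x)).
  assert (HY : forall x, x < x1 -> is_derive Y x (2 * b * p x)).
  { intros x Hx. destruct (Hode x Hx) as [Hvx [Hnd Hvd]].
    unfold Y. eapply is_derive_eq; [der|]. unfold p. cbv beta. field. lra. }
  assert (Hp : forall x, x < x1 ->
    is_derive p x (K * Y x + dG (v x) * b / v x * p x)).
  { intros x Hx. destruct (Hode x Hx) as [Hvx [Hnd Hvd]].
    unfold p. eapply is_derive_eq.
    - der. apply (der_comp G v); [apply HG; lra | exact Hvd].
    - unfold Y. cbv beta. field. lra. }
  assert (Hvc : forall x, x < x1 -> continuous v x).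
  { intros x Hx. destruct (Hode x Hx) as [_ [_ Hvd]]. now apply der_continuous in Hvd. }
  assert (Hbeta : forall x, x < x1 -> continuous (fun x => dG (v x) * b / v x) x).
  { intros x Hx. destruct (Hode x Hx) as [Hvx _]. cont.
    - apply (cont_comp dG v); [now apply Hvc | apply HdG; lra].
    - now apply Hvc.
    - lra. }
  assert (HYlim : filterlim Y (Rbar_locally m_infty) (locally 0)).
  { replace 0 with (D ^ 2 - D ^ 2) by ring.
    apply (filterlim_comp _ _ _ v (fun u => D ^ 2 - u ^ 2) _ _ _ Hv).
    apply (cont_minus (fun _ => D ^ 2) (fun u => u ^ 2)); cont. }
  assert (Hsplit : forall x, x < x1 -> Y x = (D - v x) * (D + v x)).
  { intros x Hx. unfold Y. ring. }
  destruct (saddle_dichotomy (2 * b) K x1 Y p (fun x => dG (v x) * b / v x))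
    as [Hpos | Hzero]; auto; [lra | |].
  - assert (HYc : forall x, x < x1 -> continuous Y x).
    { intros x Hx. eapply der_continuous, HY, Hx. }
    destruct (sign_constant Y x1 HYc) as [Hs | Hs].
    + intros x Hx E. specialize (Hpos x Hx). rewrite E in Hpos. lra.
    + left. intros x Hx. specialize (Hs x Hx). specialize (Hpos x Hx).
      assert (0 < p x) by nra.
      destruct (Hode x Hx) as [Hvx _]. rewrite Hsplit in Hs by exact Hx.
      split; [nra | exact H].
    + right; right. intros x Hx. specialize (Hs x Hx). specialize (Hpos x Hx).
      assert (p x < 0) by nra.
      destruct (Hode x Hx) as [Hvx _]. rewrite Hsplit in Hs by exact Hx.
      split; [nra | exact H].
  - right; left. intros x Hx. destruct (Hzero x Hx) as [H1 H2].
    destruct (Hode x Hx) as [Hvx _]. rewrite Hsplit in H1 by exact Hx.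
    assert (E : v x = D) by nra. split; [exact E|].
    unfold p in H2. rewrite E in H2. lra.
Qed.

Lemma half_profile_n_lt x1 n v : half_profile x1 n v ->
  (forall x, x < x1 -> D < v x) -> forall x, x < x1 -> n x < G D.
Proof.
  intros [Hode [_ Hn]] HvD x Hx. apply Ropp_lt_cancel.
  apply (lim_minf_lt (fun x => - n x) (- G D) x1); [| |exact Hx].
  - intros a c Hac Hc.
    apply (increasing_of_derive (fun x => - n x) (fun t => - (K * (D ^ 2 - v t ^ 2)))); [exact Hac | |].
    + intros t Ht. cont. destruct (Hode t ltac:(lra)) as [_ [Hnd _]]. now apply der_continuous in Hnd.
    + intros t Ht. split; [apply der_opp, Hode; lra|].
      destruct (Hode t) as [Hvt _]; [lra|]. assert (H := HvD t ltac:(lra)).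
      assert (0 < K * (v t ^ 2 - D ^ 2)) by (apply Rmult_lt_0_compat; nra). nra.
  - now apply (lim_opp (Rbar_locally m_infty)).
Qed.

(** Two values of the gap at the same [v] approach each other along the flow,
    since [K (D^2 - v^2) (1/p - 1/q)] has the sign of [q - p]; both vanish in the past. *)
Lemma half_profile_gap x1 n v P : gap_curve P -> half_profile x1 n v ->
  (forall x, x < x1 -> v x < D /\ 0 < n x - G (v x)) ->
  forall x, x < x1 -> n x - G (v x) = P (D - v x).
Proof.
  intros HP [Hode [Hv Hn]] Hside.
  pose (f := fun x => n x - G (v x) - P (D - v x)).
  assert (Hf : forall x, x < x1 -> is_derive (fun x => - f x ^ 2) x
    (2 * K * (D ^ 2 - v x ^ 2) * f x ^ 2 / P (D - v x))).
  { intros x Hx. destruct (Hode x Hx) as [Hvx [Hnd Hvd]]. destruct (Hside x Hx) as [HvD _].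
    assert (HPd := gap_curve_derive P (v x) HP ltac:(lra)).
    assert (Hpos := gap_curve_pos P (D - v x) HP ltac:(lra)).
    unfold f. eapply is_derive_eq.
    - der.
      + apply (der_comp G v); [apply HG; lra | exact Hvd].
      + apply (der_comp P (fun x => D - v x)); [exact HPd | der].
    - cbv beta. field. lra. }
  assert (HPc := proj1 HP). assert (HP0 := proj1 (proj2 HP)).
  assert (HGc : continuous G D).
  { eapply der_continuous. apply HG. lra. }
  assert (Hlimf : filterlim (fun x => - f x ^ 2) (Rbar_locally m_infty) (locally 0)).
  { assert (H : filterlim f (Rbar_locally m_infty) (locally 0)).
    { replace 0 with (plus (plus (G D) (opp (G D))) (opp (P (D - D)))).
      2: { unfold plus, opp; simpl. rewrite Rminus_eq_0, HP0. ring. }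
      unfold f, Rminus.
      assert (Hopp : forall h l, filterlim h (Rbar_locally m_infty) (locally l) ->
        filterlim (fun x : R => - h x) (Rbar_locally m_infty) (locally (opp l))).
      { intros h l. apply (lim_opp (Rbar_locally m_infty)). }
      refine (filterlim_comp_2 _ _ plus _ _ (filterlim_plus _ _)).
      - refine (filterlim_comp_2 _ _ plus Hn _ (filterlim_plus _ _)).
        apply Hopp. apply (filterlim_comp _ _ _ v G _ _ _ Hv). exact HGc.
      - apply Hopp. apply (filterlim_comp _ _ _ v (fun u => P (D + - u)) _ _ _ Hv).
        apply (cont_comp P (fun u => D - u)); [cont | apply HPc]. }
    replace 0 with (- 0 ^ 2) by ring.
    apply (filterlim_comp _ _ _ f (fun y => - y ^ 2) _ _ _ H).
    apply (cont_opp (fun y => y ^ 2)). cont. }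
  intros x Hx.
  assert (H0 : 0 <= - f x ^ 2).
  { apply (lim_minf_le (fun x => - f x ^ 2) 0 x1); [|exact Hlimf | exact Hx].
    intros y z Hyz Hz.
    apply (nondecreasing_of_derive (fun x => - f x ^ 2)
      (fun x => 2 * K * (D ^ 2 - v x ^ 2) * f x ^ 2 / P (D - v x))); [exact Hyz | |].
    - intros t Ht. eapply der_continuous, Hf. lra.
    - intros t Ht. split; [apply Hf; lra|].
      destruct (Hode t) as [Hvt _]; [lra|]. destruct (Hside t) as [HvD _]; [lra|].
      apply Rdiv_le_0_compat.
      + apply Rmult_le_pos; [apply Rmult_le_pos; nra | apply pow2_ge_0].
      + apply gap_curve_pos; [exact HP | lra]. }
  assert (E : f x = 0).
  { apply Rsqr_0_uniq. unfold Rsqr. assert (H := pow2_ge_0 (f x)). nra. }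
  unfold f in E. lra.
Qed.

(** Along a profile [v' = - 1 / time_density]. *)
Definition time_density (P : R -> R) (u : R) : R := u / (b * P (D - u)).
Definition profile_time (P : R -> R) (u : R) : R := RInt (time_density P) (D / 2) u.

Lemma time_density_pos P u : gap_curve P -> 0 < u < D -> 0 < time_density P u.
Proof.
  intros HP Hu. assert (H := gap_curve_pos P (D - u) HP ltac:(lra)).
  apply Rdiv_lt_0_compat; [lra | now apply Rmult_lt_0_compat].
Qed.

Lemma profile_time_derive P u : gap_curve P -> 0 < u < D ->
  is_derive (profile_time P) u (time_density P u).
Proof.
  intros HP Hu. apply (der_RInt_on (time_density P) 0 D); [lra | exact Hu|].
  intros t Ht. assert (H := gap_curve_pos P (D - t) HP ltac:(lra)).
  unfold time_density. cont; [|nra].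
  apply (cont_comp P (fun u => D - u)); [cont | apply HP].
Qed.

Lemma profile_time_cont P u : gap_curve P -> 0 < u < D -> continuous (profile_time P) u.
Proof. intros HP Hu. eapply der_continuous, profile_time_derive; eassumption. Qed.

Lemma profile_time_increasing P u1 u2 : gap_curve P -> 0 < u1 -> u1 < u2 -> u2 < D ->
  profile_time P u1 < profile_time P u2.
Proof.
  intros HP H1 H12 H2. apply increasing_of_derive with (time_density P); [exact H12 | |].
  - intros t Ht. apply profile_time_cont; [exact HP | lra].
  - intros t Ht. split; [apply profile_time_derive | apply time_density_pos]; auto; lra.
Qed.

(** Near [v = 0], [P (D - v)] may vanish, but not faster than [v], so the time to
    reach the sonic point is finite. *)
Lemma profile_time_Lipschitz P top : gap_curve P -> 0 < top < D -> exists L, 0 < L /\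
  forall u1 u2, 0 < u1 -> u1 <= u2 -> u2 <= top ->
    profile_time P u2 - profile_time P u1 <= L * (u2 - u1).
Proof.
  intros HP Htop. assert (HP' := HP).
  destruct HP as [HPc [HP0 [[et [La [Het [HLa Hbd]]]] HPd]]].
  exists (/ (b * et * (D - top))). split.
  { apply Rinv_0_lt_compat. repeat apply Rmult_lt_0_compat; lra. }
  intros u1 u2 H1 H12 H2. set (L := / (b * et * (D - top))).
  assert (H : L * u1 - profile_time P u1 <= L * u2 - profile_time P u2); [|lra].
  apply (nondecreasing_of_derive (fun u => L * u - profile_time P u)
    (fun u => L - time_density P u)); [exact H12 | |].
  - intros t Ht. cont. apply profile_time_cont; [exact HP' | lra].
  - intros t Ht. split.
    + eapply is_derive_eq; [der; apply profile_time_derive; [exact HP' | lra] | cbv beta; ring].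
    + assert (HPt := gap_curve_pos P (D - t) HP' ltac:(lra)).
      assert (Hlow := Hbd (D - t) ltac:(lra)). destruct Hlow as [Hlow _].
      replace (D - (D - t)) with t in Hlow by ring.
      assert (0 < D - top) by lra.
      assert (HL : L * (b * et * (D - top)) = 1).
      { unfold L. field. repeat split; lra. }
      assert (time_density P t <= L); [|lra].
      unfold time_density. apply div_le; [nra|].
      apply Rle_trans with (L * (b * et * (D - top)) * t); [rewrite HL; lra|].
      assert (HLp : 0 < L).
      { apply Rinv_0_lt_compat. repeat apply Rmult_lt_0_compat; lra. }
      replace (L * (b * et * (D - top)) * t) with (L * (b * (et * (D - top) * t))) by ring.
      apply Rmult_le_compat_l; [lra|]. apply Rmult_le_compat_l; [lra|].
      apply Rle_trans with (et * (D - t) * t); [|exact Hlow].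
      apply Rmult_le_compat_r; [lra|]. apply Rmult_le_compat_l; lra.
Qed.

(** Since [P s <= La s], the time density is not integrable at [D]: the end state is
    not reached in finite time. *)
Lemma profile_time_unbounded P A : gap_curve P -> exists u, D / 2 < u < D /\ A < profile_time P u.
Proof.
  intros HP. assert (HP' := HP).
  destruct HP as [HPc [HP0 [[et [La [Het [HLa Hbd]]]] HPd]]].
  set (kp := D / (2 * b * La)).
  assert (Hkp : 0 < kp) by (apply Rdiv_lt_0_compat; nra).
  assert (Hlog : forall u, u < D -> is_derive (fun u => ln (D - u)) u (- / (D - u))).
  { intros u Hu. eapply is_derive_eq.
    - apply (der_comp ln (fun u => D - u)); [apply is_derive_ln; lra | der].
    - cbv beta. ring. }
  assert (Hmono : forall u, D / 2 <= u < D ->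
    profile_time P (D / 2) + kp * ln (D - D / 2) <= profile_time P u + kp * ln (D - u)).
  { intros u Hu. apply (nondecreasing_of_derive (fun u => profile_time P u + kp * ln (D - u))
      (fun u => time_density P u - kp / (D - u)) (D / 2) u); [lra | |].
    - intros t Ht. cont; [apply profile_time_cont; [exact HP' | lra]|].
      eapply der_continuous, Hlog. lra.
    - intros t Ht. split.
      + eapply is_derive_eq.
        * der; [apply profile_time_derive; [exact HP' | lra] | apply Hlog; lra].
        * cbv beta. field. lra.
      + assert (HPt := gap_curve_pos P (D - t) HP' ltac:(lra)).
        destruct (Hbd (D - t) ltac:(lra)) as [_ Hup].
        assert (kp / (D - t) <= time_density P t); [|lra].
        unfold time_density. apply le_div; [nra|].
        apply Rle_trans with (kp / (D - t) * (b * (La * (D - t)))).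
        * apply Rmult_le_compat_l; [apply Rdiv_le_0_compat; lra|].
          apply Rmult_le_compat_l; lra.
        * unfold kp. replace (D / (2 * b * La) / (D - t) * (b * (La * (D - t)))) with (D / 2)
            by (field; lra). lra. }
  set (T0 := profile_time P (D / 2) + kp * ln (D - D / 2)) in Hmono.
  set (q := Rmin (D / 4) (exp ((T0 - A) / kp - 1))).
  assert (Hq1 : q <= D / 4) by apply Rmin_l.
  assert (Hq2 : q <= exp ((T0 - A) / kp - 1)) by apply Rmin_r.
  assert (Hq : 0 < q) by (apply Rmin_pos; [lra | apply exp_pos]).
  exists (D - q). split; [lra|].
  assert (H := Hmono (D - q) ltac:(lra)).
  replace (D - (D - q)) with q in H by ring.
  assert (Hln : ln q <= (T0 - A) / kp - 1).
  { rewrite <- (ln_exp ((T0 - A) / kp - 1)). destruct Hq2 as [Hq2 | ->]; [|lra].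
    left. now apply ln_increasing. }
  assert (kp * ln q <= kp * ((T0 - A) / kp - 1)) by (apply Rmult_le_compat_l; lra).
  replace (kp * ((T0 - A) / kp - 1)) with (T0 - A - kp) in * by (field; lra). lra.
Qed.

Definition flows (P : R -> R) (x1 : R) (v : R -> R) : Prop :=
  forall x, x < x1 -> 0 < v x < D /\ is_derive v x (- b * P (D - v x) / v x).

(** The times along two solutions differ by a constant, which is [0] because the
    solutions have the same end point and the time is Lipschitz there. *)
Lemma flow_unique P x1 d v1 v2 : gap_curve P -> d < D ->
  flows P x1 v1 -> flows P x1 v2 ->
  filterlim v1 (at_left x1) (locally d) -> filterlim v2 (at_left x1) (locally d) ->
  forall x, x < x1 -> v1 x = v2 x.
Proof.
  intros HP Hd Hv1 Hv2 Hl1 Hl2 x Hx.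
  assert (Hder : forall v, flows P x1 v -> forall y, y < x1 ->
    is_derive (fun x => profile_time P (v x)) y (-1)).
  { intros v Hv y Hy. destruct (Hv y Hy) as [Hvy Hvd].
    assert (Hpos := gap_curve_pos P (D - v y) HP ltac:(lra)).
    eapply is_derive_eq.
    - apply (der_comp (profile_time P) v); [apply profile_time_derive; [exact HP | exact Hvy] | exact Hvd].
    - unfold time_density. field. repeat split; lra. }
  pose (f := fun x => profile_time P (v1 x) - profile_time P (v2 x)).
  assert (Hfd : forall y, y < x1 -> is_derive f y 0).
  { intros y Hy. unfold f. eapply is_derive_eq; [der; now apply Hder | ring]. }
  assert (Hconst : forall y, x <= y -> y < x1 -> f x = f y).
  { intros y Hxy Hy. apply constant_of_derive; [exact Hxy | |].
    - intros t Ht. eapply der_continuous, Hfd. lra.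
    - intros t Ht. apply Hfd. lra. }
  assert (Hf0 : f x = 0).
  { set (top := (Rmax d 0 + D) / 2).
    assert (Hr1 := Rmax_l d 0). assert (Hr2 := Rmax_r d 0).
    assert (Hr3 : Rmax d 0 < D) by (apply Rmax_lub_lt; lra).
    assert (Htop : 0 < top < D) by (unfold top; lra).
    destruct (profile_time_Lipschitz P top HP Htop) as [L [HL Hlip]].
    apply NNPP. intros N. assert (HN : 0 < Rabs (f x)) by now apply Rabs_pos_lt.
    destruct (pick_small (top - d) (Rabs (f x) / (4 * L))) as [e [He [He1 He2]]];
      [unfold top; lra | apply Rdiv_lt_0_compat; lra |].
    destruct (proj1 (lim_left v1 x1 d) Hl1 e He) as [d1 [Hd1 Hn1]].
    destruct (proj1 (lim_left v2 x1 d) Hl2 e He) as [d2 [Hd2 Hn2]].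
    destruct (pick_small d1 d2 Hd1 Hd2) as [d3 [Hd3 [Hm1 Hm2]]].
    destruct (pick_left x (x1 - d3) x1) as [y [[Hy1 Hy3] Hy2]]; [exact Hx | lra |].
    specialize (Hn1 y ltac:(lra)). specialize (Hn2 y ltac:(lra)).
    apply Rabs_def2 in Hn1. apply Rabs_def2 in Hn2.
    destruct (Hv1 y Hy3) as [Hb1 _]. destruct (Hv2 y Hy3) as [Hb2 _].
    assert (Hfy : Rabs (f y) <= L * (2 * e)).
    { unfold f. destruct (Rle_or_lt (v1 y) (v2 y)) as [Hle | Hlt].
      - assert (H := Hlip (v1 y) (v2 y) ltac:(lra) Hle ltac:(lra)).
        assert (profile_time P (v1 y) <= profile_time P (v2 y)).
        { destruct Hle as [Hlt | ->]; [left; apply profile_time_increasing; auto; lra | lra]. }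
        rewrite Rabs_left1 by lra.
        assert (L * (v2 y - v1 y) <= L * (2 * e)) by (apply Rmult_le_compat_l; lra). lra.
      - assert (H := Hlip (v2 y) (v1 y) ltac:(lra) ltac:(lra) ltac:(lra)).
        assert (profile_time P (v2 y) < profile_time P (v1 y))
          by (apply profile_time_increasing; auto; lra).
        rewrite Rabs_right by lra.
        assert (L * (v1 y - v2 y) <= L * (2 * e)) by (apply Rmult_le_compat_l; lra). lra. }
    rewrite <- (Hconst y (Rlt_le _ _ Hy1) Hy3) in Hfy.
    assert (L * (2 * e) <= L * (2 * (Rabs (f x) / (4 * L)))).
    { apply Rmult_le_compat_l; lra. }
    replace (L * (2 * (Rabs (f x) / (4 * L)))) with (Rabs (f x) / 2) in * by (field; lra). lra. }
  destruct (Hv1 x Hx) as [Hb1 _]. destruct (Hv2 x Hx) as [Hb2 _]. unfold f in Hf0.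
  destruct (Rtotal_order (v1 x) (v2 x)) as [H | [H | H]]; [|exact H|].
  - assert (profile_time P (v1 x) < profile_time P (v2 x))
      by (apply profile_time_increasing; auto; lra). lra.
  - assert (profile_time P (v2 x) < profile_time P (v1 x))
      by (apply profile_time_increasing; auto; lra). lra.
Qed.

Lemma flow_exists P d : gap_curve P -> 0 <= d < D -> exists v : R -> R,
  (forall x, continuous v x) /\ (forall x, 0 <= x -> v x = d) /\
  (forall x, x < 0 -> d < v x < D /\ is_derive v x (- b * P (D - v x) / v x)) /\
  filterlim v (Rbar_locally m_infty) (locally D).
Proof.
  intros HP Hd.
  destruct (inverse_flow (profile_time P) (time_density P) d D) as [v [Hc [H0 [Hv Hlim]]]].
  - lra.
  - intros u Hu. split; [apply profile_time_derive | apply time_density_pos]; auto; lra.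
  - assert (Htop : 0 < (d + D) / 2 < D) by lra.
    destruct (profile_time_Lipschitz P ((d + D) / 2) HP Htop) as [L [HL Hlip]].
    exists (profile_time P ((d + D) / 2) - L * D). intros u Hu.
    destruct (Rle_or_lt u ((d + D) / 2)) as [Hle | Hlt].
    + assert (H := Hlip u ((d + D) / 2) ltac:(lra) Hle ltac:(lra)).
      assert (L * ((d + D) / 2 - u) <= L * D) by (apply Rmult_le_compat_l; lra). lra.
    + assert (profile_time P ((d + D) / 2) < profile_time P u)
        by (apply profile_time_increasing; auto; lra).
      assert (0 < L * D) by now apply Rmult_lt_0_compat. lra.
  - intros A.
    destruct (profile_time_unbounded P (Rmax A (profile_time P ((d + D) / 2))) HP) as [u [Hu HA]].
    assert (H1 := Rmax_l A (profile_time P ((d + D) / 2))).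
    assert (H2 := Rmax_r A (profile_time P ((d + D) / 2))).
    exists u. split; [|lra]. split; [|lra].
    apply Rnot_le_lt. intros Hle.
    assert (profile_time P u < profile_time P ((d + D) / 2)); [|lra].
    apply profile_time_increasing; auto; lra.
  - exists v. split; [exact Hc|]. split; [exact H0|]. split; [|exact Hlim].
    intros x Hx. destruct (Hv x Hx) as [Hvx Hvd]. split; [exact Hvx|].
    eapply is_derive_eq; [exact Hvd|]. unfold time_density.
    assert (H := gap_curve_pos P (D - v x) HP ltac:(lra)). field. repeat split; lra.
Qed.

Lemma half_profile_of_flow P v n : gap_curve P -> flows P 0 v ->
  (forall x, x < 0 -> n x = G (v x) + P (D - v x)) ->
  forall x, x < 0 -> is_derive n x (K * (D ^ 2 - v x ^ 2)).
Proof.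
  intros HP Hv Hn x Hx. destruct (Hv x Hx) as [Hvx Hvd].
  assert (Hpos := gap_curve_pos P (D - v x) HP ltac:(lra)).
  apply is_derive_ext_loc with (fun x => G (v x) + P (D - v x)).
  { apply locally_R. exists (- x). split; [lra|]. intros y Hy. apply Rabs_def2 in Hy.
    symmetry. apply Hn. lra. }
  eapply is_derive_eq.
  - der.
    + apply (der_comp G v); [apply HG; lra | exact Hvd].
    + apply (der_comp P (fun x => D - v x)); [apply gap_curve_derive; [exact HP | lra] | der].
  - cbv beta. field. repeat split; lra.
Qed.

Lemma lim_left_comp_right (f g : R -> R) (x a l : R) :
  (forall y, y < x -> a < f y) -> filterlim f (at_left x) (locally a) ->
  filterlim g (at_right a) (locally l) -> filterlim (fun y => g (f y)) (at_left x) (locally l).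
Proof.
  intros Hab Hf Hg. apply lim_left. intros e He.
  destruct (proj1 (lim_right g a l) Hg e He) as [d [Hd Hn]].
  destruct (proj1 (lim_left f x a) Hf d Hd) as [d' [Hd' Hn']].
  exists d'. split; [exact Hd'|]. intros y Hy. apply Hn.
  specialize (Hn' y Hy). apply Rabs_def2 in Hn'. specialize (Hab y ltac:(lra)). lra.
Qed.

(** For [d > 0] the right-hand side is continuous at [v = d]; for [d = 0] the limit is
    the sonic slope. *)
Lemma flow_slope_limit P d v : gap_curve P -> 0 <= d < D -> (d = 0 -> P D = 0) ->
  continuous v 0 -> v 0 = d -> (forall x, x < 0 -> d < v x) ->
  exists l, filterlim (fun x => - b * P (D - v x) / v x) (at_left 0) (locally l).
Proof.
  intros HP Hd HPD Hvc Hv0 Hv.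
  assert (Hvl := cont_at_left v 0 Hvc). rewrite Hv0 in Hvl.
  destruct (Req_dec d 0) as [Ed | Nd].
  - destruct (sonic_slope D (K / b) gap_slope P HD Kb_pos gap_slope_cont gap_slope_bounded HP (HPD Ed))
      as [l Hl].
    exists (- b * l). rewrite Ed in *.
    apply (filterlim_ext (fun x => - b * (P (D - v x) / v x))).
    { intros x. unfold Rdiv. ring. }
    apply (filterlim_comp _ _ _ (fun x => P (D - v x) / v x) (fun y => - b * y) _ (locally l)).
    + now apply (lim_left_comp_right v (fun r => P (D - r) / r) 0 0 l).
    + apply (cont_mult (fun _ => - b) (fun y => y)); cont.
  - exists (- b * P (D - d) / d).
    apply (filterlim_comp _ _ _ v (fun u => - b * P (D - u) / u) _ (locally d) _ Hvl).
    change (continuous (fun u => - b * P (D - u) / u) d). cont; [|exact Nd].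
    apply (cont_comp P (fun u => D - u)); [cont | apply HP].
Qed.

End HalfProfile.

(** * Weak derivatives *)

Definition hat (u : R) : R := Rmax 0 (1 - Rabs u).
(** A [C^1] function that is constant outside [[-1, 1]]. *)
Definition step (u : R) : R := RInt hat (-1) u.

Lemma hat_cont u : continuous hat u.
Proof. apply cont_max; cont. Qed.

Lemma hat_out u : 1 <= Rabs u -> hat u = 0.
Proof. intros H. apply Rmax_left. lra. Qed.

Lemma hat_nonneg u : 0 <= hat u.
Proof. apply Rmax_l. Qed.

Lemma step_derive u : is_derive step u (hat u).
Proof. apply (der_RInt hat). apply hat_cont. Qed.

Lemma step_left u : u <= -1 -> step u = 0.
Proof.
  intros Hu. transitivity (step (-1)).
  - apply constant_of_derive; [exact Hu | |].
    + intros t _. eapply der_continuous, step_derive.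
    + intros t Ht. eapply is_derive_eq; [apply step_derive|].
      apply hat_out. rewrite Rabs_left; lra.
  - apply (RInt_point (V := R_CompleteNormedModule)).
Qed.

Lemma step_right u : 1 <= u -> step u = step 1.
Proof.
  intros Hu. symmetry. apply constant_of_derive; [exact Hu | |].
  - intros t _. eapply der_continuous, step_derive.
  - intros t Ht. eapply is_derive_eq; [apply step_derive|].
    apply hat_out. rewrite Rabs_right; lra.
Qed.

Lemma step_1_pos : 0 < step 1.
Proof.
  rewrite <- (step_left (-1)) by lra. apply increasing_of_derive with hat; [lra | |].
  - intros t _. eapply der_continuous, step_derive.
  - intros t Ht. split; [apply step_derive|].
    assert (Rabs t < 1) by (apply Rabs_def1; lra).
    apply Rlt_le_trans with (1 - Rabs t); [lra | apply Rmax_r].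
Qed.

Section ScaledStep.

Variables (e x : R).
Hypothesis He : 0 < e.

Definition scaled_step (t : R) : R := step ((t - x) / e).
Definition scaled_hat (t : R) : R := hat ((t - x) / e) / e.

Lemma scaled_step_derive t : is_derive scaled_step t (scaled_hat t).
Proof.
  eapply is_derive_eq.
  - apply (der_comp step (fun t => (t - x) / e)); [apply step_derive | der; lra].
  - unfold scaled_hat. cbv beta. field. lra.
Qed.

Lemma scaled_hat_cont t : continuous scaled_hat t.
Proof.
  unfold scaled_hat. cont; [|lra].
  apply (cont_comp hat (fun t => (t - x) / e)); [cont; lra | apply hat_cont].
Qed.

Lemma scaled_hat_nonneg t : 0 <= scaled_hat t.
Proof. apply Rdiv_le_0_compat; [apply hat_nonneg | exact He]. Qed.

Lemma scaled_hat_out t : e <= Rabs (t - x) -> scaled_hat t = 0.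
Proof.
  intros H. unfold scaled_hat. rewrite hat_out; [field; lra|].
  unfold Rdiv. rewrite Rabs_mult, (Rabs_right (/ e)).
  - apply le_div; lra.
  - apply Rle_ge. left. now apply Rinv_0_lt_compat.
Qed.

Lemma scaled_step_left t : t <= x - e -> scaled_step t = 0.
Proof. intros H. apply step_left. apply div_le; lra. Qed.

Lemma scaled_step_right t : x + e <= t -> scaled_step t = step 1.
Proof. intros H. apply step_right. apply le_div; lra. Qed.

Lemma scaled_hat_RInt a b : a <= x - e -> x + e <= b -> is_RInt scaled_hat a b (step 1).
Proof.
  intros Ha Hb. replace (step 1) with (minus (scaled_step b) (scaled_step a)).
  - apply (is_RInt_derive scaled_step scaled_hat).
    + intros t _. apply scaled_step_derive.
    + intros t _. apply scaled_hat_cont.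
  - rewrite (scaled_step_left a), (scaled_step_right b) by lra. unfold minus, plus, opp; simpl. ring.
Qed.

End ScaledStep.

Lemma is_RInt_ext_R (f g : R -> R) (a b l : R) : a <= b ->
  (forall x, a < x < b -> f x = g x) -> is_RInt f a b l -> is_RInt g a b l.
Proof.
  intros Hab H. apply is_RInt_ext. intros x Hx.
  rewrite Rmin_left, Rmax_right in Hx by exact Hab. now apply H.
Qed.

(** Testing against the difference of two narrow hats compares the values at their
    centres. *)
Lemma weak_constant_le (F : R -> R) (a b x y : R) :
  (forall phi, C1 phi -> (forall t, t <= a \/ b <= t -> phi t = 0) ->
     is_RInt (fun t => F t * Derive phi t) a b 0) ->
  a < x < b -> a < y < b -> continuous F x -> continuous F y -> F x <= F y.
Proof.
  intros Hw Hx Hy Hcx Hcy. apply Rnot_lt_le. intros Hlt.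
  set (d := (F x - F y) / 3). assert (Hd : 0 < d) by (unfold d; lra).
  destruct (proj1 (cont_eps F x) Hcx d Hd) as [ex [Hex Hnx]].
  destruct (proj1 (cont_eps F y) Hcy d Hd) as [ey [Hey Hny]].
  set (e := Rmin (Rmin ex ey) (Rmin (Rmin (x - a) (b - x)) (Rmin (y - a) (b - y)))).
  assert (He : 0 < e) by (unfold e; repeat apply Rmin_pos; lra).
  assert (Hle : e <= ex /\ e <= ey /\ e <= x - a /\ e <= b - x /\ e <= y - a /\ e <= b - y).
  { unfold e. repeat split;
      unfold Rmin; repeat destruct (Rle_dec _ _); lra. }
  pose (phi := fun t => scaled_step e x t - scaled_step e y t).
  assert (Hphi : forall t, is_derive phi t (scaled_hat e x t - scaled_hat e y t)).
  { intros t. unfold phi. der; apply scaled_step_derive, He. }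
  assert (HI : is_RInt (fun t => F t * Derive phi t) a b 0).
  { apply Hw.
    - intros t. split; [eexists; apply Hphi|].
      apply continuous_ext with (fun t => scaled_hat e x t - scaled_hat e y t).
      + intros u. symmetry. apply is_derive_unique, Hphi.
      + cont; apply scaled_hat_cont, He.
    - intros t [Ht | Ht]; unfold phi.
      + rewrite !scaled_step_left by lra. ring.
      + rewrite !scaled_step_right by lra. ring. }
  assert (HL : is_RInt (fun t => (F x - d) * scaled_hat e x t - (F y + d) * scaled_hat e y t) a b
                 ((F x - d) * step 1 - (F y + d) * step 1)).
  { apply (is_RInt_minus (fun t => (F x - d) * scaled_hat e x t) (fun t => (F y + d) * scaled_hat e y t));
    apply (is_RInt_scal (scaled_hat e _)); apply scaled_hat_RInt; lra. }
  assert (Hle0 : (F x - d) * step 1 - (F y + d) * step 1 <= 0).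
  { apply (is_RInt_le _ _ a b _ _ ltac:(lra) HL HI). intros t _.
    rewrite (is_derive_unique phi t _ (Hphi t)).
    assert (H1 := scaled_hat_nonneg e x He t). assert (H2 := scaled_hat_nonneg e y He t).
    assert (F x * scaled_hat e x t - d * scaled_hat e x t <= F t * scaled_hat e x t).
    { destruct (Rlt_or_le (Rabs (t - x)) e) as [H | H].
      - assert (Hn := Hnx t ltac:(lra)). apply Rabs_def2 in Hn. nra.
      - rewrite (scaled_hat_out e x He t H). lra. }
    assert (F t * scaled_hat e y t <= F y * scaled_hat e y t + d * scaled_hat e y t).
    { destruct (Rlt_or_le (Rabs (t - y)) e) as [H' | H'].
      - assert (Hn := Hny t ltac:(lra)). apply Rabs_def2 in Hn. nra.
      - rewrite (scaled_hat_out e y He t H'). lra. }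
    lra. }
  assert (Hs := step_1_pos). assert (d * step 1 <= 0); [|nra].
  unfold d in *. nra.
Qed.

Lemma weak_constant_on (F : R -> R) (a b x y : R) :
  (forall phi, C1 phi -> (forall t, t <= a \/ b <= t -> phi t = 0) ->
     is_RInt (fun t => F t * Derive phi t) a b 0) ->
  a < x < b -> a < y < b -> continuous F x -> continuous F y -> F x = F y.
Proof.
  intros. apply Rle_antisym; eapply weak_constant_le; eauto.
Qed.

Lemma weak_constant (F : R -> R) (x y : R) :
  weak_derivative F (fun _ => 0) -> continuous F x -> continuous F y -> F x = F y.
Proof.
  intros Hw Hx Hy.
  assert (H1 := Rmin_l x y). assert (H2 := Rmin_r x y).
  assert (H3 := Rmax_l x y). assert (H4 := Rmax_r x y).
  apply (weak_constant_on F (Rmin x y - 1) (Rmax x y + 1)); [|lra | lra | exact Hx | exact Hy].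
  intros phi HC Hsupp.
  apply (is_RInt_ext_R (fun t => F t * Derive phi t + 0 * phi t)); [lra | |].
  - intros t _. ring.
  - apply Hw; [lra | exact HC | exact Hsupp].
Qed.

Lemma C1_is_derive phi x : C1 phi -> is_derive phi x (Derive phi x).
Proof. intros H. apply Derive_correct, H. Qed.

Lemma C1_continuous phi x : C1 phi -> continuous phi x.
Proof. intros H. eapply der_continuous, C1_is_derive, H. Qed.

Lemma C1_intro f df : (forall x, is_derive f x (df x)) -> (forall x, continuous df x) -> C1 f.
Proof.
  intros Hd Hc x. split; [eexists; apply Hd|].
  apply continuous_ext with df; [|apply Hc]. intros u. symmetry. apply is_derive_unique, Hd.
Qed.

(** Subtracting a primitive of [G] from [F] leaves a function with vanishing weak
    derivative. *)
Lemma weak_derivative_strong (F G : R -> R) (a b : R) :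
  weak_derivative F G ->
  (forall x, a <= x <= b -> continuous G x) -> (forall x, a < x < b -> continuous F x) ->
  forall x, a < x < b -> is_derive F x (G x).
Proof.
  intros Hw HG HF x Hx.
  pose (Gc := fun t => G (Rmax a (Rmin t b))).
  assert (HGc : forall t, continuous Gc t).
  { intros t. apply (cont_comp G (fun t => Rmax a (Rmin t b))).
    - apply cont_max; [cont|]. apply cont_min; cont.
    - apply HG. unfold Rmax, Rmin. repeat destruct (Rle_dec _ _); lra. }
  assert (HGin : forall t, a <= t <= b -> Gc t = G t).
  { intros t Ht. unfold Gc. rewrite Rmin_left, Rmax_right; lra. }
  pose (Gam := fun t => RInt Gc a t).
  assert (HGam : forall t, is_derive Gam t (Gc t)) by (intros t; now apply der_RInt).
  assert (HH : forall y, a < y < b -> F x - Gam x = F y - Gam y).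
  { intros y Hy. apply (weak_constant_on (fun t => F t - Gam t) a b); auto.
    - intros phi HC Hsupp.
      assert (H1 := Hw phi a b ltac:(lra) HC Hsupp).
      assert (H2 : is_RInt (fun t => Gc t * phi t + Gam t * Derive phi t) a b
                     (minus (Gam b * phi b) (Gam a * phi a))).
      { apply (is_RInt_derive (fun t => Gam t * phi t)).
        - intros t _. apply der_mult; [apply HGam | now apply C1_is_derive].
        - intros t _. cont.
          + apply HGc.
          + now apply C1_continuous.
          + eapply der_continuous, HGam.
          + apply HC. }
      assert (H3 := is_RInt_minus _ _ _ _ _ _ H1 H2).
      replace 0 with (minus 0 (minus (Gam b * phi b) (Gam a * phi a))).
      + eapply is_RInt_ext_R; [lra | | exact H3]. intros t Ht.
        unfold minus, plus, opp; simpl. rewrite HGin by lra. ring.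
      + rewrite (Hsupp a), (Hsupp b) by (left + right; lra).
        unfold minus, plus, opp; simpl. ring.
    - cont; [now apply HF | eapply der_continuous, HGam].
    - cont; [now apply HF | eapply der_continuous, HGam]. }
  apply is_derive_ext_loc with (fun t => Gam t + (F x - Gam x)).
  - apply locally_R. exists (Rmin (x - a) (b - x)). split; [apply Rmin_pos; lra|].
    intros y Hy. apply Rabs_def2 in Hy.
    assert (H1 := Rmin_l (x - a) (b - x)). assert (H2 := Rmin_r (x - a) (b - x)).
    change (Gam y + (F x - Gam x) = F y). rewrite (HH y) by lra. ring.
  - eapply is_derive_eq; [der; apply HGam|]. rewrite HGin by lra. ring.
Qed.

Lemma weak_derivative_of_constant (F : R -> R) (C : R) :
  (forall x, F x = C) -> weak_derivative F (fun _ => 0).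
Proof.
  intros HF phi a b Hab HC Hsupp.
  apply (is_RInt_ext_R (fun t => C * Derive phi t)); [lra | |].
  { intros t _. rewrite HF. ring. }
  replace 0 with (minus (C * phi b) (C * phi a)).
  - apply (is_RInt_derive (fun t => C * phi t)).
    + intros t _. eapply is_derive_eq; [der; now apply C1_is_derive | cbv beta; ring].
    + intros t _. cont. apply HC.
  - rewrite (Hsupp a), (Hsupp b) by (left + right; lra). unfold minus, plus, opp; simpl. ring.
Qed.

Lemma is_RInt_derive_open (f h : R -> R) (a b : R) : a <= b ->
  (forall x, a <= x <= b -> continuous f x) -> (forall x, continuous h x) ->
  (forall x, a < x < b -> is_derive f x (h x)) -> is_RInt h a b (f b - f a).
Proof.
  intros Hab Hf Hh Hd.
  assert (E : RInt h a b = f b - f a).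
  { assert (H : f a - RInt h a a = f b - RInt h a b).
    { apply (constant_of_derive (fun t => f t - RInt h a t) a b Hab).
      - intros t Ht. cont; [now apply Hf | eapply der_continuous, der_RInt, Hh].
      - intros t Ht. eapply is_derive_eq; [der; [now apply Hd | apply der_RInt, Hh] | ring]. }
    rewrite RInt_point in H. unfold zero in H; simpl in H. lra. }
  rewrite <- E. apply (RInt_correct h), ex_RInt_cont, Hh.
Qed.

(** A continuous function that is differentiable off one point, with one-sided
    continuous derivatives, has no singular part in its derivative. *)
Lemma weak_derivative_glue (z h hl hr : R -> R) :
  (forall x, continuous z x) -> (forall x, continuous hl x) -> (forall x, continuous hr x) ->
  (forall x, x < 0 -> h x = hl x) -> (forall x, 0 < x -> h x = hr x) ->
  (forall x, x <> 0 -> is_derive z x (h x)) -> weak_derivative z h.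
Proof.
  intros Hz Hhl Hhr Hl Hr Hd.
  assert (Hside : forall phi k a b, a <= b -> C1 phi -> (forall x, continuous k x) ->
    (forall x, a < x < b -> x <> 0 /\ h x = k x) ->
    is_RInt (fun x => z x * Derive phi x + h x * phi x) a b (z b * phi b - z a * phi a)).
  { intros phi k a b Hab HC Hk Hin.
    apply (is_RInt_ext_R (fun x => z x * Derive phi x + k x * phi x)); [exact Hab | |].
    { intros x Hx. now rewrite (proj2 (Hin x Hx)). }
    apply (is_RInt_derive_open (fun x => z x * phi x)); [exact Hab | | |].
    - intros x _. cont; [apply Hz | now apply C1_continuous].
    - intros x. cont; [apply Hz | apply HC | apply Hk | now apply C1_continuous].
    - intros x Hx. destruct (Hin x Hx) as [Hx0 E]. eapply is_derive_eq.
      + der; [now apply Hd | now apply C1_is_derive].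
      + rewrite E. cbv beta. ring. }
  intros phi a b Hab HC Hsupp.
  assert (Ha : phi a = 0) by (apply Hsupp; lra).
  assert (Hb : phi b = 0) by (apply Hsupp; lra).
  destruct (Rle_or_lt b 0) as [Hb0 | Hb0]; [|destruct (Rle_or_lt 0 a) as [Ha0 | Ha0]].
  - replace 0 with (z b * phi b - z a * phi a) by (rewrite Ha, Hb; ring).
    apply (Hside phi hl); auto; [lra|]. intros x Hx. split; [lra|]. apply Hl. lra.
  - replace 0 with (z b * phi b - z a * phi a) by (rewrite Ha, Hb; ring).
    apply (Hside phi hr); auto; [lra|]. intros x Hx. split; [lra|]. apply Hr. lra.
  - assert (H1 : is_RInt (fun x => z x * Derive phi x + h x * phi x) a 0
      (z 0 * phi 0 - z a * phi a)).
    { apply (Hside phi hl); auto; [lra|]. intros x Hx. split; [lra|]. apply Hl. lra. }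
    assert (H2 : is_RInt (fun x => z x * Derive phi x + h x * phi x) 0 b
      (z b * phi b - z 0 * phi 0)).
    { apply (Hside phi hr); auto; [lra|]. intros x Hx. split; [lra|]. apply Hr. lra. }
    assert (H := is_RInt_Chasles _ _ _ _ _ _ H1 H2). rewrite Ha, Hb in H.
    unfold plus in H; simpl in H.
    replace (z 0 * phi 0 - z a * 0 + (z b * 0 - z 0 * phi 0)) with 0 in H by ring.
    exact H.
Qed.

(** * Matching the two sides *)

Lemma lim_comp_cont (F : (R -> Prop) -> Prop) (f g : R -> R) (l : R) :
  filterlim f F (locally l) -> continuous g l -> filterlim (fun x => g (f x)) F (locally (g l)).
Proof. intros Hf Hg. exact (filterlim_comp _ _ _ f g _ _ _ Hf Hg). Qed.

Lemma lim_left_ext (f g : R -> R) (x l : R) :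
  (forall y, y < x -> f y = g y) ->
  filterlim f (at_left x) (locally l) -> filterlim g (at_left x) (locally l).
Proof.
  intros E. apply filterlim_ext_loc. apply at_left_R. exists 1. split; [lra|].
  intros y Hy. apply E. lra.
Qed.

Lemma lim_right_ext (f g : R -> R) (x l : R) :
  (forall y, x < y -> f y = g y) ->
  filterlim f (at_right x) (locally l) -> filterlim g (at_right x) (locally l).
Proof.
  intros E. apply filterlim_ext_loc. apply at_right_R. exists 1. split; [lra|].
  intros y Hy. apply E. lra.
Qed.

Lemma lim_right_reflect (f : R -> R) (x l : R) :
  filterlim (fun y => f (- y)) (at_left (- x)) (locally l) <->
  filterlim f (at_right x) (locally l).
Proof.
  rewrite lim_left, lim_right. split; intros H e He; destruct (H e He) as [d [Hd Hn]];
    exists d; split; try exact Hd; intros y Hy.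
  - specialize (Hn (- y) ltac:(lra)). now rewrite Ropp_involutive in Hn.
  - apply Hn. lra.
Qed.

Lemma lim_pinf_reflect (f : R -> R) (l : R) :
  filterlim (fun y => f (- y)) (Rbar_locally m_infty) (locally l) <->
  filterlim f (Rbar_locally p_infty) (locally l).
Proof.
  rewrite lim_minf, lim_pinf. split; intros H e He; destruct (H e He) as [M Hn]; exists (- M);
    intros y Hy.
  - specialize (Hn (- y) ltac:(lra)). now rewrite Ropp_involutive in Hn.
  - apply Hn. lra.
Qed.

(** The three cases of [half_profile_dichotomy] leave at the end point a positive, zero
    or negative value of [z], which stands for [n']. As [z] and [n] are continuous
    there, both sides of a profile see the same values. In the first case [v] tends
    to the square root of [D^2 - z / K]. *)
Lemma half_profile_end (K b D hi : R) (G dG : R -> R) (x1 : R) (n v z P : R -> R) :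
  0 < K -> 0 < b -> 0 < D -> D < hi ->
  (forall u, 0 <= u < hi -> is_derive G u (dG u)) ->
  (forall u, 0 <= u < hi -> continuous dG u) ->
  gap_curve K b D dG P -> half_profile K b D hi G x1 n v ->
  continuous n x1 -> continuous z x1 ->
  (forall x, x < x1 -> z x = K * (D ^ 2 - v x ^ 2)) ->
  (exists d, 0 <= d < D /\ z x1 = K * (D ^ 2 - d ^ 2) /\
     filterlim v (at_left x1) (locally d) /\ n x1 = G d + P (D - d) /\
     (forall x, x < x1 -> n x = G (v x) + P (D - v x)) /\ flows b D P x1 v) \/
  (z x1 = 0 /\ n x1 = G D) \/ (z x1 < 0 /\ n x1 <= G D).
Proof.
  intros HK Hb HD Hhi HG HdG HP Hhalf Hn Hz Ez.
  assert (Hzl := cont_at_left z x1 Hz). assert (Hnl := cont_at_left n x1 Hn).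
  assert (Hode := proj1 Hhalf).
  assert (Hvl : filterlim (fun x => D ^ 2 - z x / K) (at_left x1) (locally (D ^ 2 - z x1 / K))).
  { apply (lim_comp_cont _ z (fun y => D ^ 2 - y / K) (z x1) Hzl). cont. lra. }
  assert (Esq : forall x, x < x1 -> v x ^ 2 = D ^ 2 - z x / K).
  { intros x Hx. rewrite Ez by exact Hx. field. lra. }
  destruct (half_profile_dichotomy K b D hi G dG HK Hb HD HG HdG x1 n v Hhalf)
    as [HA | [HB | HC]].
  - left. assert (Hgap := half_profile_gap K b D hi G dG HK Hb HD Hhi HG x1 n v P HP Hhalf HA).
    set (d2 := D ^ 2 - z x1 / K).
    assert (Hd2 : 0 <= d2).
    { apply (filterlim_le (F := at_left x1) (fun _ => 0) (fun x => D ^ 2 - z x / K) 0 d2).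
      - apply at_left_R. exists 1. split; [lra|]. intros y Hy.
        rewrite <- Esq by lra. apply pow2_ge_0.
      - apply filterlim_const.
      - exact Hvl. }
    assert (Hmono : forall x, x1 - 1 < x -> x < x1 -> v x <= v (x1 - 1)).
    { intros x Hx1 Hx. assert (H : - v (x1 - 1) <= - v x); [|lra].
      apply (nondecreasing_of_derive (fun t => - v t) (fun t => - (- b * (n t - G (v t)) / v t)));
        [lra | |].
      - intros t Ht. destruct (Hode t ltac:(lra)) as [_ [_ Hvd]].
        apply der_continuous in Hvd. cont.
      - intros t Ht. destruct (Hode t ltac:(lra)) as [Hvt [_ Hvd]].
        destruct (HA t ltac:(lra)) as [_ Hpt].
        split; [now apply der_opp|].
        replace (- (- b * (n t - G (v t)) / v t)) with (b * (n t - G (v t)) / v t) by (field; lra).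
        apply Rdiv_le_0_compat; [|lra]. apply Rmult_le_pos; lra. }
    destruct (HA (x1 - 1) ltac:(lra)) as [HvD _].
    destruct (Hode (x1 - 1) ltac:(lra)) as [Hv0 _].
    assert (Hd2D : d2 <= v (x1 - 1) ^ 2).
    { apply (filterlim_le (F := at_left x1) (fun x => D ^ 2 - z x / K) (fun _ => v (x1 - 1) ^ 2)
               d2 (v (x1 - 1) ^ 2)).
      - apply at_left_R. exists 1. split; [lra|]. intros y Hy.
        rewrite <- Esq by lra. assert (H := Hmono y ltac:(lra) ltac:(lra)).
        destruct (Hode y ltac:(lra)) as [Hvy _]. nra.
      - exact Hvl.
      - apply filterlim_const. }
    assert (Hsq : sqrt d2 ^ 2 = d2) by now apply pow2_sqrt.
    assert (Hs0 := sqrt_pos d2).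
    assert (Hsd : sqrt d2 < D) by nra.
    assert (Hvlim : filterlim v (at_left x1) (locally (sqrt d2))).
    { apply lim_left_ext with (fun x => sqrt (D ^ 2 - z x / K)).
      - intros y Hy. rewrite <- Esq by exact Hy. apply sqrt_pow2.
        destruct (Hode y Hy) as [Hvy _]. lra.
      - apply (lim_comp_cont _ (fun x => D ^ 2 - z x / K) sqrt); [exact Hvl|].
        apply continuity_pt_filterlim, continuity_pt_sqrt. exact Hd2. }
    exists (sqrt d2). split; [lra|]. split.
    { rewrite Hsq. unfold d2. field. lra. }
    split; [exact Hvlim|].
    assert (Hgap' : forall x, x < x1 -> n x = G (v x) + P (D - v x)).
    { intros x Hx. rewrite <- Hgap by exact Hx. ring. }
    split; [|split; [exact Hgap'|]].
    + apply (lim_unique_R (at_left x1) n); [exact Hnl|].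
      apply lim_left_ext with (fun x => G (v x) + P (D - v x)).
      { intros y Hy. symmetry. now apply Hgap'. }
      apply (lim_comp_cont _ v (fun u => G u + P (D - u)) (sqrt d2) Hvlim).
      cont.
      * eapply der_continuous. apply HG. lra.
      * apply (cont_comp P (fun u => D - u)); [cont | apply HP].
    + intros x Hx. destruct (Hode x Hx) as [Hvx [_ Hvd]]. destruct (HA x Hx) as [HvxD _].
      split; [lra|]. rewrite Hgap in Hvd by exact Hx. exact Hvd.
  - right; left. split.
    + apply (lim_unique_R (at_left x1) z); [exact Hzl|].
      apply lim_left_ext with (fun _ => 0); [|apply filterlim_const].
      intros y Hy. rewrite Ez by exact Hy. destruct (HB y Hy) as [-> _]. ring.
    + apply (lim_unique_R (at_left x1) n); [exact Hnl|].
      apply lim_left_ext with (fun _ => G D); [|apply filterlim_const].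
      intros y Hy. destruct (HB y Hy) as [_ ->]. reflexivity.
  - right; right. split.
    + destruct (Hode (x1 - 1) ltac:(lra)) as [Hv0 _].
      destruct (HC (x1 - 1) ltac:(lra)) as [HvD _].
      assert (Hz1 : z (x1 - 1) < 0).
      { rewrite Ez by lra. assert (0 < K * (v (x1 - 1) ^ 2 - D ^ 2)); [|nra].
        apply Rmult_lt_0_compat; nra. }
      apply Rle_lt_trans with (z (x1 - 1)); [|exact Hz1].
      apply (filterlim_le (F := at_left x1) z (fun _ => z (x1 - 1)) (z x1) (z (x1 - 1)));
        [| exact Hzl | apply filterlim_const].
      apply at_left_R. exists 1. split; [lra|]. intros y Hy.
      rewrite !Ez by lra. apply Rmult_le_compat_l; [lra|].
      assert (H : v (x1 - 1) <= v y).
      { apply (nondecreasing_of_derive v (fun t => - b * (n t - G (v t)) / v t)); [lra | |].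
        - intros t Ht. destruct (Hode t ltac:(lra)) as [_ [_ Hvd]].
          now apply der_continuous in Hvd.
        - intros t Ht. destruct (Hode t ltac:(lra)) as [Hvt [_ Hvd]].
          destruct (HC t ltac:(lra)) as [_ Hpt].
          split; [exact Hvd|]. apply Rdiv_le_0_compat; [nra | lra]. }
      nra.
    + apply (filterlim_le (F := at_left x1) n (fun _ => G D) (n x1) (G D));
        [| exact Hnl | apply filterlim_const].
      apply at_left_R. exists 1. split; [lra|]. intros y Hy. left.
      apply (half_profile_n_lt K b D hi G HK HD x1 n v Hhalf); [|lra].
      intros x Hx. now apply HC.
Qed.

Section Reduced.

Variables (K b D lo hi : R) (G dG : R -> R).
Hypotheses (HK : 0 < K) (Hb : 0 < b) (HD : 0 < D) (Hhi : D < hi) (Hlo : lo < - D).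
Hypothesis HG : forall v, lo < v < hi -> is_derive G v (dG v).
Hypothesis HdG : forall v, lo < v < hi -> continuous dG v.
Hypothesis HGlt : G D < G (- D).

(** The subsonic side becomes a supersonic one under
    [(x, v, n) -> (- x, - v, - n)], which maps the emission [G] to [Gr]. *)
Definition Gr (v : R) : R := - G (- v).
Definition dGr (v : R) : R := dG (- v).

Lemma G_derive_left v : 0 <= v < hi -> is_derive G v (dG v).
Proof. intros H. apply HG. lra. Qed.
Lemma dG_cont_left v : 0 <= v < hi -> continuous dG v.
Proof. intros H. apply HdG. lra. Qed.
Lemma Gr_derive v : 0 <= v < - lo -> is_derive Gr v (dGr v).
Proof.
  intros H. unfold Gr, dGr. eapply is_derive_eq.
  - apply der_opp, (der_comp G (fun v => - v)); [apply HG; lra | der].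
  - ring.
Qed.
Lemma dGr_cont v : 0 <= v < - lo -> continuous dGr v.
Proof.
  intros H. apply (cont_comp dG (fun v => - v)); [cont | apply HdG; lra].
Qed.

Definition left_gap (P : R -> R) : Prop := gap_curve K b D dG P.
Definition right_gap (P : R -> R) : Prop := gap_curve K b D dGr P.

Definition matched (PL PR : R -> R) (d : R) : Prop :=
  G d + PL (D - d) = G (- d) - PR (D - d).

Lemma gap_end_nonneg dH P : gap_curve K b D dH P -> 0 <= P D.
Proof.
  intros [_ [_ [[et [La [Het [_ Hbd]]]] _]]]. assert (H := Hbd D ltac:(lra)). lra.
Qed.

(** The difference of the values of [n] that the two sides prescribe at a jump from [d]
    to [- d]. *)
Definition mismatch (PL PR : R -> R) (d : R) : R :=
  G d + PL (D - d) - (G (- d) - PR (D - d)).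

Lemma mismatch_cont PL PR d : left_gap PL -> right_gap PR -> 0 <= d <= D ->
  continuous (mismatch PL PR) d.
Proof.
  intros HL HR Hd. unfold mismatch. cont.
  - eapply der_continuous, HG. lra.
  - apply (cont_comp PL (fun d => D - d)); [cont | apply HL].
  - apply (cont_comp G (fun d => - d)); [cont | eapply der_continuous, HG; lra].
  - apply (cont_comp PR (fun d => D - d)); [cont | apply HR].
Qed.

(** The emission contributes equally to the change of the gap curves and to the
    change of [G (- d) - G d], so only the terms with a sign remain. *)
Lemma mismatch_decreasing PL PR d1 d2 : left_gap PL -> right_gap PR ->
  0 <= d1 -> d1 < d2 -> d2 <= D -> mismatch PL PR d2 < mismatch PL PR d1.
Proof.
  intros HL HR H1 H12 H2.
  assert (H : - mismatch PL PR d1 < - mismatch PL PR d2); [|lra].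
  apply (increasing_of_derive (fun d => - mismatch PL PR d)
    (fun d => K / b * d * (D ^ 2 - d ^ 2) * (/ PL (D - d) + / PR (D - d)))); [exact H12 | |].
  - intros t Ht. cont. apply mismatch_cont; auto; lra.
  - intros t Ht.
    assert (HpL := gap_curve_pos K b D dG PL (D - t) HL ltac:(lra)).
    assert (HpR := gap_curve_pos K b D dGr PR (D - t) HR ltac:(lra)).
    split.
    + unfold mismatch. eapply is_derive_eq.
      * der.
        -- apply HG. lra.
        -- apply (der_comp PL (fun d => D - d));
             [apply (gap_curve_derive K b D dG Hb); [exact HL | lra] | der].
        -- apply (der_comp G (fun d => - d)); [apply HG; lra | der].
        -- apply (der_comp PR (fun d => D - d));
             [apply (gap_curve_derive K b D dGr Hb); [exact HR | lra] | der].
      * unfold dGr. cbv beta. field. repeat split; lra.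
    + assert (HKb := Kb_pos K b HK Hb).
      assert (0 < / PL (D - t)) by now apply Rinv_0_lt_compat.
      assert (0 < / PR (D - t)) by now apply Rinv_0_lt_compat.
      apply Rmult_lt_0_compat; [|lra].
      apply Rmult_lt_0_compat; [apply Rmult_lt_0_compat; lra | nra].
Qed.

Lemma matched_exists PL PR : left_gap PL -> right_gap PR ->
  exists d, 0 <= d < D /\ matched PL PR d.
Proof.
  intros HL HR.
  assert (H0 : 0 <= mismatch PL PR 0).
  { unfold mismatch. rewrite Ropp_0, Rminus_0_r.
    assert (H1 := gap_end_nonneg _ _ HL). assert (H2 := gap_end_nonneg _ _ HR). lra. }
  assert (HD0 : mismatch PL PR D < 0).
  { unfold mismatch. rewrite Rminus_eq_0.
    rewrite (proj1 (proj2 HL)), (proj1 (proj2 HR)). lra. }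
  destruct (intermediate_value (fun d => - mismatch PL PR d) 0 D 0) as [d [Hd Ed]].
  - lra.
  - intros x Hx. cont. now apply mismatch_cont.
  - lra.
  - exists d. split.
    + split; [lra|]. destruct (proj2 Hd) as [H | H]; [exact H|]. rewrite H in Ed. lra.
    + unfold mismatch in Ed. unfold matched. lra.
Qed.

Lemma matched_unique PL PR d1 d2 : left_gap PL -> right_gap PR ->
  0 <= d1 < D -> 0 <= d2 < D -> matched PL PR d1 -> matched PL PR d2 -> d1 = d2.
Proof.
  intros HL HR H1 H2 E1 E2. unfold matched in *.
  destruct (Rtotal_order d1 d2) as [H | [H | H]]; [exfalso | exact H | exfalso].
  - assert (Hm := mismatch_decreasing PL PR d1 d2 HL HR ltac:(lra) H ltac:(lra)).
    unfold mismatch in Hm. lra.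
  - assert (Hm := mismatch_decreasing PL PR d2 d1 HL HR ltac:(lra) H ltac:(lra)).
    unfold mismatch in Hm. lra.
Qed.

(** The gaps are nonnegative and add up to [G 0 - G 0]. *)
Lemma matched_sonic PL PR : left_gap PL -> right_gap PR -> matched PL PR 0 ->
  PL D = 0 /\ PR D = 0.
Proof.
  intros HL HR E. unfold matched in E. rewrite Ropp_0, Rminus_0_r in E.
  assert (H1 := gap_end_nonneg _ _ HL). assert (H2 := gap_end_nonneg _ _ HR). lra.
Qed.

(** [z] stands for the derivative of [n]; at the transition point [x1] itself [v] may be
    arbitrary, and only the continuity of [n] and [z] connects the two sides. *)
Definition reduced_profile (x1 : R) (n v z : R -> R) : Prop :=
  half_profile K b D hi G x1 n v /\
  half_profile K b D (- lo) Gr (- x1) (fun x => - n (- x)) (fun x => - v (- x)) /\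
  continuous n x1 /\ continuous z x1 /\
  (forall x, x <> x1 -> z x = K * (D ^ 2 - v x ^ 2)).

(** If [z x1 <= 0], the left side gives [n x1 <= G D] and the right side
    [G (- D) <= n x1], contrary to [G D < G (- D)]. *)
Lemma reduced_profile_structure PL PR x1 n v z : left_gap PL -> right_gap PR ->
  reduced_profile x1 n v z ->
  exists d, 0 <= d < D /\ matched PL PR d /\
    filterlim v (at_left x1) (locally d) /\ filterlim v (at_right x1) (locally (- d)) /\
    n x1 = G d + PL (D - d) /\
    (forall x, x < x1 -> n x = G (v x) + PL (D - v x)) /\
    (forall x, x1 < x -> n x = G (v x) - PR (D + v x)) /\
    flows b D PL x1 v /\ flows b D PR (- x1) (fun x => - v (- x)).
Proof.
  intros HL HR [Hl [Hr [Hn [Hz Ez]]]].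
  assert (Hcl := half_profile_end K b D hi G dG x1 n v z PL HK Hb HD Hhi G_derive_left dG_cont_left HL Hl Hn Hz
                   (fun x Hx => Ez x (Rlt_not_eq _ _ Hx))).
  assert (Hcr : forall f : R -> R, continuous f x1 -> continuous (fun x => f (- x)) (- x1)).
  { intros f Hf. apply (cont_comp f (fun x => - x)); [cont|]. now rewrite Ropp_involutive. }
  assert (Hcr' := half_profile_end K b D (- lo) Gr dGr (- x1) (fun x => - n (- x))
    (fun x => - v (- x)) (fun x => z (- x)) PR HK Hb HD ltac:(lra) Gr_derive dGr_cont HR Hr
    (cont_opp _ _ (Hcr n Hn)) (Hcr z Hz)).
  cbv beta in Hcr'. rewrite !Ropp_involutive in Hcr'.
  assert (Ez' : forall x, x < - x1 -> z (- x) = K * (D ^ 2 - (- v (- x)) ^ 2)).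
  { intros x Hx. rewrite Ez by lra. ring. }
  specialize (Hcr' Ez').
  destruct Hcl as [[d [Hd [Ed [Hvd [End [Hgapl Hfl]]]]]] | [[Z1 N1] | [Z1 N1]]];
  destruct Hcr' as [[d' [Hd' [Ed' [Hvd' [End' [Hgapr Hfr]]]]]] | [[Z2 N2] | [Z2 N2]]];
    unfold Gr in *;
    try (exfalso; lra).
  - assert (Edd : d' = d).
    { rewrite Ed in Ed'. apply Rmult_eq_reg_l in Ed'; [|lra]. nra. }
    subst d'. exists d. split; [exact Hd|]. split; [unfold matched; lra|].
    split; [exact Hvd|]. split.
    { apply lim_right_reflect.
      apply lim_left_ext with (fun x => - - v (- x)).
      - intros y _. apply Ropp_involutive.
      - now apply (lim_opp (at_left (- x1))). }
    split; [exact End|]. split; [exact Hgapl|]. split; [|split; [exact Hfl | exact Hfr]].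
    intros x Hx. specialize (Hgapr (- x) ltac:(lra)). rewrite !Ropp_involutive in Hgapr.
    replace (D - - v x) with (D + v x) in Hgapr by ring. lra.
  - exfalso. assert (0 < K * (D ^ 2 - d ^ 2)) by (apply Rmult_lt_0_compat; nra). lra.
  - exfalso. assert (0 < K * (D ^ 2 - d ^ 2)) by (apply Rmult_lt_0_compat; nra). lra.
  - exfalso. assert (0 < K * (D ^ 2 - d' ^ 2)) by (apply Rmult_lt_0_compat; nra). lra.
  - exfalso. assert (0 < K * (D ^ 2 - d' ^ 2)) by (apply Rmult_lt_0_compat; nra). lra.
Qed.

Lemma flows_shift P x1 h v : flows b D P x1 v -> flows b D P (x1 - h) (fun x => v (x + h)).
Proof.
  intros Hv x Hx. destruct (Hv (x + h) ltac:(lra)) as [Hvx Hvd]. split; [exact Hvx|].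
  eapply is_derive_eq; [apply (der_comp v (fun x => x + h)); [exact Hvd | der]|].
  cbv beta. ring.
Qed.

Lemma lim_left_shift (f : R -> R) (x h l : R) :
  filterlim f (at_left x) (locally l) -> filterlim (fun y => f (y + h)) (at_left (x - h)) (locally l).
Proof.
  rewrite !lim_left. intros H e He. destruct (H e He) as [d [Hd Hn]].
  exists d. split; [exact Hd|]. intros y Hy. apply Hn. lra.
Qed.

Theorem reduced_profile_unique x1 n1 v1 z1 x2 n2 v2 z2 :
  reduced_profile x1 n1 v1 z1 -> reduced_profile x2 n2 v2 z2 ->
  forall x, n2 x = n1 (x + (x1 - x2)) /\ (x <> x2 -> v2 x = v1 (x + (x1 - x2))).
Proof.
  intros H1 H2.
  destruct (gap_curve_exists K b D hi dG HK Hb HD Hhi dG_cont_left) as [PL HL].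
  destruct (gap_curve_exists K b D (- lo) dGr HK Hb HD ltac:(lra) dGr_cont) as [PR HR].
  destruct (reduced_profile_structure PL PR _ _ _ _ HL HR H1)
    as [d1 [Hd1 [M1 [L1 [R1 [E1 [GL1 [GR1 [FL1 FR1]]]]]]]]].
  destruct (reduced_profile_structure PL PR _ _ _ _ HL HR H2)
    as [d2 [Hd2 [M2 [L2 [R2 [E2 [GL2 [GR2 [FL2 FR2]]]]]]]]].
  assert (E := matched_unique PL PR d1 d2 HL HR Hd1 Hd2 M1 M2). subst d2.
  set (h := x1 - x2).
  assert (HvL : forall x, x < x2 -> v2 x = v1 (x + h)).
  { intros x Hx. symmetry.
    apply (flow_unique K b D dG Hb HD PL x2 d1 (fun x => v1 (x + h)) v2 HL); auto; [lra | |].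
    - replace x2 with (x1 - h) by (unfold h; ring). now apply flows_shift.
    - replace x2 with (x1 - h) by (unfold h; ring). now apply lim_left_shift. }
  assert (Hrefl : forall (v : R -> R) (y : R), filterlim v (at_right y) (locally (- d1)) ->
    filterlim (fun x => - v (- x)) (at_left (- y)) (locally d1)).
  { intros v y Hv. rewrite <- (Ropp_involutive d1). apply (lim_opp (at_left (- y))).
    now apply lim_right_reflect. }
  assert (HvR : forall x, x2 < x -> v2 x = v1 (x + h)).
  { intros x Hx. apply Ropp_eq_reg.
    assert (Hv := flow_unique K b D dGr Hb HD PR (- x2) d1
      (fun x => - v1 (- (x + - h))) (fun x => - v2 (- x)) HR ltac:(lra)).
    specialize (Hv ltac:(replace (- x2) with (- x1 - - h) by (unfold h; ring);
                         exact (flows_shift PR (- x1) (- h) _ FR1)) FR2).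
    specialize (Hv ltac:(replace (- x2) with (- x1 - - h) by (unfold h; ring);
                         exact (lim_left_shift _ (- x1) (- h) d1 (Hrefl v1 x1 R1)))).
    specialize (Hv (Hrefl v2 x2 R2) (- x) ltac:(lra)). cbv beta in Hv.
    rewrite Ropp_involutive in Hv. replace (- (- x + - h)) with (x + h) in Hv by ring.
    symmetry. exact Hv. }
  intros x. split.
  - destruct (Rtotal_order x x2) as [Hx | [-> | Hx]].
    + rewrite (GL2 x Hx), (GL1 (x + h)) by (unfold h; lra). now rewrite HvL.
    + replace (x2 + h) with x1 by (unfold h; ring). now rewrite E1, E2.
    + rewrite (GR2 x Hx), (GR1 (x + h)) by (unfold h; lra). now rewrite HvR.
  - intros N. destruct (Rtotal_order x x2) as [Hx | [Hx | Hx]]; [now apply HvL | contradiction | now apply HvR].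
Qed.

(** The branches [vl] and [vr] are continued by constants beyond [0], so [v ^ 2] and [n]
    are sums of globally continuous functions; [n] is differentiable at [0] because its
    derivative extends continuously. *)
Theorem reduced_profile_exists : exists (d : R) (n v vl vr : R -> R),
  0 <= d < D /\
  (forall x, x < 0 -> d < v x < D /\ v x = vl x) /\
  (forall x, 0 < x -> - D < v x < - d /\ v x = vr x) /\
  v 0 = d /\ vl 0 = d /\ vr 0 = - d /\
  (forall x, continuous vl x /\ lo < vl x < hi) /\
  (forall x, continuous vr x /\ lo < vr x < hi) /\
  (forall x, is_derive n x (K * (D ^ 2 - v x ^ 2))) /\
  (forall x, continuous (fun x => v x ^ 2) x) /\
  (forall x, x <> 0 -> is_derive v x (- b * (n x - G (v x)) / v x)) /\
  (exists l, filterlim (fun x => - b * (n x - G (v x)) / v x) (at_left 0) (locally l)) /\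
  (exists l, filterlim (fun x => - b * (n x - G (v x)) / v x) (at_right 0) (locally l)) /\
  filterlim v (Rbar_locally m_infty) (locally D) /\
  filterlim v (Rbar_locally p_infty) (locally (- D)) /\
  filterlim n (Rbar_locally m_infty) (locally (G D)) /\
  filterlim n (Rbar_locally p_infty) (locally (G (- D))).
Proof.
  assert (Hlo' : D < - lo) by lra.
  destruct (gap_curve_exists K b D hi dG HK Hb HD Hhi dG_cont_left) as [PL HL].
  destruct (gap_curve_exists K b D (- lo) dGr HK Hb HD Hlo' dGr_cont) as [PR HR].
  destruct (matched_exists PL PR HL HR) as [d [Hd Hm]].
  assert (Hsonic : d = 0 -> PL D = 0 /\ PR D = 0).
  { intros ->. now apply matched_sonic. }
  destruct (flow_exists K b D dG Hb HD PL d HL Hd) as [vL [HLc [HL0 [HLv HLlim]]]].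
  destruct (flow_exists K b D dGr Hb HD PR d HR Hd) as [vR [HRc [HR0 [HRv HRlim]]]].
  assert (HLb : forall x, 0 <= vL x < D).
  { intros x. destruct (Rlt_or_le x 0) as [Hx | Hx];
      [destruct (HLv x Hx); lra | rewrite HL0; lra]. }
  assert (HRb : forall x, 0 <= vR x < D).
  { intros x. destruct (Rlt_or_le x 0) as [Hx | Hx];
      [destruct (HRv x Hx); lra | rewrite HR0; lra]. }
  pose (vr := fun x => - vR (- x)).
  assert (Hvrc : forall x, continuous vr x).
  { intros x. unfold vr. cont. apply (cont_comp vR (fun x => - x)); [cont | apply HRc]. }
  pose (v := fun x => if Rle_dec x 0 then vL x else vr x).
  assert (HvL : forall x, x <= 0 -> v x = vL x).
  { intros x Hx. unfold v. destruct (Rle_dec x 0); [reflexivity | contradiction]. }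
  assert (HvR : forall x, 0 < x -> v x = vr x).
  { intros x Hx. unfold v. destruct (Rle_dec x 0); [lra | reflexivity]. }
  pose (n0 := G d + PL (D - d)).
  pose (nl := fun x => G (vL x) + PL (D - vL x)).
  pose (nr := fun x => G (vr x) - PR (D - vR (- x))).
  pose (n := fun x => nl x + nr x - n0).
  assert (Hnl : forall x, x <= 0 -> n x = nl x).
  { intros x Hx. unfold n, nr, vr, n0. rewrite (HR0 (- x)) by lra. unfold matched in Hm. lra. }
  assert (Hnr : forall x, 0 <= x -> n x = nr x).
  { intros x Hx. unfold n, nl, n0. rewrite (HL0 x) by lra. ring. }
  assert (Hnc : forall x, continuous n x).
  { intros x. unfold n, nl, nr. cont.
    - apply (cont_comp G vL); [apply HLc | eapply der_continuous, HG]. assert (H := HLb x). lra.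
    - apply (cont_comp PL (fun x => D - vL x)); [cont; apply HLc | apply HL].
    - apply (cont_comp G vr); [apply Hvrc | eapply der_continuous, HG].
      assert (H := HRb (- x)). unfold vr. lra.
    - apply (cont_comp PR (fun x => D - vR (- x))); [|apply HR].
      cont. apply (cont_comp vR (fun x => - x)); [cont | apply HRc]. }
  assert (Hsq : forall x, continuous (fun x => v x ^ 2) x).
  { intros x. apply continuous_ext with (fun x => vL x ^ 2 + vr x ^ 2 - d ^ 2).
    - intros y. destruct (Rle_or_lt y 0) as [Hy | Hy].
      + rewrite HvL by exact Hy. unfold vr. rewrite (HR0 (- y)) by lra. simpl; ring.
      + rewrite HvR by exact Hy. rewrite (HL0 y) by lra. simpl; ring.
    - cont; [apply HLc | apply Hvrc]. }
  assert (HflL : flows b D PL 0 vL).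
  { intros x Hx. destruct (HLv x Hx) as [H1 H2]. split; [lra | exact H2]. }
  assert (HflR : flows b D PR 0 vR).
  { intros x Hx. destruct (HRv x Hx) as [H1 H2]. split; [lra | exact H2]. }
  assert (Hnd : forall x, is_derive n x (K * (D ^ 2 - v x ^ 2))).
  { apply (is_derive_of_punctured n (fun x => K * (D ^ 2 - v x ^ 2)) 0 Hnc).
    - intros x. apply cont_mult; [cont|].
      apply (cont_minus (fun _ => D ^ 2) (fun x => v x ^ 2)); [cont | apply Hsq].
    - intros x Nx. destruct (Rlt_or_le x 0) as [Hx | Hx].
      + rewrite HvL by lra.
        apply (half_profile_of_flow K b D hi G dG Hb Hhi G_derive_left PL vL n HL HflL); [|exact Hx].
        intros y Hy. rewrite Hnl by lra. reflexivity.
      + assert (Hx' : - x < 0) by lra.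
        assert (H := half_profile_of_flow K b D (- lo) Gr dGr Hb Hlo' Gr_derive PR vR
          (fun x => - n (- x)) HR HflR).
        specialize (H ltac:(intros y Hy; cbv beta; rewrite Hnr by lra; unfold nr, vr, Gr;
                            rewrite Ropp_involutive; ring) (- x) Hx').
        rewrite HvR by lra.
        apply is_derive_ext with (fun x => - - n (- - x)).
        { intros y. now rewrite !Ropp_involutive. }
        eapply is_derive_eq.
        * apply der_opp, (der_comp (fun x => - n (- x)) (fun x => - x)); [exact H | der].
        * unfold vr. ring. }
  assert (HvdL : forall x, x < 0 -> - b * (n x - G (v x)) / v x = - b * PL (D - vL x) / vL x).
  { intros x Hx. rewrite Hnl, HvL by lra. unfold nl. f_equal. ring. }
  assert (HvdR : forall x, 0 < x ->
    - b * (n x - G (v x)) / v x = - b * PR (D - vR (- x)) / vR (- x)).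
  { intros x Hx. rewrite Hnr, HvR by lra. unfold nr, vr.
    destruct (HflR (- x) ltac:(lra)) as [Hp _]. field. lra. }
  exists d, n, v, vL, vr.
  split; [exact Hd|]. split.
  { intros x Hx. rewrite HvL by lra. split; [apply HLv, Hx | reflexivity]. }
  split.
  { intros x Hx. rewrite HvR by lra. unfold vr.
    destruct (HRv (- x) ltac:(lra)) as [Hp _]. split; [lra | reflexivity]. }
  split; [rewrite HvL by lra; apply HL0; lra|].
  split; [apply HL0; lra|].
  split; [unfold vr; rewrite HR0 by lra; reflexivity|].
  split.
  { intros x. split; [apply HLc|]. assert (H := HLb x). lra. }
  split.
  { intros x. split; [apply Hvrc|]. assert (H := HRb (- x)). unfold vr. lra. }
  split; [exact Hnd|]. split; [exact Hsq|]. split.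
  { intros x Nx. destruct (Rlt_or_le x 0) as [Hx | Hx].
    - rewrite HvdL by exact Hx. apply is_derive_ext_loc with vL; [|apply HflL, Hx].
      apply locally_R. exists (- x). split; [lra|]. intros y Hy. apply Rabs_def2 in Hy.
      symmetry. apply HvL. lra.
    - rewrite HvdR by lra. apply is_derive_ext_loc with vr.
      + apply locally_R. exists x. split; [lra|]. intros y Hy. apply Rabs_def2 in Hy.
        symmetry. apply HvR. lra.
      + unfold vr. destruct (HflR (- x) ltac:(lra)) as [_ Hp]. eapply is_derive_eq.
        * apply der_opp, (der_comp vR (fun x => - x)); [exact Hp | der].
        * ring. }
  split.
  { destruct (flow_slope_limit K b D hi dG HK Hb HD Hhi dG_cont_left PL d vL HL Hd) as [l Hl].
    - intros E. now apply Hsonic.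
    - apply HLc.
    - apply HL0. lra.
    - intros x Hx. apply HLv, Hx.
    - exists l. apply lim_left_ext with (fun x => - b * PL (D - vL x) / vL x); [|exact Hl].
      intros x Hx. symmetry. now apply HvdL. }
  split.
  { destruct (flow_slope_limit K b D (- lo) dGr HK Hb HD Hlo' dGr_cont PR d vR HR Hd) as [l Hl].
    - intros E. now apply Hsonic.
    - apply HRc.
    - apply HR0. lra.
    - intros x Hx. apply HRv, Hx.
    - exists l. apply lim_right_ext with (fun x => - b * PR (D - vR (- x)) / vR (- x)).
      { intros x Hx. symmetry. now apply HvdR. }
      apply lim_right_reflect. rewrite Ropp_0.
      apply lim_left_ext with (fun x => - b * PR (D - vR x) / vR x); [|exact Hl].
      intros x _. now rewrite Ropp_involutive. }
  assert (HvmI : filterlim v (Rbar_locally m_infty) (locally D)).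
  { apply (filterlim_ext_loc vL); [|exact HLlim].
    exists 0. intros x Hx. symmetry. apply HvL. lra. }
  assert (HvpI : filterlim v (Rbar_locally p_infty) (locally (- D))).
  { apply (filterlim_ext_loc vr).
    - exists 0. intros x Hx. symmetry. now apply HvR.
    - apply lim_pinf_reflect.
      apply filterlim_ext with (fun x => - vR x).
      + intros x. unfold vr. now rewrite Ropp_involutive.
      + now apply (lim_opp (Rbar_locally m_infty)). }
  split; [exact HvmI|]. split; [exact HvpI|]. split.
  - replace (G D) with (G D + PL (D - D)).
    2: { rewrite Rminus_eq_0, (proj1 (proj2 HL)). ring. }
    apply (filterlim_ext_loc nl).
    { exists 0. intros x Hx. symmetry. apply Hnl. lra. }
    apply (lim_comp_cont _ vL (fun u => G u + PL (D - u)) D HLlim).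
    cont; [eapply der_continuous, HG; lra|].
    apply (cont_comp PL (fun u => D - u)); [cont | apply HL].
  - replace (G (- D)) with (G (- D) - PR (D + - D)).
    2: { replace (D + - D) with 0 by ring. rewrite (proj1 (proj2 HR)). ring. }
    apply (filterlim_ext_loc (fun x => G (v x) - PR (D + v x))).
    { exists 0. intros x Hx. rewrite Hnr by lra. unfold nr. rewrite HvR by exact Hx.
      unfold vr. reflexivity. }
    apply (lim_comp_cont _ v (fun u => G u - PR (D + u)) (- D) HvpI).
    cont; [eapply der_continuous, HG; lra|].
    apply (cont_comp PR (fun u => D + u)); [cont | apply HR].
Qed.

End Reduced.

(** * Reduction of the travelling wave equations *)

Lemma lim_plus (F : (R -> Prop) -> Prop) {FF : Filter F} (f g : R -> R) (l m : R) :
  filterlim f F (locally l) -> filterlim g F (locally m) ->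
  filterlim (fun x => f x + g x) F (locally (l + m)).
Proof. intros Hf Hg. exact (filterlim_comp_2 _ _ _ Hf Hg (filterlim_plus l m)). Qed.

Lemma lim_mult (F : (R -> Prop) -> Prop) {FF : Filter F} (f g : R -> R) (l m : R) :
  filterlim f F (locally l) -> filterlim g F (locally m) ->
  filterlim (fun x => f x * g x) F (locally (l * m)).
Proof. intros Hf Hg. exact (filterlim_comp_2 _ _ _ Hf Hg (filterlim_mult l m)). Qed.

Lemma lim_minus (F : (R -> Prop) -> Prop) {FF : Filter F} (f g : R -> R) (l m : R) :
  filterlim f F (locally l) -> filterlim g F (locally m) ->
  filterlim (fun x => f x - g x) F (locally (l - m)).
Proof.
  intros Hf Hg. apply (lim_plus F); [exact Hf|]. now apply (lim_opp F).
Qed.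

Lemma lim_const (F : (R -> Prop) -> Prop) {FF : Filter F} (a : R) :
  filterlim (fun _ : R => a) F (locally a).
Proof. apply filterlim_const. Qed.

Ltac limit F :=
  lazymatch goal with
  | |- filterlim (fun _ => ?a) _ (locally ?a) => apply (lim_const F)
  | |- filterlim (fun x => _ + _) _ (locally (_ + _)) => apply (lim_plus F); limit F
  | |- filterlim (fun x => _ - _) _ (locally (_ - _)) => apply (lim_minus F); limit F
  | |- filterlim (fun x => _ * _) _ (locally (_ * _)) => apply (lim_mult F); limit F
  | |- _ => try eassumption
  end.

Lemma mass_flux_lim (F : (R -> Prop) -> Prop) {FF : Filter F} c v s :
  state_lim v F s -> filterlim (fun x => mass_flux c (v x)) F (locally (mass_flux c s)).
Proof. intros [Hr [Hu Ht]]. unfold mass_flux. limit F. Qed.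

Lemma momentum_flux_lim (F : (R -> Prop) -> Prop) {FF : Filter F} Rg c v s :
  state_lim v F s ->
  filterlim (fun x => momentum_flux Rg c (v x)) F (locally (momentum_flux Rg c s)).
Proof. intros [Hr [Hu Ht]]. unfold momentum_flux, pressure. simpl. limit F. Qed.

Lemma energy_flux_lim (F : (R -> Prop) -> Prop) {FF : Filter F} Rg gamma c v s :
  state_lim v F s ->
  filterlim (fun x => energy_flux Rg gamma c (v x)) F (locally (energy_flux Rg gamma c s)).
Proof.
  intros [Hr [Hu Ht]]. unfold energy_flux, internal_energy, pressure. simpl. limit F.
Qed.

Lemma list_isolated (J : list R) (x : R) :
  exists d, 0 < d /\ forall y, 0 < Rabs (y - x) < d -> ~ In y J.
Proof.
  induction J as [|j J [d [Hd H]]].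
  - exists 1. split; [lra|]. intros y _ [].
  - destruct (Req_dec j x) as [-> | N].
    + exists d. split; [exact Hd|]. intros y Hy [<- | Hin].
      * rewrite Rminus_eq_0, Rabs_R0 in Hy. lra.
      * now apply (H y).
    + assert (Hj : 0 < Rabs (j - x)) by (apply Rabs_pos_lt; lra).
      destruct (pick_small d (Rabs (j - x)) Hd Hj) as [e [He [H1 H2]]].
      exists e. split; [exact He|].
      intros y Hy [<- | Hin]; [lra|]. apply (H y); [lra | exact Hin].
Qed.

Lemma list_bounded (J : list R) : exists M, 0 < M /\ forall x, In x J -> - M < x < M.
Proof.
  induction J as [|j J [M [HM H]]].
  - exists 1. split; [lra|]. intros x [].
  - exists (M + Rabs j). assert (Hj := Rabs_pos j). split; [lra|].
    intros x [<- | Hin].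
    + assert (Ha := Rle_abs j). assert (Hb := Rle_abs (- j)). rewrite Rabs_Ropp in Hb. lra.
    + specialize (H x Hin). lra.
Qed.

(** The local alternatives leave out a change from [N] to [P]. *)
Lemma sign_change_once (P N : R -> Prop) :
  (forall x, P x -> N x -> False) ->
  (forall x, exists d, 0 < d /\
     ((forall y, Rabs (y - x) < d -> P y) \/ (forall y, Rabs (y - x) < d -> N y) \/
      ((forall y, x - d < y < x -> P y) /\ (forall y, x < y < x + d -> N y)))) ->
  (exists M, forall x, x < M -> P x) -> (exists M, forall x, M < x -> N x) ->
  exists x1, (forall x, x < x1 -> P x) /\ (forall x, x1 < x -> N x).
Proof.
  intros Hex Hloc [Ml HMl] [Mr HMr].
  destruct (completeness (fun x => forall y, y <= x -> P y)) as [x1 [Hub Hlub]].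
  { exists (Mr + 1). intros x Hx. apply Rnot_lt_le. intros Hlt.
    apply (Hex (Mr + 1)); [apply Hx; lra | apply HMr; lra]. }
  { exists (Ml - 1). intros y Hy. apply HMl. lra. }
  assert (HP : forall x, x < x1 -> P x).
  { intros x Hx. apply NNPP. intros HnP. assert (x1 <= x); [|lra].
    apply Hlub. intros z Hz. apply Rnot_lt_le. intros Hlt. apply HnP, Hz. lra. }
  destruct (Hloc x1) as [d [Hd [HPP | [HNN | [HPd HNd]]]]].
  - exfalso. assert (x1 + d / 2 <= x1); [|lra]. apply Hub. intros y Hy.
    destruct (Rlt_or_le y x1) as [Hlt | Hle]; [now apply HP|]. apply HPP, Rabs_def1; lra.
  - exfalso. apply (Hex (x1 - d / 2)); [apply HP; lra | apply HNN, Rabs_def1; lra].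
  - exists x1. split; [exact HP|]. intros x Hx. apply NNPP. intros HnN.
    destruct (completeness (fun x => x1 < x /\ forall y, x1 < y <= x -> N y)) as [x2 [Hub2 Hlub2]].
    { exists x. intros z [Hz1 Hz]. apply Rnot_lt_le. intros Hlt. apply HnN, Hz. lra. }
    { exists (x1 + d / 2). split; [lra|]. intros y Hy. apply HNd. lra. }
    assert (H12 : x1 + d / 2 <= x2).
    { apply Hub2. split; [lra|]. intros y Hy. apply HNd. lra. }
    assert (HN2 : forall y, x1 < y < x2 -> N y).
    { intros y Hy. apply NNPP. intros HnNy. assert (x2 <= y); [|lra].
      apply Hlub2. intros z [Hz1 Hz]. apply Rnot_lt_le. intros Hlt. apply HnNy, Hz. lra. }
    destruct (Hloc x2) as [d2 [Hd2 Hcase]].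
    destruct (pick_left (x2 - d2) x1 x2) as [y [[Hy1 Hy3] Hy2]]; [lra | lra |].
    destruct Hcase as [HPP | [HNN | [HPd2 _]]].
    + apply (Hex y); [apply HPP, Rabs_def1; lra | apply HN2; lra].
    + assert (x2 + d2 / 2 <= x2); [|lra]. apply Hub2. split; [lra|]. intros t Ht.
      destruct (Rlt_or_le t x2) as [Hlt | Hle]; [apply HN2; lra | apply HNN, Rabs_def1; lra].
    + apply (Hex y); [apply HPd2; lra | apply HN2; lra].
Qed.

(** Near [x], [v] is plus or minus the square root of [q]. *)
Lemma derive_of_square (v q : R -> R) (x l : R) :
  continuous v x -> v x <> 0 -> locally x (fun y => v y ^ 2 = q y) ->
  is_derive q x l -> is_derive v x (l / (2 * v x)).
Proof.
  assert (Hpos : forall v : R -> R, continuous v x -> 0 < v x ->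
    locally x (fun y => v y ^ 2 = q y) -> is_derive q x l -> is_derive v x (l / (2 * v x))).
  { intros u Hc H0 Hloc Hq.
    assert (Eq : u x ^ 2 = q x) by exact (locally_singleton _ _ Hloc).
    destruct (cont_pos_near u x Hc H0) as [d [Hd Hn]].
    apply is_derive_ext_loc with (fun y => sqrt (q y)).
    - apply (filter_imp (fun y => u y ^ 2 = q y /\ 0 < u y)).
      + intros y [E Hy]. rewrite <- E. apply sqrt_pow2. lra.
      + apply filter_and; [exact Hloc|]. apply locally_R. now exists d.
    - eapply is_derive_eq.
      + apply is_derive_sqrt; [exact Hq|]. rewrite <- Eq. nra.
      + rewrite <- Eq, sqrt_pow2 by lra. reflexivity. }
  intros Hc N Hloc Hq. destruct (Rtotal_order (v x) 0) as [H | [H | H]]; [|contradiction|].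
  - apply is_derive_ext with (fun y => - - v y).
    { intros y. apply Ropp_involutive. }
    eapply is_derive_eq.
    + apply der_opp. apply (Hpos (fun y => - v y)); [cont | lra | | exact Hq].
      apply (filter_imp (fun y => v y ^ 2 = q y)); [|exact Hloc].
      intros y E. rewrite <- E. ring.
    + field. lra.
  - now apply Hpos.
Qed.

Lemma is_derive_Rpower (x y : R) : 0 < x ->
  is_derive (fun t => Rpower t y) x (y * Rpower x (y - 1)).
Proof. intros H. apply is_derive_Reals. now apply derivable_pt_lim_power. Qed.

Lemma emission_cont alpha sigma (v : R -> state) (x : R) :
  0 < temp (v x) -> continuous (fun y => temp (v y)) x ->
  continuous (fun y => emission alpha sigma (v y)) x.
Proof.
  intros Hp Hc. unfold emission. cont.
  apply (cont_comp (fun t => Rpower t alpha) (fun y => temp (v y))); [exact Hc|].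
  eapply der_continuous. now apply is_derive_Rpower.
Qed.

Lemma piecewise_C1_comp (F dF v dv : R -> R) (lo hi l r : R) :
  (forall u, lo < u < hi -> is_derive F u (dF u) /\ continuous dF u) ->
  (forall x, lo < v x < hi) -> lo < l < hi -> lo < r < hi ->
  (forall x, x <> 0 -> is_derive v x (dv x) /\ continuous dv x) ->
  filterlim v (at_left 0) (locally l) -> filterlim v (at_right 0) (locally r) ->
  (exists l', filterlim dv (at_left 0) (locally l')) ->
  (exists r', filterlim dv (at_right 0) (locally r')) ->
  piecewise_C1 (0 :: nil) (fun x => F (v x)).
Proof.
  intros HF Hv Hl Hr Hd Hvl Hvr [l' Hdl] [r' Hdr].
  assert (HD : forall x, x <> 0 -> is_derive (fun x => F (v x)) x (dF (v x) * dv x)).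
  { intros x Nx. apply der_comp; [apply HF, Hv | now apply Hd]. }
  assert (HDE : forall x, x <> 0 -> Derive (fun x => F (v x)) x = dF (v x) * dv x).
  { intros x Nx. now apply is_derive_unique, HD. }
  assert (HFc : forall u, lo < u < hi -> continuous F u).
  { intros u Hu. eapply der_continuous. now apply HF. }
  split.
  - intros x Nin. assert (Nx : x <> 0) by (intros ->; apply Nin; now left).
    split; [eexists; now apply HD|].
    apply continuous_ext_loc with (fun x => dF (v x) * dv x).
    + apply locally_R. exists (Rabs x). split; [now apply Rabs_pos_lt|].
      intros y Hy. symmetry. apply HDE. intros ->.
      rewrite Rminus_0_l, Rabs_Ropp in Hy. lra.
    + destruct (Hd x Nx) as [Hd1 Hd2]. apply cont_mult; [|exact Hd2].
      apply (cont_comp dF v); [eapply der_continuous, Hd1 | apply HF, Hv].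
  - intros x [<- | []]. split; split.
    + exists (F l). apply (lim_comp_cont (at_left 0) v F l Hvl). now apply HFc.
    + exists (F r). apply (lim_comp_cont (at_right 0) v F r Hvr). now apply HFc.
    + exists (dF l * l'). apply lim_left_ext with (fun x => dF (v x) * dv x).
      { intros y Hy. symmetry. apply HDE. lra. }
      apply (lim_mult (at_left 0)); [|exact Hdl].
      apply (lim_comp_cont (at_left 0) v dF l Hvl). now apply HF.
    + exists (dF r * r'). apply lim_right_ext with (fun x => dF (v x) * dv x).
      { intros y Hy. symmetry. apply HDE. lra. }
      apply (lim_mult (at_right 0)); [|exact Hdr].
      apply (lim_comp_cont (at_right 0) v dF r Hvr). now apply HF.
Qed.

Lemma weak_constant_limit (F : R -> R) (J : list R) (l : R) :
  weak_derivative F (fun _ => 0) -> (forall x, ~ In x J -> continuous F x) ->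
  filterlim F (Rbar_locally m_infty) (locally l) -> forall x, ~ In x J -> F x = l.
Proof.
  intros Hw Hc Hl x Hx. destruct (list_bounded J) as [M [HM HJ]].
  apply NNPP. intros N. assert (HN : 0 < Rabs (F x - l)) by (apply Rabs_pos_lt; lra).
  destruct (proj1 (lim_minf F l) Hl _ HN) as [M' HM'].
  destruct (exists_below (- M) M') as [y [Hy1 Hy2]].
  assert (HyJ : ~ In y J) by (intros Hin; specialize (HJ y Hin); lra).
  assert (E : F x = F y) by (apply weak_constant; auto).
  specialize (HM' y ltac:(lra)). rewrite E in HM'. lra.
Qed.

Lemma derive_zero_of_max (f : R -> R) (x l d : R) :
  0 < d -> is_derive f x l -> (forall y, Rabs (y - x) < d -> f y <= f x) -> l = 0.
Proof.
  intros Hd Hl Hmax.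
  assert (pr : derivable_pt f x) by (exists l; now apply is_derive_Reals).
  rewrite <- (derive_pt_eq_0 f x l pr) by now apply is_derive_Reals.
  apply deriv_maximum with (x - d) (x + d); try lra.
  intros y Hy1 Hy2. apply Hmax, Rabs_def1; lra.
Qed.

(** At a sonic point [z] is maximal, hence [n = G 0] there, while [n] increases. Were
    [v] negative just before it, then [n < G 0 < G v] would make [z] decrease towards
    its maximum. *)
Lemma supersonic_before_sonic (Q : R -> Prop) (K A kap g0 : R) (G v n z : R -> R) (x : R) :
  0 < K -> 0 < kap -> 0 < A -> is_derive G 0 g0 -> g0 < 0 ->
  (forall y, exists d, 0 < d /\ forall t, 0 < Rabs (t - y) < d -> Q t) ->
  (forall y, Q y -> continuous v y /\ z y = K * (A ^ 2 - v y ^ 2) /\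
     is_derive z y (kap * (n y - G (v y)))) ->
  (forall y, is_derive n y (z y)) ->
  Q x -> v x = 0 ->
  exists d, 0 < d /\ forall y, x - d < y < x -> Q y /\ 0 < v y.
Proof.
  intros HK Hkap HA HG Hg0 Hiso Hz Hn HxQ Hvx.
  assert (Hmax : forall y, Q y -> z y <= K * A ^ 2).
  { intros y Hy. destruct (Hz y Hy) as [_ [-> _]].
    apply Rmult_le_compat_l; [lra|]. assert (H := pow2_ge_0 (v y)). lra. }
  assert (Htop : forall y, Q y -> v y = 0 -> z y = K * A ^ 2).
  { intros y Hy E. destruct (Hz y Hy) as [_ [-> _]]. rewrite E. ring. }
  assert (Hnear : forall y, Q y -> exists d, 0 < d /\ forall t, Rabs (t - y) < d -> Q t).
  { intros y Hy. destruct (Hiso y) as [d [Hd H]]. exists d. split; [exact Hd|].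
    intros t Ht. destruct (Req_dec t y) as [-> | N]; [exact Hy|].
    apply H. split; [apply Rabs_pos_lt; lra | exact Ht]. }
  assert (Hn0 : forall y, Q y -> v y = 0 -> n y = G 0).
  { intros y Hy E. destruct (Hz y Hy) as [_ [_ Hzd]]. rewrite E in Hzd.
    destruct (Hnear y Hy) as [d [Hd Hq]].
    apply derive_zero_of_max with (d := d) in Hzd; [nra | exact Hd|].
    intros t Ht. rewrite (Htop y Hy E). now apply Hmax, Hq. }
  assert (Hzx := Htop x HxQ Hvx).
  assert (Hzpos : 0 < z x) by (rewrite Hzx; apply Rmult_lt_0_compat; nra).
  destruct (derive_pos_left n x (z x) (Hn x) Hzpos) as [d1 [Hd1 Hnl]].
  destruct (derive_pos_left (fun u => - G u) 0 _ (der_opp _ _ _ HG)) as [d2 [Hd2 HGl]]; [lra|].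
  destruct (Hnear x HxQ) as [d3 [Hd3 HQ]].
  destruct (proj1 (cont_eps v x) (proj1 (Hz x HxQ)) d2 Hd2) as [d4 [Hd4 Hvn]].
  rewrite Hvx in Hvn.
  destruct (pick_small d3 d4 Hd3 Hd4) as [d5 [Hd5 [Hd53 Hd54]]].
  destruct (pick_small d1 d5 Hd1 Hd5) as [d [Hd [Hdd1 Hdd5]]].
  assert (Hq : forall y, x - d < y <= x -> Q y) by (intros; apply HQ, Rabs_def1; lra).
  assert (Hnx : forall y, x - d < y < x -> n y < G 0).
  { intros y Hy. rewrite <- (Hn0 x HxQ Hvx). apply Hnl. lra. }
  exists d. split; [exact Hd|].
  intros y0 Hy0. split; [apply Hq; lra|]. apply Rnot_le_lt. intros Hle.
  assert (Hneg : forall y, y0 <= y < x -> v y < 0).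
  { intros y Hy. apply Rnot_le_lt. intros Hp.
    destruct (intermediate_value v y0 y 0) as [t [Ht E]]; [lra | | lra |].
    - intros t Ht. apply Hz, Hq. lra.
    - specialize (Hnx t ltac:(lra)). rewrite (Hn0 t) in Hnx; [lra | apply Hq; lra | exact E]. }
  assert (H : - z y0 < - z x).
  { apply (increasing_of_derive (fun t => - z t) (fun t => - (kap * (n t - G (v t))))); [lra | |].
    - intros t Ht. destruct (Hz t (Hq t ltac:(lra))) as [_ [_ Hzd]].
      apply der_continuous in Hzd. cont.
    - intros t Ht. split; [apply der_opp, Hz, Hq; lra|].
      specialize (Hneg t ltac:(lra)). specialize (Hnx t ltac:(lra)).
      specialize (Hvn t ltac:(apply Rabs_def1; lra)). apply Rabs_def2 in Hvn.
      specialize (HGl (v t) ltac:(lra)). nra. }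
  specialize (Hmax y0 (Hq y0 ltac:(lra))). lra.
Qed.

(** The assertion after [x] is the one before it, for the reflected functions. *)
Lemma sonic_crossing (Q : R -> Prop) (K A kap g0 : R) (G v n z : R -> R) (x : R) :
  0 < K -> 0 < kap -> 0 < A -> is_derive G 0 g0 -> g0 < 0 ->
  (forall y, exists d, 0 < d /\ forall t, 0 < Rabs (t - y) < d -> Q t) ->
  (forall y, Q y -> continuous v y /\ z y = K * (A ^ 2 - v y ^ 2) /\
     is_derive z y (kap * (n y - G (v y)))) ->
  (forall y, is_derive n y (z y)) ->
  Q x -> v x = 0 ->
  exists d, 0 < d /\ (forall y, x - d < y < x -> Q y /\ 0 < v y) /\
    (forall y, x < y < x + d -> Q y /\ v y < 0).
Proof.
  intros HK Hkap HA HG Hg0 Hiso Hz Hn HxQ Hvx.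
  destruct (supersonic_before_sonic Q K A kap g0 G v n z x) as [d1 [Hd1 H1]]; auto.
  destruct (supersonic_before_sonic (fun y => Q (- y)) K A kap g0 (fun u => - G (- u))
    (fun y => - v (- y)) (fun y => - n (- y)) (fun y => z (- y)) (- x)) as [d2 [Hd2 H2]];
    rewrite ?Ropp_involutive; auto.
  - eapply is_derive_eq.
    + apply der_opp, (der_comp G (fun u => - u)); [rewrite Ropp_0; exact HG | der].
    + ring.
  - intros y. destruct (Hiso (- y)) as [d [Hd H]]. exists d. split; [exact Hd|].
    intros t Ht. apply H. replace (- t - - y) with (- (t - y)) by ring. now rewrite Rabs_Ropp.
  - intros y Hy. destruct (Hz _ Hy) as [Hc [E Hd]]. split; [|split].
    + cont. apply (cont_comp v (fun y => - y)); [cont | exact Hc].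
    + rewrite E. ring.
    + eapply is_derive_eq; [apply (der_comp z (fun y => - y)); [exact Hd | der]|].
      rewrite Ropp_involutive. ring.
  - intros y. eapply is_derive_eq.
    + apply der_opp, (der_comp n (fun y => - y)); [apply Hn | der].
    + ring.
  - rewrite Hvx. ring.
  - destruct (pick_small d1 d2 Hd1 Hd2) as [d [Hd [Hl Hr]]].
    exists d. split; [exact Hd|]. split.
    + intros y Hy. apply H1. lra.
    + intros y Hy. destruct (H2 (- y) ltac:(lra)) as [Hq Hv].
      rewrite Ropp_involutive in Hq, Hv. split; [exact Hq | lra].
Qed.

Section Gas.

Variables (Rg gamma alpha sigma sigma_s tau c : R) (sm sp : state).
Hypotheses (HRg : 0 < Rg) (Hgam : 1 < gamma) (Halpha : 0 < alpha)
  (Hsig : 0 < sigma) (Hsigs : 0 < sigma_s) (Htau : 0 < tau)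
  (Hrm : 0 < rho sm) (Htm : 0 < temp sm) (Hrp : 0 < rho sp) (Htp : 0 < temp sp)
  (HRH : rankine_hugoniot Rg gamma c sm sp)
  (Hem : c + sound_speed Rg gamma sm < vel sm)
  (Hep : c < vel sp < c + sound_speed Rg gamma sp).

Definition flux_m : R := mass_flux c sm.
Definition flux_a : R := momentum_flux Rg c sm / flux_m.
Definition U_sonic : R := gamma * flux_a / (gamma + 1).
Definition amplitude : R := (vel sm - vel sp) / 2.

(** [K_flux] is the coefficient of the energy law
    [n' = K_flux (amplitude^2 - v^2)], and [b_rate] is such that
    [n'' = 2 K_flux b_rate (n - G v)]. *)
Definition K_flux : R := sigma_s * flux_m * (gamma + 1) / (2 * (gamma - 1)).
Definition b_rate : R := tau ^ 2 / (2 * K_flux).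

(** The state with the given mass and momentum fluxes and velocity [v] relative to
    the sonic one. *)
Definition state_of (v : R) : state :=
  State (flux_m / (U_sonic + v)) (c + (U_sonic + v))
        ((U_sonic + v) * (flux_a - (U_sonic + v)) / Rg).

Definition emit (v : R) : R := emission alpha sigma (state_of v).
Definition d_emit (v : R) : R :=
  sigma * (alpha * Rpower (temp (state_of v)) (alpha - 1))
  * ((flux_a - 2 * (U_sonic + v)) / Rg).

Lemma sound_speed_pos s : 0 < temp s -> 0 < sound_speed Rg gamma s.
Proof.
  intros H. apply sqrt_lt_R0. apply Rmult_lt_0_compat; [nra | exact H].
Qed.

Lemma Um_pos : 0 < vel sm - c.
Proof. assert (H := sound_speed_pos sm Htm). lra. Qed.

Lemma flux_m_pos : 0 < flux_m.
Proof. apply Rmult_lt_0_compat; [exact Hrm | apply Um_pos]. Qed.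

Lemma supersonic s : sound_speed Rg gamma s < vel s - c ->
  Rg * gamma * temp s < (vel s - c) ^ 2.
Proof.
  intros H. unfold sound_speed in H. assert (H0 := sqrt_pos (Rg * gamma * temp s)).
  destruct (Rle_or_lt 0 (Rg * gamma * temp s)) as [Hp | Hn].
  - assert (E := sqrt_sqrt _ Hp). nra.
  - assert (0 <= (vel s - c) ^ 2) by apply pow2_ge_0. lra.
Qed.

Lemma subsonic s : 0 < vel s - c < sound_speed Rg gamma s ->
  (vel s - c) ^ 2 < Rg * gamma * temp s.
Proof.
  intros [H0 H]. unfold sound_speed in H.
  destruct (Rle_or_lt (Rg * gamma * temp s) 0) as [Hn | Hp].
  - rewrite sqrt_neg_0 in H by exact Hn. lra.
  - assert (E := sqrt_sqrt _ (Rlt_le _ _ Hp)). nra.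
Qed.

(** The mass flux determines the density from the velocity, and then the momentum flux
    the pressure, hence the temperature. *)
Lemma state_of_fluxes s : 0 < vel s - c ->
  mass_flux c s = flux_m -> momentum_flux Rg c s = flux_m * flux_a ->
  s = state_of (vel s - c - U_sonic).
Proof.
  intros HU Hmass Hmom. assert (Hm := flux_m_pos).
  destruct s as [r u t]. unfold state_of, mass_flux, momentum_flux, pressure in *. simpl in *.
  replace (U_sonic + (u - c - U_sonic)) with (u - c) by ring.
  assert (Er : r = flux_m / (u - c)) by (rewrite <- Hmass; field; lra).
  assert (Ht : flux_m * (Rg * t) = flux_m * ((u - c) * (flux_a - (u - c)))).
  { replace (flux_m * (Rg * t)) with ((u - c) * (Rg * r * t)) by (rewrite <- Hmass; ring).
    replace (Rg * r * t) with (flux_m * flux_a - flux_m * (u - c)).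
    - ring.
    - rewrite <- Hmom, <- Hmass. ring. }
  apply Rmult_eq_reg_l in Ht; [|lra].
  f_equal; [exact Er | ring |]. rewrite <- Ht. field. lra.
Qed.

Lemma flux_a_eq : momentum_flux Rg c sm = flux_m * flux_a.
Proof. unfold flux_a. field. assert (H := flux_m_pos). lra. Qed.

Lemma flux_jumps :
  mass_flux c sp = flux_m /\ momentum_flux Rg c sp = flux_m * flux_a /\
  energy_flux Rg gamma c sp = energy_flux Rg gamma c sm.
Proof.
  destruct HRH as [H1 [H2 H3]].
  assert (E1 : mass_flux c sp = flux_m) by (unfold flux_m, mass_flux; lra).
  assert (E2 : momentum_flux Rg c sp = momentum_flux Rg c sm).
  { assert (H1c : c * (c * (rho sp - rho sm)) = c * (rho sp * vel sp - rho sm * vel sm))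
      by now rewrite H1.
    unfold momentum_flux. lra. }
  split; [exact E1|]. split; [rewrite E2; apply flux_a_eq|].
  assert (E1c : c ^ 2 / 2 * mass_flux c sp = c ^ 2 / 2 * mass_flux c sm).
  { f_equal. exact E1. }
  assert (E2c : c * momentum_flux Rg c sp = c * momentum_flux Rg c sm) by now rewrite E2.
  unfold energy_flux, mass_flux, momentum_flux, total_energy in *. lra.
Qed.

(** On the curve [state_of] the energy flux is a quadratic function of the velocity with
    vertex at [U_sonic], and the entropy conditions put the end states on different
    sides of the vertex; so they are symmetric about it. *)
Lemma end_states : sm = state_of amplitude /\ sp = state_of (- amplitude) /\
  0 < amplitude /\ amplitude < U_sonic /\ amplitude < flux_a - U_sonic.
Proof.
  destruct flux_jumps as [E1 [E2 E3]]. assert (Hm := flux_m_pos). assert (HUm := Um_pos).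
  assert (HUp : 0 < vel sp - c) by lra.
  assert (Sm := state_of_fluxes sm HUm eq_refl flux_a_eq).
  assert (Sp := state_of_fluxes sp HUp E1 E2).
  set (Um := vel sm - c) in *. set (Up := vel sp - c) in *.
  assert (Tm : Rg * temp sm = Um * (flux_a - Um)).
  { rewrite Sm at 1. simpl. replace (U_sonic + (Um - U_sonic)) with Um by ring. field. lra. }
  assert (Tp : Rg * temp sp = Up * (flux_a - Up)).
  { rewrite Sp at 1. simpl. replace (U_sonic + (Up - U_sonic)) with Up by ring. field. lra. }
  assert (Em := supersonic sm ltac:(lra)). assert (Ep := subsonic sp ltac:(lra)).
  fold Um in Em. fold Up in Ep.
  assert (HUs : U_sonic * (gamma + 1) = gamma * flux_a) by (unfold U_sonic; field; lra).
  assert (Hsup : U_sonic < Um).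
  { assert (H : Um * (gamma * (flux_a - Um)) < Um * Um) by nra.
    apply Rmult_lt_reg_l in H; [|exact HUm]. nra. }
  assert (Hsub : Up < U_sonic).
  { assert (H : Up * Up < Up * (gamma * (flux_a - Up))) by nra.
    apply Rmult_lt_reg_l in H; [|exact HUp]. nra. }
  assert (Em' : energy_flux Rg gamma c sm
            = flux_m * (Um ^ 2 / 2 + Um * (flux_a - Um) * (gamma / (gamma - 1)))).
  { unfold energy_flux, internal_energy, pressure. fold Um.
    replace (rho sm * Um) with flux_m by reflexivity.
    replace (Rg * rho sm * temp sm * Um) with (flux_m * (Rg * temp sm))
      by (unfold flux_m, mass_flux, Um; ring).
    replace (Rg / (gamma - 1) * temp sm) with (Rg * temp sm / (gamma - 1)) by (field; lra).
    rewrite Tm. field. lra. }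
  assert (Ep' : energy_flux Rg gamma c sp
            = flux_m * (Up ^ 2 / 2 + Up * (flux_a - Up) * (gamma / (gamma - 1)))).
  { unfold energy_flux, internal_energy, pressure. fold Up.
    replace (rho sp * Up) with flux_m by (rewrite <- E1; reflexivity).
    replace (Rg * rho sp * temp sp * Up) with (flux_m * (Rg * temp sp))
      by (rewrite <- E1; unfold mass_flux, Up; ring).
    replace (Rg / (gamma - 1) * temp sp) with (Rg * temp sp / (gamma - 1)) by (field; lra).
    rewrite Tp. field. lra. }
  assert (Hsum : Um + Up = 2 * U_sonic).
  { rewrite Em', Ep' in E3. apply Rmult_eq_reg_l in E3; [|lra].
    assert (E4 : (Um - Up) * (Um + Up - 2 * U_sonic) = 0).
    { replace (2 * U_sonic) with (2 * (gamma * flux_a / (gamma + 1))) by reflexivity.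
      assert (E5 : (Up ^ 2 / 2 + Up * (flux_a - Up) * (gamma / (gamma - 1))) * (2 * (gamma - 1) / (gamma + 1))
        = (Um ^ 2 / 2 + Um * (flux_a - Um) * (gamma / (gamma - 1))) * (2 * (gamma - 1) / (gamma + 1)))
        by now rewrite E3.
      replace ((Um - Up) * (Um + Up - 2 * (gamma * flux_a / (gamma + 1)))) with
        ((Up ^ 2 / 2 + Up * (flux_a - Up) * (gamma / (gamma - 1))) * (2 * (gamma - 1) / (gamma + 1))
        - (Um ^ 2 / 2 + Um * (flux_a - Um) * (gamma / (gamma - 1))) * (2 * (gamma - 1) / (gamma + 1))).
      - lra.
      - field. lra. }
    apply Rmult_integral in E4. destruct E4; lra. }
  assert (HA : amplitude = (Um - Up) / 2) by (unfold amplitude, Um, Up; lra).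
  split; [rewrite Sm at 1; f_equal; lra|].
  split; [rewrite Sp at 1; f_equal; lra|].
  split; [lra|]. split; [lra|].
  assert (0 < Um * (flux_a - Um)) by (rewrite <- Tm; now apply Rmult_lt_0_compat).
  assert (0 < flux_a - Um) by nra. lra.
Qed.

Lemma U_sonic_eq : U_sonic * (gamma + 1) = gamma * flux_a.
Proof. unfold U_sonic. field. lra. Qed.

(** [gamma / (gamma + 1) > 1 / 2]. *)
Lemma sonic_past_peak : flux_a < 2 * U_sonic.
Proof.
  destruct end_states as [_ [_ [H1 [H2 H3]]]]. assert (H := U_sonic_eq).
  assert (0 < flux_a) by lra. nra.
Qed.

Lemma K_flux_pos : 0 < K_flux.
Proof.
  assert (H := flux_m_pos). apply Rdiv_lt_0_compat; [|lra].
  apply Rmult_lt_0_compat; [now apply Rmult_lt_0_compat | lra].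
Qed.

Lemma b_rate_pos : 0 < b_rate.
Proof. assert (H := K_flux_pos). apply Rdiv_lt_0_compat; nra. Qed.

Lemma b_rate_eq : 2 * K_flux * b_rate = tau ^ 2.
Proof. assert (H := K_flux_pos). unfold b_rate. field. lra. Qed.

Lemma state_of_temp_pos v : - U_sonic < v < flux_a - U_sonic -> 0 < temp (state_of v).
Proof.
  intros Hv. simpl. apply Rdiv_lt_0_compat; [|exact HRg]. apply Rmult_lt_0_compat; lra.
Qed.

Lemma temp_state_of_derive v :
  is_derive (fun u => temp (state_of u)) v ((flux_a - 2 * (U_sonic + v)) / Rg).
Proof. simpl. eapply is_derive_eq; [der; lra|]. cbv beta. field. lra. Qed.

Lemma emit_derive v : - U_sonic < v < flux_a - U_sonic -> is_derive emit v (d_emit v).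
Proof.
  intros Hv. unfold emit, emission. eapply is_derive_eq.
  - apply der_mult; [der|].
    apply (der_comp (fun t => Rpower t alpha) (fun u => temp (state_of u))).
    + apply is_derive_Rpower. now apply state_of_temp_pos.
    + apply temp_state_of_derive.
  - unfold d_emit. cbv beta. ring.
Qed.

Lemma d_emit_cont v : - U_sonic < v < flux_a - U_sonic -> continuous d_emit v.
Proof.
  intros Hv. unfold d_emit. apply cont_mult; [|cont; lra].
  apply cont_mult; [cont|]. apply cont_mult; [cont|].
  apply (cont_comp (fun t => Rpower t (alpha - 1)) (fun u => temp (state_of u))).
  - eapply der_continuous. apply temp_state_of_derive.
  - eapply der_continuous. apply is_derive_Rpower. now apply state_of_temp_pos.
Qed.

Lemma d_emit_sonic : d_emit 0 < 0.
Proof.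
  assert (H := sonic_past_peak). unfold d_emit.
  assert (0 < sigma * (alpha * Rpower (temp (state_of 0)) (alpha - 1))).
  { apply Rmult_lt_0_compat; [exact Hsig|]. apply Rmult_lt_0_compat; [exact Halpha | apply exp_pos]. }
  assert (0 < (2 * (U_sonic + 0) - flux_a) / Rg) by (apply Rdiv_lt_0_compat; lra).
  replace ((flux_a - 2 * (U_sonic + 0)) / Rg) with (- ((2 * (U_sonic + 0) - flux_a) / Rg))
    by (field; lra). nra.
Qed.

(** [R theta = U (a - U)] is a parabola with vertex [a / 2] below the sonic velocity. *)
Lemma temp_state_of_lt v : 0 < v -> temp (state_of v) < temp (state_of (- v)).
Proof.
  intros Hv. assert (H := sonic_past_peak). simpl.
  apply Rmult_lt_compat_r; [now apply Rinv_0_lt_compat|]. nra.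
Qed.

Lemma emit_ends : emit amplitude < emit (- amplitude).
Proof.
  destruct end_states as [_ [_ [H1 [H2 H3]]]].
  unfold emit, emission. apply Rmult_lt_compat_l; [exact Hsig|].
  apply Rlt_Rpower_l; [exact Halpha|]. split.
  - apply state_of_temp_pos. lra.
  - now apply temp_state_of_lt.
Qed.

Lemma state_of_mass v : - U_sonic < v -> mass_flux c (state_of v) = flux_m.
Proof. intros Hv. unfold mass_flux. simpl. field. lra. Qed.

Lemma state_of_momentum v : - U_sonic < v ->
  momentum_flux Rg c (state_of v) = flux_m * flux_a.
Proof. intros Hv. unfold momentum_flux, pressure. simpl. field. lra. Qed.

(** The energy flux is even in [v]: the sonic velocity is where it is maximal. *)
Lemma state_of_energy v : - U_sonic < v ->
  energy_flux Rg gamma c (state_of v) - / sigma_s * (K_flux * (amplitude ^ 2 - v ^ 2))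
  = energy_flux Rg gamma c sm.
Proof.
  intros Hv. destruct end_states as [Sm [_ [H1 [H2 H3]]]].
  rewrite Sm. unfold energy_flux, internal_energy, pressure, K_flux. simpl.
  assert (HU := U_sonic_eq).
  assert (P1 : 0 < gamma * flux_a + amplitude * (gamma + 1)) by (rewrite <- HU; nra).
  assert (P2 : 0 < gamma * flux_a + v * (gamma + 1)) by (rewrite <- HU; nra).
  unfold U_sonic. field. repeat split; lra.
Qed.

Lemma energy_flux_inj v z : - U_sonic < v ->
  energy_flux Rg gamma c (state_of v) - / sigma_s * z = energy_flux Rg gamma c sm ->
  z = K_flux * (amplitude ^ 2 - v ^ 2).
Proof.
  intros Hv E. assert (H := state_of_energy v Hv).
  apply (Rmult_eq_reg_l (/ sigma_s)); [lra|]. apply Rinv_neq_0_compat. lra.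
Qed.

Lemma state_of_lim (F : (R -> Prop) -> Prop) {FF : Filter F} (v : R -> R) (l : R) :
  - U_sonic < l -> filterlim v F (locally l) ->
  state_lim (fun x => state_of (v x)) F (state_of l).
Proof.
  intros Hl Hv. split; [|split]; simpl.
  - apply (lim_comp_cont F v (fun u => flux_m / (U_sonic + u)) l Hv). cont. lra.
  - apply (lim_comp_cont F v (fun u => c + (U_sonic + u)) l Hv). cont.
  - apply (lim_comp_cont F v (fun u => (U_sonic + u) * (flux_a - (U_sonic + u)) / Rg) l Hv).
    cont. lra.
Qed.

Lemma state_of_entropy d : 0 < d -> d < U_sonic -> d < flux_a - U_sonic ->
  entropy_1shock Rg gamma c (state_of d) (state_of (- d)).
Proof.
  intros Hd H1 H2. assert (HU := U_sonic_eq).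
  assert (Harg : forall v, - U_sonic < v ->
    Rg * gamma * temp (state_of v) = (U_sonic + v) * (U_sonic - gamma * v)).
  { intros v Hv. simpl.
    replace (Rg * gamma * ((U_sonic + v) * (flux_a - (U_sonic + v)) / Rg))
      with ((U_sonic + v) * (gamma * flux_a - gamma * (U_sonic + v))) by (field; lra).
    rewrite <- HU. ring. }
  assert (Hvel : forall v, vel (state_of v) - c = U_sonic + v) by (intros; simpl; ring).
  split; [|split].
  - rewrite Hvel. unfold sound_speed. rewrite <- (sqrt_pow2 (U_sonic + d)) by lra.
    apply sqrt_lt_1_alt. split.
    + assert (H := state_of_temp_pos d ltac:(lra)).
      apply Rmult_le_pos; [|lra]. apply Rmult_le_pos; lra.
    + rewrite Harg by lra. simpl. rewrite Rmult_1_r. apply Rmult_lt_compat_l; nra.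
  - rewrite Hvel. lra.
  - rewrite Hvel. unfold sound_speed. rewrite <- (sqrt_pow2 (U_sonic + - d)) by lra.
    apply sqrt_lt_1_alt. split; [apply pow2_ge_0|].
    rewrite Harg by lra. simpl. rewrite Rmult_1_r. apply Rmult_lt_compat_l; nra.
Qed.

(** ** Existence of a profile *)
Theorem shock_profile_exists :
  exists w, shock_profile Rg gamma alpha sigma sigma_s tau c sm sp w.
Proof.
  destruct end_states as [Sm [Sp [HD [HDU HDa]]]].
  assert (HK := K_flux_pos). assert (Hb := b_rate_pos). assert (Hm := flux_m_pos).
  destruct (reduced_profile_exists K_flux b_rate amplitude (- U_sonic) (flux_a - U_sonic)
    emit d_emit HK Hb HD HDa ltac:(lra) emit_derive d_emit_cont emit_ends)
    as (d & n & v & vl & vr & Hd & Hvl & Hvr & Hv0 & Hvl0 & Hvr0 & Hlc & Hrc & Hn & Hsq & Hvd &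
        Hdl & Hdr & HvmI & HvpI & HnmI & HnpI).
  assert (Hbd : forall x, - U_sonic < v x < flux_a - U_sonic).
  { intros x. destruct (Rtotal_order x 0) as [Hx | [-> | Hx]].
    - destruct (Hvl x Hx). lra.
    - lra.
    - destruct (Hvr x Hx). lra. }
  assert (Hnz : forall x, x <> 0 -> v x <> 0).
  { intros x Nx. destruct (Rtotal_order x 0) as [Hx | [Hx | Hx]]; [|contradiction|].
    - destruct (Hvl x Hx). lra.
    - destruct (Hvr x Hx). lra. }
  assert (Hvc : forall x, x <> 0 -> continuous v x).
  { intros x Nx. eapply der_continuous. now apply Hvd. }
  assert (Hnc : forall x, continuous n x).
  { intros x. eapply der_continuous. apply Hn. }
  assert (Hemc : forall u : R -> R, forall x, - U_sonic < u x < flux_a - U_sonic ->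
    continuous u x -> continuous (fun x => emit (u x)) x).
  { intros u x Hu Hc. apply (cont_comp emit u); [exact Hc|].
    eapply der_continuous. now apply emit_derive. }
  assert (Hdvc : forall x, x <> 0 ->
    continuous (fun x => - b_rate * (n x - emit (v x)) / v x) x).
  { intros x Nx. cont; auto. }
  assert (HlimL : filterlim v (at_left 0) (locally d)).
  { apply lim_left_ext with vl.
    - intros y Hy. symmetry. now apply Hvl.
    - rewrite <- Hvl0. apply cont_at_left, Hlc. }
  assert (HlimR : filterlim v (at_right 0) (locally (- d))).
  { apply lim_right_ext with vr.
    - intros y Hy. symmetry. now apply Hvr.
    - rewrite <- Hvr0. apply cont_at_right, Hrc. }
  assert (Hpw : forall F dF : R -> R,
    (forall u, - U_sonic < u < flux_a - U_sonic -> is_derive F u (dF u) /\ continuous dF u) ->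
    piecewise_C1 (0 :: nil) (fun x => F (v x))).
  { intros F dF HF.
    apply (piecewise_C1_comp F dF v (fun x => - b_rate * (n x - emit (v x)) / v x)
             (- U_sonic) (flux_a - U_sonic) d (- d)); auto; lra. }
  assert (HDn : forall x, Derive n x = K_flux * (amplitude ^ 2 - v x ^ 2)).
  { intros x. apply is_derive_unique, Hn. }
  assert (Hzc : forall x, continuous (fun x => K_flux * (amplitude ^ 2 - v x ^ 2)) x).
  { intros x. apply cont_mult; [cont|].
    apply (cont_minus (fun _ => amplitude ^ 2) (fun x => v x ^ 2)); [cont | apply Hsq]. }
  exists (Wave (fun x => state_of (v x)) n). split; [|split].
  - split; [|split].
    + intros x. simpl. split.
      * apply Rdiv_lt_0_compat; [exact Hm|]. assert (H := Hbd x). lra.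
      * now apply (state_of_temp_pos (v x)).
    + split.
      2: { apply C1_intro with (fun x => K_flux * (amplitude ^ 2 - v x ^ 2)); assumption. }
      exists (if Req_EM_T d 0 then nil else 0 :: nil), (0 :: nil). simpl.
      split; [|split; [|split; [|split]]].
      * apply (Hpw (fun u => flux_m / (U_sonic + u)) (fun u => - flux_m / (U_sonic + u) ^ 2)).
        intros u Hu. split.
        -- eapply is_derive_eq; [der; lra | cbv beta; field; lra].
        -- cont. assert (0 < (U_sonic + u) ^ 2) by (apply pow2_gt_0; lra). lra.
      * apply (Hpw (fun u => c + (U_sonic + u)) (fun _ => 1)).
        intros u Hu. split; [|cont]. eapply is_derive_eq; [der | ring].
      * apply (Hpw (fun u => temp (state_of u)) (fun u => (flux_a - 2 * (U_sonic + u)) / Rg)).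
        intros u Hu. split; [apply temp_state_of_derive | cont; lra].
      * intros x Nin. apply (state_of_lim (locally x)); [assert (H := Hbd x); lra|].
        destruct (Req_dec x 0) as [-> | Nx]; [|now apply Hvc].
        destruct (Req_EM_T d 0) as [Ed | Nd]; [|exfalso; apply Nin; now left].
        (* [v ^ 2] is continuous and vanishes here, so [v] tends to 0 *)
        apply (lim_locally (locally 0)). intros e He.
        destruct (proj1 (cont_eps _ 0) (Hsq 0) (e ^ 2)) as [dl [Hdl0 Hn0]]; [nra|].
        apply locally_R. exists dl. split; [exact Hdl0|]. intros y Hy.
        specialize (Hn0 y Hy). cbv beta in Hn0. rewrite Hv0, Ed in *.
        replace (v y ^ 2 - 0 ^ 2) with (v y ^ 2) in Hn0 by ring.
        rewrite Rabs_right in Hn0 by (apply Rle_ge, pow2_ge_0).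
        rewrite Rminus_0_r. apply Rabs_def1; nra.
      * intros x Hin. destruct (Req_EM_T d 0) as [Ed | Nd]; [destruct Hin|].
        destruct Hin as [<- | []]. exists (state_of d), (state_of (- d)).
        split; [apply (state_of_lim (at_left 0)); [lra | exact HlimL]|].
        split; [apply (state_of_lim (at_right 0)); [lra | exact HlimR]|].
        apply state_of_entropy; lra.
    + split; [|split; [|split]]; cbn [hydro rad].
      * apply weak_derivative_of_constant with flux_m. intros x. apply state_of_mass, Hbd.
      * apply weak_derivative_of_constant with (flux_m * flux_a).
        intros x. apply state_of_momentum, Hbd.
      * apply weak_derivative_of_constant with (energy_flux Rg gamma c sm).
        intros x. rewrite HDn. apply state_of_energy, Hbd.
      * apply (weak_derivative_glue _ _ (fun x => tau ^ 2 * (n x - emit (vl x)))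
                 (fun x => tau ^ 2 * (n x - emit (vr x)))).
        -- intros x. apply continuous_ext with (fun x => K_flux * (amplitude ^ 2 - v x ^ 2)).
           ++ intros y. symmetry. apply HDn.
           ++ apply Hzc.
        -- intros x. cont; [apply Hnc|]. apply Hemc; apply Hlc.
        -- intros x. cont; [apply Hnc|]. apply Hemc; apply Hrc.
        -- intros x Hx. destruct (Hvl x Hx) as [_ <-]. reflexivity.
        -- intros x Hx. destruct (Hvr x Hx) as [_ <-]. reflexivity.
        -- intros x Nx. apply is_derive_ext with (fun x => K_flux * (amplitude ^ 2 - v x ^ 2)).
           { intros y. symmetry. apply HDn. }
           eapply is_derive_eq; [der; now apply Hvd|].
           rewrite <- b_rate_eq. cbv beta. fold (emit (v x)). field. now apply Hnz.
  - split; [|split]; simpl.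
    + rewrite Sm. apply (state_of_lim (Rbar_locally m_infty)); [lra | exact HvmI].
    + rewrite Sm. exact HnmI.
    + apply (filterlim_ext (fun x => K_flux * (amplitude ^ 2 - v x ^ 2))).
      { intros x. symmetry. apply HDn. }
      replace 0 with (K_flux * (amplitude ^ 2 - amplitude ^ 2)) by ring.
      apply (lim_comp_cont (Rbar_locally m_infty) v
               (fun u => K_flux * (amplitude ^ 2 - u ^ 2)) amplitude HvmI). cont.
  - split; [|split]; simpl.
    + rewrite Sp. apply (state_of_lim (Rbar_locally p_infty)); [lra | exact HvpI].
    + rewrite Sp. exact HnpI.
    + apply (filterlim_ext (fun x => K_flux * (amplitude ^ 2 - v x ^ 2))).
      { intros x. symmetry. apply HDn. }
      replace 0 with (K_flux * (amplitude ^ 2 - (- amplitude) ^ 2)) by ring.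
      apply (lim_comp_cont (Rbar_locally p_infty) v
               (fun u => K_flux * (amplitude ^ 2 - u ^ 2)) (- amplitude) HvpI). cont.
Qed.

(** ** From a profile to the planar system *)
Definition rel_vel (w : wave) (x : R) : R := vel (hydro w x) - c - U_sonic.

Lemma off_list_left (J : list R) x : at_left x (fun y => ~ In y J).
Proof.
  destruct (list_isolated J x) as [d [Hd H]]. apply at_left_R. exists d. split; [exact Hd|].
  intros y Hy. apply H. rewrite Rabs_left; lra.
Qed.

Lemma off_list_right (J : list R) x : at_right x (fun y => ~ In y J).
Proof.
  destruct (list_isolated J x) as [d [Hd H]]. apply at_right_R. exists d. split; [exact Hd|].
  intros y Hy. apply H. rewrite Rabs_right; lra.
Qed.

Lemma supersonic_rel s : s = state_of (vel s - c - U_sonic) -> 0 < vel s - c ->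
  sound_speed Rg gamma s < vel s - c -> 0 < vel s - c - U_sonic.
Proof.
  intros E HU H. apply supersonic in H. assert (HUs := U_sonic_eq).
  set (U := vel s - c) in *.
  assert (Et : Rg * temp s = U * (flux_a - U)).
  { rewrite E at 1. simpl. replace (U_sonic + (U - U_sonic)) with U by ring. field. lra. }
  assert (H1 : U * (gamma * (flux_a - U)) < U * U) by nra.
  apply Rmult_lt_reg_l in H1; [|exact HU]. nra.
Qed.

Lemma subsonic_rel s : s = state_of (vel s - c - U_sonic) ->
  0 < vel s - c < sound_speed Rg gamma s -> vel s - c - U_sonic < 0.
Proof.
  intros E H. assert (HU := proj1 H). apply subsonic in H. assert (HUs := U_sonic_eq).
  set (U := vel s - c) in *.
  assert (Et : Rg * temp s = U * (flux_a - U)).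
  { rewrite E at 1. simpl. replace (U_sonic + (U - U_sonic)) with U by ring. field. lra. }
  assert (H1 : U * U < U * (gamma * (flux_a - U))) by nra.
  apply Rmult_lt_reg_l in H1; [|exact HU]. nra.
Qed.

Definition jump_at (w : wave) (x vl : R) : Prop :=
  0 < vl /\ vl < U_sonic /\
  state_lim (hydro w) (at_left x) (state_of vl) /\
  state_lim (hydro w) (at_right x) (state_of (- vl)).

(** The conservation laws hold with constants taken from the left end state, at every
    point of continuity by [weak_constant] and at a jump by passing to one-sided
    limits. *)
Lemma profile_facts w : shock_profile Rg gamma alpha sigma sigma_s tau c sm sp w ->
  exists J : list R,
    (forall x, ~ In x J -> state_continuous (hydro w) x /\
       hydro w x = state_of (rel_vel w x) /\
       - U_sonic < rel_vel w x < flux_a - U_sonic /\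
       Derive (rad w) x = K_flux * (amplitude ^ 2 - rel_vel w x ^ 2) /\
       is_derive (Derive (rad w)) x (tau ^ 2 * (rad w x - emit (rel_vel w x)))) /\
    (forall x, In x J -> exists vl, jump_at w x vl) /\
    (forall x, is_derive (rad w) x (Derive (rad w) x) /\ continuous (Derive (rad w)) x).
Proof.
  intros [[Hpos [[HJB HC1] Heqs]] [Hmi Hpi]].
  destruct HJB as [J [B [_ [_ [_ [Hcont Hjump]]]]]].
  destruct Heqs as [W1 [W2 [W3 W4]]].
  assert (Hm := flux_m_pos).
  assert (Hrad : forall x, is_derive (rad w) x (Derive (rad w) x) /\ continuous (Derive (rad w)) x).
  { intros x. split; [now apply C1_is_derive | apply HC1]. }
  assert (F1 : forall x, ~ In x J -> mass_flux c (hydro w x) = flux_m).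
  { apply (weak_constant_limit _ J flux_m W1).
    - intros x Hx. exact (mass_flux_lim (locally x) c (hydro w) _ (Hcont x Hx)).
    - exact (mass_flux_lim (Rbar_locally m_infty) c (hydro w) sm (proj1 Hmi)). }
  assert (F2 : forall x, ~ In x J -> momentum_flux Rg c (hydro w x) = flux_m * flux_a).
  { apply (weak_constant_limit _ J _ W2).
    - intros x Hx. exact (momentum_flux_lim (locally x) Rg c (hydro w) _ (Hcont x Hx)).
    - rewrite <- flux_a_eq.
      exact (momentum_flux_lim (Rbar_locally m_infty) Rg c (hydro w) sm (proj1 Hmi)). }
  assert (F3 : forall x, ~ In x J ->
    energy_flux Rg gamma c (hydro w x) - / sigma_s * Derive (rad w) x
    = energy_flux Rg gamma c sm).
  { apply (weak_constant_limit
      (fun x => energy_flux Rg gamma c (hydro w x) - / sigma_s * Derive (rad w) x) J _ W3).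
    - intros x Hx. apply cont_minus.
      + exact (energy_flux_lim (locally x) Rg gamma c (hydro w) _ (Hcont x Hx)).
      + cont. apply HC1.
    - replace (energy_flux Rg gamma c sm) with (energy_flux Rg gamma c sm - / sigma_s * 0) by ring.
      apply (lim_minus (Rbar_locally m_infty)).
      + exact (energy_flux_lim (Rbar_locally m_infty) Rg gamma c (hydro w) sm (proj1 Hmi)).
      + apply (lim_mult (Rbar_locally m_infty)); [apply (lim_const (Rbar_locally m_infty)) | apply Hmi]. }
  assert (Hstate : forall x, ~ In x J -> hydro w x = state_of (rel_vel w x) /\
       - U_sonic < rel_vel w x < flux_a - U_sonic).
  { intros x Hx. destruct (Hpos x) as [Hr Ht]. assert (E1 := F1 x Hx).
    assert (HU : 0 < vel (hydro w x) - c).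
    { apply (Rmult_lt_reg_l (rho (hydro w x))); [exact Hr|]. rewrite Rmult_0_r.
      unfold mass_flux in E1. rewrite E1. exact Hm. }
    assert (E := state_of_fluxes (hydro w x) HU E1 (F2 x Hx)). fold (rel_vel w x) in E.
    split; [exact E|]. rewrite E in Ht. simpl in Ht.
    assert (HUv : 0 < U_sonic + rel_vel w x) by (unfold rel_vel; lra). split; [lra|].
    assert (0 < (U_sonic + rel_vel w x) * (flux_a - (U_sonic + rel_vel w x))).
    { apply (Rmult_lt_reg_r (/ Rg)); [now apply Rinv_0_lt_compat|]. rewrite Rmult_0_l. exact Ht. }
    nra. }
  assert (Hside : forall (F : (R -> Prop) -> Prop) (FF : ProperFilter F) x s,
    F (fun y => ~ In y J) -> filter_le F (locally x) -> state_lim (hydro w) F s ->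
    0 < vel s - c ->
    s = state_of (vel s - c - U_sonic) /\
    Derive (rad w) x = K_flux * (amplitude ^ 2 - (vel s - c - U_sonic) ^ 2)).
  { intros F FF x s HF Hle Hs HU.
    assert (Hconst : forall (f : R -> R) a b, (forall y, ~ In y J -> f y = a) ->
      filterlim f F (locally b) -> b = a).
    { intros f a b Hf Hb. apply (lim_unique_R F f _ _ Hb).
      apply (filterlim_ext_loc (fun _ => a)); [|apply (lim_const F)].
      apply (filter_imp (fun y => ~ In y J)); [|exact HF]. intros y Hy. symmetry. now apply Hf. }
    assert (E1 := Hconst _ _ _ F1 (mass_flux_lim F c (hydro w) s Hs)).
    assert (E2 := Hconst _ _ _ F2 (momentum_flux_lim F Rg c (hydro w) s Hs)).
    assert (E := state_of_fluxes s HU E1 E2). split; [exact E|].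
    apply energy_flux_inj; [lra|]. rewrite <- E.
    apply (Hconst (fun x => energy_flux Rg gamma c (hydro w x) - / sigma_s * Derive (rad w) x)
             _ _ F3).
    apply (lim_minus F); [exact (energy_flux_lim F Rg gamma c (hydro w) s Hs)|].
    apply (lim_mult F); [apply (lim_const F)|].
    eapply filterlim_filter_le_1; [exact Hle | apply HC1]. }
  exists J. split; [|split; [|exact Hrad]].
  - intros x Hx. destruct (Hstate x Hx) as [E Hb].
    split; [now apply Hcont|]. split; [exact E|]. split; [exact Hb|]. split.
    + apply energy_flux_inj; [apply Hb|]. rewrite <- E. now apply F3.
    + destruct (list_isolated J x) as [d [Hd Hiso]].
      assert (Hoff : forall y, Rabs (y - x) < d -> ~ In y J).
      { intros y Hy. destruct (Req_dec y x) as [-> | N]; [exact Hx|].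
        apply Hiso. split; [apply Rabs_pos_lt; lra | exact Hy]. }
      unfold emit. rewrite <- E.
      apply (weak_derivative_strong (Derive (rad w))
        (fun x => tau ^ 2 * (rad w x - emission alpha sigma (hydro w x))) (x - d / 2) (x + d / 2));
        [exact W4 | | intros y _; apply HC1 | lra].
      intros y Hy. assert (HyJ : ~ In y J) by (apply Hoff, Rabs_def1; lra).
      apply cont_mult; [cont|]. apply cont_minus; [now apply C1_continuous|].
      apply emission_cont; [apply Hpos | apply (Hcont y HyJ)].
  - intros x Hx. destruct (Hjump x Hx) as [sl [sr [Hl [Hr [Hel Her]]]]].
    assert (HUl : 0 < vel sl - c).
    { assert (H := sqrt_pos (Rg * gamma * temp sl)). unfold sound_speed in Hel. lra. }
    destruct (Hside (at_left x) _ x sl (off_list_left J x)) as [El Zl];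
      [apply filter_le_within | exact Hl | exact HUl |].
    destruct (Hside (at_right x) _ x sr (off_list_right J x)) as [Er Zr];
      [apply filter_le_within | exact Hr | lra |].
    assert (Hvl := supersonic_rel sl El HUl Hel). assert (Hvr := subsonic_rel sr Er Her).
    set (vl := vel sl - c - U_sonic) in *. set (vr := vel sr - c - U_sonic) in *.
    assert (HK := K_flux_pos).
    assert (Evr : vr = - vl).
    { rewrite Zl in Zr. apply Rmult_eq_reg_l in Zr; [|lra]. nra. }
    exists vl. split; [exact Hvl|]. split; [unfold vl, vr in *; lra|].
    split; [rewrite <- El; exact Hl | rewrite <- Evr, <- Er; exact Hr].
Qed.

(** The derivative of [v] is recovered from that of [v ^ 2 = D^2 - n' / K], which exists
    wherever [v] is continuous. *)
Lemma profile_reduction w : shock_profile Rg gamma alpha sigma sigma_s tau c sm sp w ->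
  exists x1 : R,
    reduced_profile K_flux b_rate amplitude (- U_sonic) (flux_a - U_sonic) emit
      x1 (rad w) (rel_vel w) (Derive (rad w)) /\
    (forall x, x <> x1 -> state_continuous (hydro w) x /\ hydro w x = state_of (rel_vel w x)) /\
    ((state_continuous (hydro w) x1 /\ hydro w x1 = state_of (rel_vel w x1)) \/
     (exists vl, jump_at w x1 vl)).
Proof.
  intros Hw. destruct (profile_facts w Hw) as [J [Hoff [HJ Hrad]]].
  destruct Hw as [_ [Hmi Hpi]].
  destruct end_states as [Sm [Sp [HA [HAU HAa]]]].
  assert (HK := K_flux_pos). assert (Hb := b_rate_pos). assert (Hkap := b_rate_eq).
  set (v := rel_vel w) in *. set (n := rad w) in *. set (z := Derive n) in *.
  assert (Hvc : forall x, ~ In x J -> continuous v x).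
  { intros x Hx. destruct (Hoff x Hx) as [[_ [Hu _]] _]. unfold v, rel_vel.
    apply (cont_minus (fun x => vel (hydro w x) - c)); [|cont].
    apply (cont_minus (fun x => vel (hydro w x))); [exact Hu | cont]. }
  assert (Hvlim : forall (F : (R -> Prop) -> Prop) (FF : Filter F) u,
    state_lim (hydro w) F (state_of u) -> filterlim v F (locally u)).
  { intros F FF u [_ [Hu _]]. simpl in Hu.
    replace u with (c + (U_sonic + u) - c - U_sonic) by ring.
    unfold v, rel_vel. apply (lim_minus F); [|apply (lim_const F)].
    apply (lim_minus F); [exact Hu | apply (lim_const F)]. }
  destruct (list_bounded J) as [MJ [HMJ HJb]].
  assert (HvmI : filterlim v (Rbar_locally m_infty) (locally amplitude)).
  { apply (Hvlim (Rbar_locally m_infty) _). rewrite <- Sm. apply Hmi. }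
  assert (HvpI : filterlim v (Rbar_locally p_infty) (locally (- amplitude))).
  { apply (Hvlim (Rbar_locally p_infty) _). rewrite <- Sp. apply Hpi. }
  destruct (sign_change_once (fun x => ~ In x J /\ 0 < v x) (fun x => ~ In x J /\ v x < 0))
    as [x1 [HP HN]].
  - intros x [_ H1] [_ H2]. lra.
  - intros x. destruct (classic (In x J)) as [Hin | Hout].
    + destruct (HJ x Hin) as [vl [Hvl [_ [Hl Hr]]]].
      assert (Hl' := Hvlim (at_left x) _ vl Hl). assert (Hr' := Hvlim (at_right x) _ (- vl) Hr).
      destruct (proj1 (lim_left v x vl) Hl' vl Hvl) as [d1 [Hd1 Hn1]].
      destruct (proj1 (lim_right v x (- vl)) Hr' vl Hvl) as [d2 [Hd2 Hn2]].
      destruct (list_isolated J x) as [d3 [Hd3 Hn3]].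
      destruct (pick_small d1 d2 Hd1 Hd2) as [d4 [Hd4 [H1 H2]]].
      destruct (pick_small d3 d4 Hd3 Hd4) as [d [Hd [H3 H4]]].
      exists d. split; [exact Hd|].
      right; right. split; intros y Hy; split.
      * apply Hn3. rewrite Rabs_left; lra.
      * specialize (Hn1 y ltac:(lra)). apply Rabs_def2 in Hn1. lra.
      * apply Hn3. rewrite Rabs_right; lra.
      * specialize (Hn2 y ltac:(lra)). apply Rabs_def2 in Hn2. lra.
    + destruct (list_isolated J x) as [d3 [Hd3 Hn3]].
      assert (HoffJ : forall y, Rabs (y - x) < d3 -> ~ In y J).
      { intros y Hy. destruct (Req_dec y x) as [-> | N]; [exact Hout|].
        apply Hn3. split; [apply Rabs_pos_lt; lra | exact Hy]. }
      destruct (Rtotal_order (v x) 0) as [Hlt | [Heq | Hgt]].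
      * destruct (cont_pos_near (fun x => - v x) x) as [d [Hd Hn]];
          [cont; now apply Hvc | lra |].
        destruct (pick_small d3 d Hd3 Hd) as [d4 [Hd4 [H1 H2]]]. exists d4. split; [exact Hd4|].
        right; left. intros y Hy. split; [apply HoffJ; lra|].
        specialize (Hn y ltac:(lra)). lra.
      * destruct (sonic_crossing (fun y => ~ In y J) K_flux amplitude (tau ^ 2) (d_emit 0) emit v n z x)
          as [d [Hd [Hl Hr]]]; auto.
        -- rewrite <- b_rate_eq. apply Rmult_lt_0_compat; lra.
        -- apply emit_derive. lra.
        -- apply d_emit_sonic.
        -- intros y. apply list_isolated.
        -- intros y Hy. split; [now apply Hvc|].
           destruct (Hoff y Hy) as [_ [_ [_ [E1 E2]]]]. split; [exact E1 | exact E2].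
        -- intros y. apply Hrad.
        -- exists d. split; [exact Hd|]. right; right. split; [exact Hl | exact Hr].
      * destruct (cont_pos_near v x) as [d [Hd Hn]]; [now apply Hvc | lra |].
        destruct (pick_small d3 d Hd3 Hd) as [d4 [Hd4 [H1 H2]]]. exists d4. split; [exact Hd4|].
        left. intros y Hy. split; [apply HoffJ; lra|]. apply Hn. lra.
  - destruct (proj1 (lim_minf v amplitude) HvmI amplitude HA) as [M HM].
    destruct (exists_below M (- MJ)) as [M' [H1 H2]]. exists M'. intros x Hx. split; [intros Hin; specialize (HJb x Hin); lra|].
    specialize (HM x ltac:(lra)). apply Rabs_def2 in HM. lra.
  - destruct (proj1 (lim_pinf v (- amplitude)) HvpI amplitude HA) as [M HM].
    exists (Rmax M MJ). assert (H1 := Rmax_l M MJ). assert (H2 := Rmax_r M MJ).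
    intros x Hx. split; [intros Hin; specialize (HJb x Hin); lra|].
    specialize (HM x ltac:(lra)). apply Rabs_def2 in HM. lra.
  - assert (HoffJ : forall x, x <> x1 -> ~ In x J).
    { intros x N. destruct (Rtotal_order x x1) as [H | [H | H]];
        [now apply HP | contradiction | now apply HN]. }
    exists x1. split; [|split].
    + assert (Hvd : forall x, x <> x1 -> v x <> 0 ->
        is_derive v x (- b_rate * (n x - emit (v x)) / v x)).
      { intros x N Nv. assert (Hx := HoffJ x N).
        destruct (Hoff x Hx) as [_ [_ [_ [_ E2]]]]. fold z in E2.
        eapply is_derive_eq.
        - apply (derive_of_square v (fun y => amplitude ^ 2 - z y / K_flux) x
            (- (2 * b_rate * (n x - emit (v x))))); [now apply Hvc | exact Nv | |].
          + destruct (list_isolated J x) as [d [Hd Hiso]].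
            apply locally_R. exists d. split; [exact Hd|]. intros y Hy.
            assert (HyJ : ~ In y J).
            { destruct (Req_dec y x) as [-> | Ny]; [exact Hx|].
              apply Hiso. split; [apply Rabs_pos_lt; lra | exact Hy]. }
            destruct (Hoff y HyJ) as [_ [_ [_ [E1 _]]]]. fold z v in E1. rewrite E1. field. lra.
          + eapply is_derive_eq; [der; lra|].
            rewrite <- b_rate_eq. unfold v. cbv beta. field. lra.
        - field. exact Nv. }
      split; [|split; [|split; [|split]]].
      * split; [|split; [exact HvmI|]].
        -- intros x Hx. destruct (HP x Hx) as [HxJ Hvx].
           destruct (Hoff x HxJ) as [_ [_ [Hbd [E1 _]]]]. fold z v in E1, Hbd.
           split; [lra|]. split; [rewrite <- E1; apply Hrad|]. apply Hvd; lra.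
        -- unfold emit. rewrite <- Sm. apply Hmi.
      * split; [|split].
        -- intros x Hx. destruct (HN (- x) ltac:(lra)) as [HxJ Hvx].
           destruct (Hoff (- x) HxJ) as [_ [_ [Hbd [E1 _]]]]. fold z v in E1, Hbd.
           split; [lra|]. split.
           ++ eapply is_derive_eq.
              ** apply der_opp, (der_comp n (fun x => - x)); [apply Hrad | der].
              ** fold z. rewrite E1. ring.
           ++ eapply is_derive_eq.
              ** apply der_opp, (der_comp v (fun x => - x)); [apply Hvd; lra | der].
              ** unfold Gr. rewrite Ropp_involutive. field. lra.
        -- replace amplitude with (- - amplitude) at 1 by ring.
           apply (lim_opp (Rbar_locally m_infty)). now apply lim_pinf_reflect.
        -- unfold Gr. apply (lim_opp (Rbar_locally m_infty)). apply lim_pinf_reflect.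
           unfold emit. rewrite <- Sp. apply Hpi.
      * eapply der_continuous. apply Hrad.
      * apply Hrad.
      * intros x N. destruct (Hoff x (HoffJ x N)) as [_ [_ [_ [E1 _]]]]. exact E1.
    + intros x N. destruct (Hoff x (HoffJ x N)) as [E1 [E2 _]]. split; [exact E1 | exact E2].
    + destruct (classic (In x1 J)) as [Hin | Hout].
      * right. now apply HJ.
      * left. destruct (Hoff x1 Hout) as [E1 [E2 _]]. split; [exact E1 | exact E2].
Qed.

(** ** Uniqueness and discontinuities *)
Lemma jump_not_continuous w x vl : jump_at w x vl -> ~ state_continuous (hydro w) x.
Proof.
  intros [Hvl [_ [[_ [Hl _]] [_ [Hr _]]]]] [_ [Hu _]]. simpl in Hl, Hr.
  assert (E1 := lim_unique_R (at_left x) _ _ _ Hl (cont_at_left _ x Hu)).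
  assert (E2 := lim_unique_R (at_right x) _ _ _ Hr (cont_at_right _ x Hu)). lra.
Qed.

Lemma rel_vel_lim (F : (R -> Prop) -> Prop) {FF : Filter F} w s :
  state_lim (hydro w) F s -> filterlim (rel_vel w) F (locally (vel s - c - U_sonic)).
Proof. intros [_ [Hu _]]. unfold rel_vel. limit F. Qed.

(** Both profiles are governed by the same matched [d]; the values of the state at a jump
    are not compared, and a profile that is continuous at its transition point forces
    the other one to be so. *)
Theorem shock_profile_unique w1 w2 :
  shock_profile Rg gamma alpha sigma sigma_s tau c sm sp w1 ->
  shock_profile Rg gamma alpha sigma sigma_s tau c sm sp w2 ->
  same_up_to_translation w1 w2.
Proof.
  intros H1 H2. destruct end_states as [_ [_ [HA [HAU HAa]]]].
  destruct (profile_reduction w1 H1) as [x1 [R1 [Off1 At1]]].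
  destruct (profile_reduction w2 H2) as [x2 [R2 [Off2 At2]]].
  assert (Hu := reduced_profile_unique K_flux b_rate amplitude (- U_sonic) (flux_a - U_sonic)
    emit d_emit K_flux_pos b_rate_pos HA HAa ltac:(lra) emit_derive d_emit_cont emit_ends
    _ _ _ _ _ _ _ _ R1 R2).
  set (h := x1 - x2) in Hu. exists h. intros x. destruct (Hu x) as [En Ev].
  split; [exact En|]. intros Hnd.
  destruct (Req_dec x x2) as [-> | N].
  2: { destruct (Off2 x N) as [_ ->]. destruct (Off1 (x + h)) as [_ ->]; [unfold h; lra|].
       now rewrite Ev. }
  replace (x2 + h) with x1 in * by (unfold h; ring).
  assert (Hsc1 : state_continuous (hydro w1) x1).
  { apply NNPP. intros Hno. apply Hnd. intros [Hs _]. contradiction. }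
  destruct At1 as [[_ E1] | [vl Hj]]; [|now apply jump_not_continuous in Hj].
  assert (Hl1 : filterlim (rel_vel w1) (locally x1) (locally (rel_vel w1 x1)))
    by exact (rel_vel_lim (locally x1) w1 _ Hsc1).
  assert (Hl2 : filterlim (rel_vel w2) (at_left x2) (locally (rel_vel w1 x1))).
  { apply lim_left_ext with (fun y => rel_vel w1 (y + h)).
    - intros y Hy. symmetry. apply Hu. lra.
    - replace x2 with (x1 - h) by (unfold h; ring). apply lim_left_shift, cont_at_left, Hl1. }
  assert (Hr2 : filterlim (rel_vel w2) (at_right x2) (locally (rel_vel w1 x1))).
  { apply lim_right_reflect.
    apply lim_left_ext with (fun y => rel_vel w1 (- (y + - h))).
    - intros y Hy. replace (- (y + - h)) with (- y + h) by ring. symmetry. apply Hu. lra.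
    - replace (- x2) with (- x1 - - h) by (unfold h; ring).
      apply (lim_left_shift (fun y => rel_vel w1 (- y))), lim_right_reflect, cont_at_right, Hl1. }
  destruct At2 as [[Hsc2 E2] | [vl [Hvl [_ [Jl Jr]]]]].
  - rewrite E1, E2. f_equal.
    apply (lim_unique_R (at_left x2) (rel_vel w2)); [|exact Hl2].
    apply cont_at_left. exact (rel_vel_lim (locally x2) w2 _ Hsc2).
  - exfalso.
    assert (Q1 := lim_unique_R (at_left x2) _ _ _ (rel_vel_lim (at_left x2) w2 _ Jl) Hl2).
    assert (Q2 := lim_unique_R (at_right x2) _ _ _ (rel_vel_lim (at_right x2) w2 _ Jr) Hr2).
    simpl in Q1, Q2. lra.
Qed.

Theorem shock_profile_discontinuity w :
  shock_profile Rg gamma alpha sigma sigma_s tau c sm sp w ->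
  (forall x y, wave_discontinuity w x -> wave_discontinuity w y -> x = y) /\
  (forall x, wave_discontinuity w x ->
     has_jump (fun y => rho (hydro w y)) x /\
     has_jump (fun y => vel (hydro w y)) x /\
     has_jump (fun y => temp (hydro w y)) x).
Proof.
  intros Hw. destruct (profile_reduction w Hw) as [x1 [_ [Off At]]].
  assert (Hrad : forall x, continuous (rad w) x).
  { intros x. apply C1_continuous. destruct Hw as [[_ [[_ HC] _]] _]. exact HC. }
  assert (Hx1 : forall x, wave_discontinuity w x -> x = x1).
  { intros x Hd. apply NNPP. intros N. apply Hd. split; [now apply Off | apply Hrad]. }
  split.
  - intros x y Hx Hy. rewrite (Hx1 x Hx). symmetry. now apply Hx1.
  - intros x Hd. assert (E := Hx1 x Hd). rewrite E in Hd |- *.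
    destruct At as [[Hs _] | [vl [Hvl [HvU [[Lr [Lu Lt]] [Rr [Ru Rt]]]]]]].
    { exfalso. apply Hd. split; [exact Hs | apply Hrad]. }
    assert (Hm := flux_m_pos).
    split; [|split].
    + exists (rho (state_of vl)), (rho (state_of (- vl))). split; [|split; [exact Lr | exact Rr]].
      simpl. apply Rlt_not_eq. unfold Rdiv. apply Rmult_lt_compat_l; [exact Hm|].
      apply Rinv_lt_contravar; nra.
    + exists (vel (state_of vl)), (vel (state_of (- vl))). split; [|split; [exact Lu | exact Ru]].
      simpl. lra.
    + exists (temp (state_of vl)), (temp (state_of (- vl))). split; [|split; [exact Lt | exact Rt]].
      apply Rlt_not_eq. now apply temp_state_of_lt.
Qed.

End Gas.

Theorem theorem1p1 :
  forall (Rg gamma alpha sigma sigma_s tau c : R) (sm sp : state),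
    0 < Rg -> 1 < gamma -> 0 < alpha ->
    0 < sigma -> 0 < sigma_s -> 0 < tau ->
    0 < rho sm -> 0 < temp sm -> 0 < rho sp -> 0 < temp sp ->
    rankine_hugoniot Rg gamma c sm sp ->
    c + sound_speed Rg gamma sm < vel sm ->
    c < vel sp < c + sound_speed Rg gamma sp ->
    (exists w, shock_profile Rg gamma alpha sigma sigma_s tau c sm sp w) /\
    (forall w1 w2,
       shock_profile Rg gamma alpha sigma sigma_s tau c sm sp w1 ->
       shock_profile Rg gamma alpha sigma sigma_s tau c sm sp w2 ->
       same_up_to_translation w1 w2) /\
    (forall w, shock_profile Rg gamma alpha sigma sigma_s tau c sm sp w ->
       (forall x y, wave_discontinuity w x -> wave_discontinuity w y -> x = y) /\
       (forall x, wave_discontinuity w x ->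
          has_jump (fun y => rho (hydro w y)) x /\
          has_jump (fun y => vel (hydro w y)) x /\
          has_jump (fun y => temp (hydro w y)) x)).
Proof.
  intros. split; [|split].
  - now apply shock_profile_exists.
  - intros w1 w2. now apply shock_profile_unique.
  - intros w. now apply shock_profile_discontinuity.
Qed.
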